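(* Let all the standing assumptions listed in the context hold, with step sequence $\gamma_k\asymp k^{-\theta}$. Let $\beta\in(0,1]$ and let $\varphi:\mathbb{R}^d\to\mathbb{R}$ satisfy $(\mathbf{T}_\beta)$. Suppose that there exists $\vartheta\in\mathcal{C}^{3,\beta}(\mathbb{R}^d,\mathbb{R})$ satisfying $(\mathbf{T}_\beta)$ such that $$\mathcal{A}\vartheta=|\sigma^*\nabla\varphi|^2-\nu\big(|\sigma^*\nabla\varphi|^2\big).$$ Then, for $\theta\in(\frac1{2+\beta},1]$, there exist explicit non-negative sequences $(c_n)_{n\ge1}$ and $(C_n)_{n\ge1}$, respectively increasing and decreasing for $n$ large enough, with $\lim_nC_n=\lim_nc_n=1$, such that for all $n\ge1$ and all $a>0$ satisfying $\frac{a}{\sqrt{\Gamma_n}}\to0$ (the regime of ''Gaussian deviations'', in which $a$ may depend on $n$), the following bound holds: $$\mathbb{P}\big[\,|\sqrt{\Gamma_n}\,\nu_n(\mathcal{A}\varphi)|\ge a\big]\le 2\,C_n\exp\Big(-c_n\frac{a^2}{2\,\nu(|\sigma^*\nabla\varphi|^2)}\Big).$$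
   Context: **Notation.** $|\cdot|$ is the Euclidean norm; for a matrix $M$, $\|M\|=\mathrm{Tr}(MM^* )^{1/2}$ is the Frobenius norm; for a bounded vector- or matrix-valued map $\zeta$ on $\mathbb{R}^d$, $\|\zeta\|_\infty=\sup_x\|\zeta(x)\|$. For $u_n,v_n>0$, $u_n\asymp v_n$ means there are $n_0$ and $C\ge1$ with $C^{-1}v_n\le u_n\le Cv_n$ for $n\ge n_0$. For $k\ge0$ and $\beta\in(0,1]$, $\mathcal{C}^{k,\beta}(\mathbb{R}^d,\mathbb{R}^m)$ is the set of $k$-times continuously differentiable functions whose partial derivatives of orders $1,\dots,k$ are bounded and whose partial derivatives of order $k$ are (globally) $\beta$-Hölder continuous (the function itself need not be bounded). **Diffusion.** $b:\mathbb{R}^d\to\mathbb{R}^d$ and $\sigma:\mathbb{R}^d\to\mathbb{R}^d\otimes\mathbb{R}^r$ are Lipschitz continuous, $dY_t=b(Y_t)dt+\sigma(Y_t)dW_t$ with $W$ an $r$-dimensional Wiener process, $\Sigma=\sigma\sigma^*$, and the generator is $\mathcal{A}g(x)=b(x)\cdot\nabla g(x)+\frac12\mathrm{Tr}(\Sigma(x)D^2g(x))$. For a measure $m$ and a function $g$, $m(g)=\int g\,dm$. **Scheme.** $(\gamma_k)_{k\ge1}$ is a decreasing sequence of positive steps with $\gamma_k\asymp k^{-\theta}$, $\theta\in(0,1]$; $\Gamma_n=\sum_{k=1}^n\gamma_k$. For $n\ge0$, $$X_{n+1}=X_n+\gamma_{n+1}b(X_n)+\sqrt{\gamma_{n+1}}\,\sigma(X_n)U_{n+1},\qquad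 X_0\in L^2,$$ and the empirical measure is $\nu_n=\frac1{\Gamma_n}\sum_{k=1}^n\gamma_k\delta_{X_{k-1}}$. **Standing assumptions.** - (C1) There is $\lambda_0>0$ with $\mathbb{E}[\exp(\lambda|X_0|^2)]<\infty$ for all $\lambda<\lambda_0$. - (GC) $(U_n)_{n\ge1}$ are i.i.d. in $\mathbb{R}^r$, independent of $X_0$, $\mathbb{E}[U_1]=0$, $\mathbb{E}[U_1^iU_1^j]=\delta_{ij}$, $\mathbb{E}[U_1^iU_1^jU_1^k]=0$ for all $i,j,k$; and for every $1$-Lipschitz $g:\mathbb{R}^r\to\mathbb{R}$ and $\lambda>0$, $\mathbb{E}[\exp(\lambda g(U_1))]\le\exp(\lambda\mathbb{E}[g(U_1)]+\frac{\lambda^2}2)$. - (C2) $\sup_x\|\sigma(x)\|^2<\infty$. - ($\mathcal{L}_V$) There is $V:\mathbb{R}^d\to[v^*,+\infty)$, $v^*>0$, with: (i) $V\in\mathcal{C}^2$, $\|D^2V\|_\infty<\infty$, $V(x)\to\infty$ as $|x|\to\infty$; (ii) there is $C_V\in(0,\infty)$ with $|\nabla V|^2+|b|^2\le C_VV$ on $\mathbb{R}^d$; (iii) there are $\alpha_V>0$, $\beta_V\ge0$ with $\mathcal{A}V\le-\alpha_VV+\beta_V$ on $\mathbb{R}^d$. - (U) The diffusion has a unique invariant probability measure $\nu$. - (S) For all $k\ge1$, $\gamma_k\le\min\big(\frac1{2\sqrt{C_V\bar c}},\frac{\alpha_V}{2C_V\|D^2V\|_\infty}\big)$, where $K,\bar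 c>0$ are constants such that $|V(x)|\le\bar c|x|^2$ and $|b(x)|\le\sqrt{C_V\bar c}\,|x|$ for $|x|\ge K$ (such constants exist under ($\mathcal{L}_V$)). **Condition $(\mathbf{T}_\beta)$** for a function $g$: (i) $g\in\mathcal{C}^{3,\beta}(\mathbb{R}^d,\mathbb{R})$; (ii) $x\mapsto\langle b(x),\nabla g(x)\rangle$ is Lipschitz continuous; (iii) there is $C>0$ with $|g(x)|\le C(1+\sqrt{V(x)})$ for all $x$. *)

(* Defs.v *)
From HB Require Import structures.
From mathcomp Require Import all_boot all_order all_algebra.
From mathcomp Require Import all_classical all_reals all_analysis.

Set Implicit Arguments.
Unset Strict Implicit.
Unset Printing Implicit Defensive.

Import Order.TTheory GRing.Theory Num.Theory.
Import numFieldNormedType.Exports.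

Local Open Scope classical_set_scope.
Local Open Scope ring_scope.

(* Vectors of R^d are column vectors 'cV[R]_d.  The library norm `|M| of a
   matrix is the sup norm, so the Euclidean / Frobenius norm is defined here;
   on 'cV[R]_d it is the Euclidean norm. *)
Definition fnorm (R : realType) (m n : nat) (M : 'M[R]_(m, n)) : R :=
  Num.sqrt (\tr (M *m M^T)).

Definition dot (R : realType) (d : nat) (u v : 'cV[R]_d) : R :=
  \sum_(i < d) u i 0 * v i 0.

(* R^d with its Borel sigma-algebra. *)
Notation borelV R d := (g_sigma_algebraType (@open 'cV[R]_d)).

Section Analysis.
Context {R : realType} {d : nat}.
Implicit Types (g : 'cV[R]_d -> R).

Definition lipschitz_mx (m n : nat) (f : 'cV[R]_d -> 'M[R]_(m, n)) : Prop :=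
  exists L : R, forall x y, fnorm (f x - f y) <= L * fnorm (x - y).

Definition lipschitz_const (L : R) g : Prop :=
  forall x y, `|g x - g y| <= L * fnorm (x - y).

Definition holder (beta : R) g : Prop :=
  exists L : R, forall x y, `|g x - g y| <= L * fnorm (x - y) `^ beta.

(* [pderiv [:: i1; ..; ik] g] is the iterated partial derivative
   d_{i1} .. d_{ik} g. *)
Fixpoint pderiv (s : seq 'I_d) g : 'cV[R]_d -> R :=
  if s is i :: s' then fun x => 'D_(delta_mx i 0) (pderiv s' g) x else g.

Definition grad g (x : 'cV[R]_d) : 'cV[R]_d := \col_i pderiv [:: i] g x.

Definition hess g (x : 'cV[R]_d) : 'M[R]_d := \matrix_(i, j) pderiv [:: i; j] g x.

(* The library's ['D_v f x] is a total operator, hence the explicit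
   derivability clause. *)
Definition Ck (k : nat) g : Prop :=
  forall s : seq 'I_d, (size s <= k)%N ->
    continuous (pderiv s g) /\
    ((size s < k)%N -> forall x i, derivable (pderiv s g) x (delta_mx i 0)).

Definition Ck_holder (k : nat) (beta : R) g : Prop :=
  [/\ Ck k g,
      (forall s : seq 'I_d, (1 <= size s <= k)%N ->
         exists M : R, forall x, `|pderiv s g x| <= M)
    & (forall s : seq 'I_d, size s = k -> holder beta (pderiv s g))].

Definition sup_norm (m n : nat) (f : 'cV[R]_d -> 'M[R]_(m, n)) : R :=
  sup (range (fun x => fnorm (f x))).

Definition finite_sup_norm (m n : nat) (f : 'cV[R]_d -> 'M[R]_(m, n)) : Prop :=
  has_ubound (range (fun x => fnorm (f x))).

End Analysis.

Definition asymp (R : realType) (u v : nat -> R) : Prop :=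
  exists (n0 : nat) (C : R), 1 <= C /\
    forall n, (n0 <= n)%N -> C^-1 * v n <= u n <= C * v n.

Section Probability.
Context {R : realType} {disp : measure_display} {Omega : measurableType disp}.
Variable P : probability Omega R.

Definition sigma_of {m : nat} (Z : Omega -> 'cV[R]_m) : set (set Omega) :=
  preimage_set_system setT (Z : Omega -> borelV R m) measurable.

Definition mutually_independent {I : eqType} (F : I -> set (set Omega)) : Prop :=
  forall (s : seq I) (A : I -> set Omega), uniq s ->
    (forall i, i \in s -> F i (A i)) ->
    P (\bigcap_(i in [set` s]) A i) = (\prod_(i <- s) fine (P (A i)))%:E.

Definition cvg_in_probability {m : nat}
    (Z : nat -> Omega -> 'cV[R]_m) (Zlim : Omega -> 'cV[R]_m) : Prop :=
  forall eps : R, 0 < eps ->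
    (fun n => P [set w | eps <= fnorm (Z n w - Zlim w)]) @ \oo --> 0%E.

(* Stochastic processes are indexed by R; only times t >= 0 matter. *)
Definition filtration (F : R -> set (set Omega)) : Prop :=
  [/\ (forall t, 0 <= t -> sigma_algebra setT (F t)),
      (forall t, 0 <= t -> F t `<=` measurable)
    & (forall s t, 0 <= s -> s <= t -> F s `<=` F t)].

Definition adapted {m : nat} (F : R -> set (set Omega))
    (Y : R -> Omega -> 'cV[R]_m) : Prop :=
  forall t, 0 <= t -> sigma_of (Y t) `<=` F t.

Definition continuous_paths {m : nat} (Y : R -> Omega -> 'cV[R]_m) : Prop :=
  forall w, {within `[0, +oo[, continuous (fun t => Y t w)}.

(* The last clause states both that W_t - W_s is independent of F_s and that
   its law is N(0, (t - s) I_r); [normal_prob] takes the standard deviation. *)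
Definition wiener {r : nat} (F : R -> set (set Omega))
    (W : R -> Omega -> 'cV[R]_r) : Prop :=
  [/\ adapted F W, continuous_paths W, (forall w, W 0 w = 0)
    & (forall s t : R, 0 <= s -> s < t ->
       forall (A : set Omega) (B : 'I_r -> set R),
         F s A -> (forall i, measurable (B i)) ->
         P (A `&` [set w | forall i, B i ((W t w - W s w) i 0)]) =
         (fine (P A) *
          \prod_(i < r) fine (normal_prob 0 (Num.sqrt (t - s)) (B i)))%:E)].

(* Ito integral over [0, t] of a continuous adapted integrand: the limit in
   probability of the left-point Riemann sums. *)
Definition is_ito_integral {m r : nat} (W : R -> Omega -> 'cV[R]_r)
    (H : R -> Omega -> 'M[R]_(m, r)) (t : R) (J : Omega -> 'cV[R]_m) : Prop :=
  cvg_in_probability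
    (fun n w => \sum_(i < n)
       H (t * (i%:R / n%:R)) w *m
         (W (t * (i.+1%:R / n%:R)) w - W (t * (i%:R / n%:R)) w))
    J.

(* Y_t = Y_0 + int_0^t b(Y_s) ds + int_0^t sigma(Y_s) dW_s. *)
Definition sde_solution {d r : nat} (b : 'cV[R]_d -> 'cV[R]_d)
    (sigma : 'cV[R]_d -> 'M[R]_(d, r)) (F : R -> set (set Omega))
    (W : R -> Omega -> 'cV[R]_r) (Y : R -> Omega -> 'cV[R]_d) : Prop :=
  [/\ adapted F Y, continuous_paths Y
    & (forall t : R, 0 <= t ->
       is_ito_integral W (fun s w => sigma (Y s w)) t
         (fun w => Y t w - Y 0 w -
            \col_i \int[lebesgue_measure]_(s in `[0, t]) b (Y s w) i 0))].

Definition has_law {m : nat} (Z : Omega -> 'cV[R]_m)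
    (mu : set (borelV R m) -> \bar R) : Prop :=
  forall B : set (borelV R m), measurable B -> P (Z @^-1` B) = mu B.

End Probability.

Section Diffusion.
Context {R : realType} {d r : nat}.
Variables (b : 'cV[R]_d -> 'cV[R]_d) (sigma : 'cV[R]_d -> 'M[R]_(d, r)).

Definition generator (g : 'cV[R]_d -> R) (x : 'cV[R]_d) : R :=
  dot (b x) (grad g x) + 2^-1 * \tr (sigma x *m (sigma x)^T *m hess g x).

(* mu is invariant if the diffusion started from mu has law mu at all times. *)
Definition invariant (mu : probability (borelV R d) R) : Prop :=
  forall (disp : measure_display) (Omega : measurableType disp)
    (P : probability Omega R) (F : R -> set (set Omega))
    (W : R -> Omega -> 'cV[R]_r) (Y : R -> Omega -> 'cV[R]_d),
    filtration F -> wiener P F W -> sde_solution P b sigma F W Y ->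
    has_law P (Y 0) mu ->
    forall t : R, 0 <= t -> has_law P (Y t) mu.

Definition unique_invariant (nu : probability (borelV R d) R) : Prop :=
  invariant nu /\
  forall mu : probability (borelV R d) R, invariant mu ->
    forall B : set (borelV R d), measurable B -> mu B = nu B.

Record lyapunov (V : 'cV[R]_d -> R) (vstar CV alphaV betaV : R) : Prop := {
  vstar_gt0 : 0 < vstar;
  V_ge : forall x, vstar <= V x;
  V_C2 : Ck 2 V;
  V_hess : finite_sup_norm (hess V);
  V_infty : forall M : R, exists A : R, forall x, A <= fnorm x -> M <= V x;
  CV_gt0 : 0 < CV;
  V_CV : forall x, fnorm (grad V x) ^+ 2 + fnorm (b x) ^+ 2 <= CV * V x;
  alphaV_gt0 : 0 < alphaV;
  betaV_ge0 : 0 <= betaV;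
  V_generator : forall x, generator V x <= - alphaV * V x + betaV }.

Record small_steps (gamma : nat -> R) (V : 'cV[R]_d -> R)
    (CV alphaV K cbar : R) : Prop := {
  K_gt0 : 0 < K;
  cbar_gt0 : 0 < cbar;
  V_cbar : forall x, K <= fnorm x -> `|V x| <= cbar * fnorm x ^+ 2;
  b_cbar : forall x, K <= fnorm x ->
    fnorm (b x) <= Num.sqrt (CV * cbar) * fnorm x;
  gamma_small : forall k, (1 <= k)%N ->
    gamma k <= Num.min (2 * Num.sqrt (CV * cbar))^-1
                       (alphaV / (2 * CV * sup_norm (hess V))) }.

Record T_cond (V : 'cV[R]_d -> R) (beta : R) (g : 'cV[R]_d -> R) : Prop := {
  T_smooth : Ck_holder 3 beta g;
  T_drift : exists L : R, lipschitz_const L (fun x => dot (b x) (grad g x));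
  T_growth : exists2 C : R, 0 < C &
    forall x, `|g x| <= C * (1 + Num.sqrt (V x)) }.

(* |sigma^* grad phi|^2 *)
Definition carre_du_champ (phi : 'cV[R]_d -> R) (x : 'cV[R]_d) : R :=
  fnorm ((sigma x)^T *m grad phi x) ^+ 2.

End Diffusion.

(* Steps and innovations are indexed from 1: gamma 0 and U 0 are never used. *)
Record steps (R : realType) (gamma : nat -> R) (theta : R) : Prop := {
  gamma_gt0 : forall k, (1 <= k)%N -> 0 < gamma k;
  gamma_decr : forall k, (1 <= k)%N -> gamma k.+1 <= gamma k;
  gamma_asymp : asymp gamma (fun k => k%:R `^ (- theta)) }.

Definition Gamma (R : realType) (gamma : nat -> R) (n : nat) : R :=
  \sum_(1 <= k < n.+1) gamma k.

Section Scheme.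
Context {R : realType} {d r : nat} {disp : measure_display}
  {Omega : measurableType disp}.
Variable P : probability Omega R.
Variables (b : 'cV[R]_d -> 'cV[R]_d) (sigma : 'cV[R]_d -> 'M[R]_(d, r)).
Variables (gamma : nat -> R).
Variables (X0 : Omega -> 'cV[R]_d) (U : nat -> Omega -> 'cV[R]_r).

Fixpoint scheme (n : nat) (w : Omega) : 'cV[R]_d :=
  if n is m.+1 then
    scheme m w + gamma m.+1 *: b (scheme m w) +
      Num.sqrt (gamma m.+1) *: (sigma (scheme m w) *m U m.+1 w)
  else X0 w.

(* nu_n = Gamma_n^-1 sum_{k < n} gamma_{k+1} delta_{X_k}.  [mscale] wants a
   syntactically nonnegative factor; for positive steps the absolute values
   below are vacuous. *)
Definition empirical (n : nat) (w : Omega) :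
    {measure set (borelV R d) -> \bar R} :=
  mscale (`|(Gamma gamma n)^-1|%:nng)
    (msum (fun k => mscale (`|gamma k.+1|%:nng)
                      (dirac (scheme k w : borelV R d))) n).

Record initial_cond : Prop := {
  X0_measurable : measurable_fun setT (X0 : Omega -> borelV R d);
  X0_L2 : ('E_P[fun w => (fnorm (X0 w) ^+ 2)%R] < +oo)%E;
  X0_exp : exists2 lambda0 : R, 0 < lambda0 &
    forall lambda : R, lambda < lambda0 ->
      ('E_P[fun w => expR (lambda * fnorm (X0 w) ^+ 2)%R] < +oo)%E }.

(* [GC_indep] says that X_0, U_1, U_2, ... are mutually independent, i.e.
   the U_n are independent and the sequence is independent of X_0. *)
Record GC : Prop := {
  U_measurable : forall n, (1 <= n)%N ->
    measurable_fun setT (U n : Omega -> borelV R r);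
  GC_indep : mutually_independent P
    (fun n : nat => if n is 0%N then sigma_of X0 else sigma_of (U n));
  U_law : forall n, (1 <= n)%N ->
    forall B : set (borelV R r), measurable B ->
      P (U n @^-1` B) = P (U 1%N @^-1` B);
  U_mean : forall i, ('E_P[fun w => U 1%N w i 0%R] = 0)%E;
  U_cov : forall i j,
    ('E_P[fun w => (U 1%N w i 0 * U 1%N w j 0)%R] = ((i == j)%:R : R)%:E)%E;
  U_third : forall i j k,
    ('E_P[fun w => (U 1%N w i 0 * U 1%N w j 0 * U 1%N w k 0)%R] = 0)%E;
  U_concentration : forall (g : 'cV[R]_r -> R) (lambda : R),
    lipschitz_const 1 g -> 0 < lambda ->
    ('E_P[fun w => expR (lambda * g (U 1%N w))%R] <=
     (expR (lambda * fine 'E_P[fun w => g (U 1%N w)] + lambda ^+ 2 / 2)%R)%:E)%E }.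

End Scheme.

(* Main.v *)
(* Write [W] for the square root of [V], [m] for the [nu]-mean of
   |sigma^* grad phi|^2 and [psi] for the solution of the Poisson equation.  Tilt
   by [f = - mu phi - (mu ^ 2 / 2) psi]: as the first and third moments of the
   noise vanish, a Taylor expansion of [f] along one step of the scheme gives
     E [exp (f (X_{k+1}) - f (X_k)) | X_k]
       <= exp (gamma_{k+1} (- mu (A phi) (X_k) + mu ^ 2 m / 2) + R_k),
   where [R_k] has order |mu| (gamma ^ ((3 + beta) / 2) + gamma ^ 2 W (X_k))
   + mu ^ 2 gamma ^ (3 / 2) + |mu| ^ 3 gamma.  The products of these exponentials
   form a supermartingale, which bounds the Laplace transform of
   Gamma_n nu_n (A phi) by exp (mu ^ 2 Gamma_n m / 2), up to the boundary terms
   f (X_0), f (X_n) and the sum of the gamma ^ 2 W (X_k).  Hölder's inequality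
   with an exponent of order (sum of the gamma ^ 2) / sqrt Gamma_n absorbs the
   latter, since E exp (l W (X_k)) <= exp (C (1 + l ^ 2)) uniformly in k.
   Chernoff's bound at mu = a / (m sqrt Gamma_n) concludes; the condition
   theta > 1 / (2 + beta) makes the sum of the gamma ^ ((3 + beta) / 2)
   negligible against sqrt Gamma_n. *)

From HB Require Import structures.
Require Import Defs.
From mathcomp Require Import all_boot all_order all_algebra.
From mathcomp Require Import all_classical all_reals all_analysis.
From mathcomp Require Import measurable_realfun ring lra.

Import Order.TTheory GRing.Theory Num.Theory.
Import numFieldNormedType.Exports.

Local Open Scope classical_set_scope.
Local Open Scope ring_scope.

(** * Frobenius norm and Taylor expansions *)

Section Frobenius.
Set Implicit Arguments.
Unset Strict Implicit.
Context {R : realType}.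

(** The conditional variances met along the scheme are the random values of
    [carre_du_champ sigma phi] at X_k. Bounding them by their supremum would lose the sharp constant
    m. Since A psi is exactly their deviation from m, the second-order part of the tilt replaces
    them by m, at the cost of cross terms of order |mu|^3. The terms left in W are unbounded and can
    only be paid for by exponential moments. Hölder's inequality with a small exponent del turns
    them into an average of the l W (X_k), with l of order |mu| sqrt Gamma_n. Then l^2 has the order
    of the Gaussian exponent mu^2 Gamma_n itself: the moments must grow no faster than exp (C l^2),
    and del must tend to 0. In the end every error is at most eps_n (1 + a^2), where eps_n sees a
    only through a null sequence rho_n that dominates a / sqrt Gamma_n. The constant part goes into
    C_n and the part in a^2 into c_n, so that neither depends on a. *)

Lemma cauchy_schwarz_sum (I : finType) (a b : I -> R) :
  `|\sum_i a i * b i| <= Num.sqrt (\sum_i a i ^+ 2) * Num.sqrt (\sum_i b i ^+ 2).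
Proof.
set A := \sum_i a i ^+ 2; set B := \sum_i b i ^+ 2; set c := \sum_i a i * b i.
have A0 : 0 <= A by apply: sumr_ge0 => i _; exact: sqr_ge0.
have B0 : 0 <= B by apply: sumr_ge0 => i _; exact: sqr_ge0.
(* This quadratic is evaluated at its minimizer - c / B. If B = 0 it is affine in t, and a nonzero c
   would let it take the value -1. *)
have poly t : 0 <= A + 2 * t * c + t ^+ 2 * B.
  rewrite [leRHS](_ : _ = \sum_i (a i + t * b i) ^+ 2).
    by apply: sumr_ge0 => i _; exact: sqr_ge0.
  rewrite /A /B /c !mulr_sumr -!big_split; apply: eq_bigr => i _ /=; ring.
suff c2 : c ^+ 2 <= A * B.
  by rewrite -sqrtrM// -sqrtr_sqr ler_wsqrtr.
have [B_gt0|] := ltP 0 B; last first.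
  move=> Ble0; have B00 : B = 0 by apply/eqP; rewrite eq_le Ble0 B0.
  have c0 : c = 0.
    apply/eqP; apply: contraT => c_neq0.
    have := poly (- (A + 1) / (2 * c)); rewrite B00 mulr0 addr0.
    have -> : 2 * (- (A + 1) / (2 * c)) * c = - (A + 1) by field.
    by lra.
  by rewrite c0 B00 expr0n mulr0.
have := poly (- c / B).
have -> : A + 2 * (- c / B) * c + (- c / B) ^+ 2 * B = (A * B - c ^+ 2) / B.
  by field; rewrite gt_eqF.
by rewrite ler_pdivlMr// mul0r subr_ge0.
Qed.

Lemma fnormE (m n : nat) (M : 'M[R]_(m, n)) :
  fnorm M = Num.sqrt (\sum_(k : 'I_m * 'I_n) M k.1 k.2 ^+ 2).
Proof.
rewrite /fnorm /mxtrace -(pair_bigA _ (fun i j => M i j ^+ 2)) /=.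
by congr Num.sqrt; apply: eq_bigr => i _; rewrite !mxE;
  apply: eq_bigr => j _; rewrite mxE expr2.
Qed.

Lemma fnorm_ge0 (m n : nat) (M : 'M[R]_(m, n)) : 0 <= fnorm M.
Proof. exact: sqrtr_ge0. Qed.

Lemma fnorm_sqr (m n : nat) (M : 'M[R]_(m, n)) :
  fnorm M ^+ 2 = \sum_i \sum_j M i j ^+ 2.
Proof.
rewrite fnormE sqr_sqrtr; first by rewrite -(pair_bigA _ (fun i j => M i j ^+ 2)).
by apply: sumr_ge0 => i _; exact: sqr_ge0.
Qed.

Lemma fnorm_sqr_col (m : nat) (M : 'cV[R]_m) :
  fnorm M ^+ 2 = \sum_i M i 0 ^+ 2.
Proof. by rewrite fnorm_sqr; apply: eq_bigr => i _; rewrite big_ord1. Qed.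

Lemma mxtrace_mulT (m n : nat) (A B : 'M[R]_(m, n)) :
  \tr (A *m B^T) = \sum_(k : 'I_m * 'I_n) A k.1 k.2 * B k.1 k.2.
Proof.
rewrite /mxtrace -(pair_bigA _ (fun i j => A i j * B i j)) /=.
by apply: eq_bigr => i _; rewrite !mxE; apply: eq_bigr => j _; rewrite mxE.
Qed.

Lemma norm_mxtrace_mulT (m n : nat) (A B : 'M[R]_(m, n)) :
  `|\tr (A *m B^T)| <= fnorm A * fnorm B.
Proof. by rewrite mxtrace_mulT !fnormE; exact: cauchy_schwarz_sum. Qed.

Lemma fnorm_tr (m n : nat) (A : 'M[R]_(m, n)) : fnorm A^T = fnorm A.
Proof. by rewrite /fnorm trmxK mxtrace_mulC. Qed.

Lemma norm_dot_le (d : nat) (u v : 'cV[R]_d) : `|dot u v| <= fnorm u * fnorm v.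
Proof.
rewrite (_ : dot u v = \tr (u *m v^T)); first exact: norm_mxtrace_mulT.
rewrite mxtrace_mulT -(pair_bigA _ (fun i j => u i j * v i j)) /=.
by rewrite /dot; apply: eq_bigr => i _; rewrite big_ord1.
Qed.

Lemma fnormD (m n : nat) (A B : 'M[R]_(m, n)) :
  fnorm (A + B) <= fnorm A + fnorm B.
Proof.
rewrite -(@ler_pXn2r _ 2)// ?nnegrE ?addr_ge0 ?fnorm_ge0//.
have sqr_tr (M : 'M[R]_(m, n)) : fnorm M ^+ 2 = \tr (M *m M^T).
  rewrite mxtrace_mulT fnorm_sqr (pair_bigA _ (fun i j => M i j ^+ 2)) /=.
  by apply: eq_bigr => i _; rewrite expr2.
rewrite sqr_tr linearD /= mulmxDl !mulmxDr !mxtraceD.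
have -> : \tr (B *m A^T) = \tr (A *m B^T).
  by rewrite !mxtrace_mulT; apply: eq_bigr => i _; rewrite mulrC.
rewrite -!sqr_tr sqrrD.
have := norm_mxtrace_mulT A B; rewrite ler_norml => /andP[_]; lra.
Qed.

Lemma fnormZ (m n : nat) (a : R) (A : 'M[R]_(m, n)) :
  fnorm (a *: A) = `|a| * fnorm A.
Proof.
rewrite !fnormE -sqrtr_sqr -sqrtrM ?sqr_ge0//; congr Num.sqrt.
by rewrite mulr_sumr; apply: eq_bigr => k _; rewrite mxE exprMn.
Qed.

Lemma fnormN (m n : nat) (A : 'M[R]_(m, n)) : fnorm (- A) = fnorm A.
Proof. by rewrite -scaleN1r fnormZ normrN normr1 mul1r. Qed.

Lemma fnorm_mulmx (m n p : nat) (A : 'M[R]_(m, n)) (B : 'M[R]_(n, p)) :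
  fnorm (A *m B) <= fnorm A * fnorm B.
Proof.
rewrite -(@ler_pXn2r _ 2)// ?nnegrE ?mulr_ge0 ?fnorm_ge0//.
rewrite exprMn -(fnorm_tr B) !fnorm_sqr mulr_suml.
apply: ler_sum => i _; rewrite mulr_sumr; apply: ler_sum => j _.
rewrite mxE.
have := cauchy_schwarz_sum (fun k => A i k) (fun k => B k j).
set a := \sum_k A i k ^+ 2; set b := \sum_k B k j ^+ 2.
have a0 : 0 <= a by apply: sumr_ge0 => k _; exact: sqr_ge0.
have b0 : 0 <= b by apply: sumr_ge0 => k _; exact: sqr_ge0.
rewrite -sqrtrM// -[X in X <= _]sqrtr_sqr ler_sqrt ?mulr_ge0// => /le_trans; apply.
by under [in leRHS]eq_bigr do rewrite mxE.
Qed.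

Lemma norm_coord_le (m n : nat) (A : 'M[R]_(m, n)) i j : `|A i j| <= fnorm A.
Proof.
rewrite fnormE -sqrtr_sqr ler_wsqrtr// (bigD1 (i, j))//= lerDl.
by apply: sumr_ge0 => k _; exact: sqr_ge0.
Qed.

Lemma fnorm_le_sum (m n : nat) (A : 'M[R]_(m, n)) :
  fnorm A <= \sum_i \sum_j `|A i j|.
Proof.
have S0 : 0 <= \sum_i \sum_j `|A i j|.
  by apply: sumr_ge0 => i _; apply: sumr_ge0 => j _.
rewrite -(@ler_pXn2r _ 2)// ?nnegrE ?fnorm_ge0// fnorm_sqr.
rewrite expr2 mulr_suml; apply: ler_sum => i _.
rewrite mulr_suml; apply: ler_sum => j _.
rewrite -normr_id -[_ ^+ 2]ger0_norm ?sqr_ge0// normrX normr_id expr2.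
apply: ler_wpM2l => //.
rewrite (bigD1 i)//= (bigD1 j)//= -addrA lerDl addr_ge0//.
  by apply: sumr_ge0.
by apply: sumr_ge0 => k _; apply: sumr_ge0.
Qed.

End Frobenius.

(** * Taylor inequalities on the unit interval *)

Section UnitIntervalTaylor.
Set Implicit Arguments.
Unset Strict Implicit.
Context {R : realType}.
Implicit Types (f df g : R -> R).

Lemma mean_value_le f df (M : R) :
  (forall t : R, is_derive t 1 f (df t)) ->
  (forall t : R, 0 <= t <= 1 -> `|df t| <= M) ->
  forall t : R, 0 <= t <= 1 -> `|f t - f 0| <= M.
Proof.
move=> fdf dfM t /andP[t0 t1].
have cf : {within `[0, t], continuous f}.
  by apply: derivable_within_continuous => x _; have [] := fdf x.
have [c] := MVT_segment t0 (fun x _ => fdf x) cf.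
rewrite in_itv/= subr0 => /andP[c0 ct] ->.
rewrite normrM (ger0_norm t0) (le_trans _ (dfM c _))//.
  by rewrite ler_piMr.
by rewrite c0 (le_trans ct).
Qed.

(** Subtracting the top Taylor monomial lowers the order by one, here and in the next two lemmas.
    The factorials in the remainders are given up, since only the order of the remainder matters. *)
Lemma taylor2_le (g0 g1 g2 : R -> R) (M : R) :
  (forall t : R, is_derive t 1 g0 (g1 t)) ->
  (forall t : R, is_derive t 1 g1 (g2 t)) ->
  (forall t : R, 0 <= t <= 1 -> `|g2 t| <= M) ->
  `|g0 1 - g0 0 - g1 0| <= M.
Proof.
move=> d0 d1 g2M.
have d (t : R) : is_derive t 1 (fun t => g0 t - t * g1 0) (g1 t - g1 0).
  by apply: is_derive_eq; rewrite scaler0 add0r /GRing.scale/= ?mulr1 ?expr1.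
have i01 : 0 <= (1 : R) <= 1 by rewrite ler01 lexx.
have := mean_value_le d (mean_value_le d1 g2M) i01.
by congr (_ <= _); congr (`|_|); ring.
Qed.

Lemma taylor3_le (g0 g1 g2 : R -> R) (M : R) :
  (forall t : R, is_derive t 1 g0 (g1 t)) ->
  (forall t : R, is_derive t 1 g1 (g2 t)) ->
  (forall t : R, 0 <= t <= 1 -> `|g2 t - g2 0| <= M) ->
  `|g0 1 - g0 0 - g1 0 - g2 0 / 2| <= M.
Proof.
move=> d0 d1 g2M.
have e0 (t : R) : is_derive t 1 (fun t => g0 t - t ^+ 2 * (g2 0 / 2)) (g1 t - t * g2 0).
  apply: is_derive_eq; rewrite scaler0 add0r /GRing.scale/= ?mulr1 ?expr1.
  by field.
have e1 (t : R) : is_derive t 1 (fun t => g1 t - t * g2 0) (g2 t - g2 0).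
  by apply: is_derive_eq; rewrite scaler0 add0r /GRing.scale/= ?mulr1 ?expr1.
have := taylor2_le e0 e1 g2M.
by congr (_ <= _); congr (`|_|); ring.
Qed.

(** The remainder is measured by the oscillation of the third derivative, because a function of
    class C^{3,beta} offers a Hölder bound there and no fourth derivative. *)
Lemma taylor4_le (g0 g1 g2 g3 : R -> R) (M : R) :
  (forall t : R, is_derive t 1 g0 (g1 t)) ->
  (forall t : R, is_derive t 1 g1 (g2 t)) ->
  (forall t : R, is_derive t 1 g2 (g3 t)) ->
  (forall t : R, 0 <= t <= 1 -> `|g3 t - g3 0| <= M) ->
  `|g0 1 - g0 0 - g1 0 - g2 0 / 2 - g3 0 / 6| <= M.
Proof.
move=> d0 d1 d2 g3M.
have e0 (t : R) : is_derive t 1 (fun t => g0 t - t ^+ 3 * (g3 0 / 6))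
    (g1 t - t ^+ 2 * (g3 0 / 2)).
  apply: is_derive_eq; rewrite scaler0 add0r /GRing.scale/= ?mulr1 ?expr1.
  by field.
have e1 (t : R) : is_derive t 1 (fun t => g1 t - t ^+ 2 * (g3 0 / 2)) (g2 t - t * g3 0).
  apply: is_derive_eq; rewrite scaler0 add0r /GRing.scale/= ?mulr1 ?expr1.
  by field.
have e2 (t : R) : is_derive t 1 (fun t => g2 t - t * g3 0) (g3 t - g3 0).
  by apply: is_derive_eq; rewrite scaler0 add0r /GRing.scale/= ?mulr1 ?expr1.
have e2M (t : R) : 0 <= t <= 1 -> `|(g2 t - t * g3 0) - (g2 0 - 0 * g3 0)| <= M.
  exact: (mean_value_le e2).
have := taylor3_le e0 e1 e2M.
by congr (_ <= _); congr (`|_|); ring.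
Qed.

(** The quadratic term must be exact, as it produces the Gaussian constant. The cubic remainder
    stays integrable because the noise has all exponential moments of its norm. *)
Lemma expR_le_quadratic (x : R) :
  expR x <= 1 + x + x ^+ 2 / 2 + `|x| ^+ 3 * expR `|x|.
Proof.
pose g n t : R := x ^+ n * expR (t * x).
have dg n (t : R) : is_derive t 1 (g n) (g n.+1 t).
  apply: is_derive_eq; rewrite /g /GRing.scale/= exprSr; ring.
have g3M (t : R) : 0 <= t <= 1 -> `|g 3%N t| <= `|x| ^+ 3 * expR `|x|.
  move=> /andP[t0 t1]; rewrite normrM normrX ler_wpM2l ?exprn_ge0//.
  rewrite ger0_norm ?expR_ge0// ler_expR (le_trans (ler_norm _))// normrM.
  by rewrite (ger0_norm t0) ler_piMl.
have := taylor3_le (dg 0%N) (dg 1%N) (mean_value_le (dg 2%N) g3M).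
rewrite ler_norml => /andP[_].
rewrite /g expr0 expr1 mul0r mul1r expR0 !mulr1 mul1r.
by lra.
Qed.

End UnitIntervalTaylor.

Section LineDerivative.
Set Implicit Arguments.
Unset Strict Implicit.
Context {R : realType}.

Lemma is_derive_line (W : normedModType R) (g : W -> R) (x v : W) (t : R) :
  derivable g (x + t *: v) v ->
  is_derive t 1 (fun t => g (x + t *: v)) ('D_v g (x + t *: v)).
Proof.
move=> dg.
have E : (fun h : R => h^-1 *: ((g \o shift (x + t *: v)) (h *: v) - g (x + t *: v)))
  = (fun h : R => h^-1 *: (((fun t => g (x + t *: v)) \o shift t) (h *: (1 : R)) - g (x + t *: v))).
  apply/funext => h /=; congr (_ *: (g _ - _)).
  have -> : h *: (1 : R) = h by rewrite /GRing.scale/= mulr1.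
  by rewrite scalerDl addrCA.
by split; rewrite /derivable /derive -E.
Qed.

Variable d : nat.
Implicit Types (g : 'cV[R]_d -> R) (x y z h : 'cV[R]_d).

(* The increment of a C^1 function along [h] is split over the coordinates
   and each piece is handled by the mean value theorem. *)
Lemma is_derive_C1_line g x h (t : R) :
  (forall y (i : 'I_d), derivable g y (delta_mx i 0)) ->
  (forall i : 'I_d, continuous (fun y => 'D_(delta_mx i 0) g y)) ->
  is_derive t 1 (fun t => g (x + t *: h))
    (\sum_i h i 0 * 'D_(delta_mx i 0) g (x + t *: h)).
Proof.
move=> dg cg; set z := x + t *: h.
(* [hk k] keeps the first k coordinates of h, so consecutive vectors differ along one basis vector
   and [hk d] is h. *)
pose hk (k : nat) : 'cV[R]_d := \col_i (if (i < k)%N then h i 0 else 0).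
have hkS (k : 'I_d) : hk k.+1 = hk k + h k 0 *: delta_mx k 0.
  apply/colP => i; rewrite !mxE ltnS leq_eqVlt eqxx andbT.
  have [->|ik] := eqVneq i k; first by rewrite eqxx ltnn mulr1 add0r.
  by rewrite (negbTE (_ : val i != val k)) ?mulr0 ?addr0.
have quot k : (k <= d)%N ->
    (fun s : R => s^-1 * (g (z + s *: hk k) - g z)) @ 0^' -->
    \sum_(i < d | (i < k)%N) h i 0 * 'D_(delta_mx i 0) g z.
  elim: k => [_|k IH kd].
    rewrite big_pred0//.
    under eq_fun => s.
      have -> : hk 0%N = 0 by apply/colP => i; rewrite !mxE.
      by rewrite scaler0 addr0 subrr mulr0; over.
    exact: cvg_cst.
  pose K := Ordinal kd.
  rewrite (bigD1 K)//= addrC.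
  rewrite (eq_bigl (fun i : 'I_d => (i < k)%N)); last first.
    by move=> i; rewrite ltnS [RHS]ltn_neqAle andbC.
  have -> : (fun s : R => s^-1 * (g (z + s *: hk k.+1) - g z)) =
     (fun s => s^-1 * (g (z + s *: hk k) - g z)) \+
     (fun s => s^-1 * (g (z + s *: hk k.+1) - g (z + s *: hk k))).
    by apply/funext => s /=; ring.
  apply: cvgD; first exact: IH (ltnW kd).
  apply/cvgrPdist_lt => e e0.
  have e'0 : 0 < e / (`|h K 0| + 1) by rewrite divr_gt0// ltr_wpDl.
  have /cvgrPdist_lt/(_ _ e'0) := cg K z.
  rewrite -nbhs_ballE => -[r /= r0 rD].
  (* N dominates the displacement per unit of s for every intermediate point given by the mean value
     theorem; |s| N < r then keeps that point in the ball where the partial derivative is nearly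
     constant. *)
  pose N := `|hk k| + `|h K 0 *: (delta_mx K 0 : 'cV[R]_d)| + 1.
  have N0 : 0 < N by rewrite ltr_wpDl// addr_ge0.
  near=> s.
  have s0 : s != 0 by near: s; exact: nbhs_dnbhs_neq.
  have sr : `|s| * N < r.
    rewrite -ltr_pdivlMr//; near: s; apply: dnbhs0_lt.
    by rewrite divr_gt0.
  have dl (c : R) : is_derive c 1
      (fun c => g ((z + s *: hk k) + c *: (s * h K 0 *: delta_mx K 0)))
      (s * h K 0 * 'D_(delta_mx K 0) g ((z + s *: hk k) + c *: (s * h K 0 *: delta_mx K 0))).
    pose f (c : R) := g ((z + s *: hk k) + c *: delta_mx K 0).
    have -> : (fun c : R => g ((z + s *: hk k) + c *: (s * h K 0 *: delta_mx K 0)))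
      = f \o (fun c : R => c * (s * h K 0)).
      by apply/funext => c' /=; rewrite /f scalerA.
    have df := is_derive_line (dg (z + s *: hk k + (c * (s * h K 0)) *: delta_mx K 0) K).
    apply: is_derive_eq.
    by rewrite scalerA scaler0 add0r [_%:A]mulr1 mulrC.
  have cf : {within `[0, 1], continuous (fun c : R => g ((z + s *: hk k) + c *: (s * h K 0 *: delta_mx K 0)))}.
    by apply: derivable_within_continuous => c _; have [] := dl c.
  have [c] := MVT_segment ler01 (fun c _ => dl c) cf.
  rewrite in_itv/= => /andP[c0 c1].
  have zE (b : R) : z + s *: hk k + b *: (s * h K 0 *: (delta_mx K 0 : 'cV[R]_d))
      = z + s *: (hk k + b *: (h K 0 *: delta_mx K 0)).
    by rewrite scalerDr addrA; congr (_ + _); rewrite !scalerA mulrA (mulrC b).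
  rewrite !zE scale1r scale0r addr0 -(hkS K) => ->.
  rewrite subr0 mulr1 !mulrA mulVf// mul1r -mulrBr normrM.
  have : `|'D_(delta_mx K 0) g z - 'D_(delta_mx K 0) g
     (z + s *: (hk k + c *: (h K 0 *: delta_mx K 0)))| < e / (`|h K 0| + 1).
    apply: rD; rewrite -ball_normE /= opprD addNKr normrN normrZ.
    apply: le_lt_trans sr; rewrite ler_wpM2l// /N -addrA.
    apply: (le_trans (ler_normD _ _)); rewrite lerD2l normrZ ger0_norm//.
    by rewrite (le_trans (_ : _ <= `|h K 0 *: (delta_mx K 0 : 'cV[R]_d)|)) ?ler_piMl// lerDl.
  rewrite ltr_pdivlMr ?ltr_wpDl// => /(le_lt_trans _); apply.
  by rewrite mulrC ler_wpM2l// lerDl.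
have hkd : hk d = h by apply/colP => i; rewrite !mxE ltn_ord.
have := quot d (leqnn d); rewrite hkd.
rewrite (eq_bigl xpredT) => [qd|i]; last by rewrite ltn_ord.
have E : (fun s : R => s^-1 *: (((fun t => g (x + t *: h)) \o shift t) (s *: (1 : R)) - g (x + t *: h)))
  = (fun s : R => s^-1 * (g (z + s *: h) - g z)).
  apply/funext => s /=; congr (_ * (g _ - _)).
  by rewrite [s%:A]mulr1 scalerDl /z -addrA [in RHS]addrCA [RHS]addrCA (addrC (s *: h)).
split; first by rewrite /derivable E; apply/cvg_ex; eexists; exact: qd.
by rewrite /derive E; exact/cvg_lim.
Unshelve. all: by end_near.
Qed.

End LineDerivative.

Section Smooth.
Set Implicit Arguments.
Unset Strict Implicit.
Context {R : realType} {d : nat}.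
Implicit Types (g : 'cV[R]_d -> R) (x y h : 'cV[R]_d).

Definition qform (H : 'M[R]_d) h : R :=
  \sum_j h j 0 * (\sum_i h i 0 * H i j).

(** The third differential of g at x on (h, h, h), with the sums nested in the order in which
    successive differentiation along a line produces them; [qform] is nested likewise. *)
Definition third_form g x h : R :=
  \sum_j h j 0 * (\sum_i h i 0 * (\sum_k h k 0 * pderiv [:: k; i; j] g x)).

Lemma sum_ord_le (n : nat) (F : 'I_n -> R) (M : R) :
  (forall i, F i <= M) -> \sum_i F i <= n%:R * M.
Proof.
move=> FM; rewrite mulr_natl -[X in _ *+ X](card_ord n) -sumr_const.
exact: ler_sum.
Qed.

Lemma norm_sum_coord_le h (c : 'I_d -> R) (M : R) :
  (forall i, `|c i| <= M) -> `|\sum_i h i 0 * c i| <= d%:R * (fnorm h * M).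
Proof.
move=> cM; apply: (le_trans (ler_norm_sum _ _ _)).
apply: sum_ord_le => i; rewrite normrM ler_pM//.
exact: norm_coord_le.
Qed.

Lemma norm_qform_le (H : 'M[R]_d) h : `|qform H h| <= fnorm H * fnorm h ^+ 2.
Proof.
have -> : qform H h = \tr (H *m (h *m h^T)^T).
  rewrite mxtrace_mulT -(pair_bigA _ (fun i j => H i j * (h *m h^T) i j)) /=.
  rewrite exchange_big; apply: eq_bigr => j _ /=; rewrite mulr_sumr.
  by apply: eq_bigr => i _; rewrite !mxE big_ord1 mxE; ring.
apply: (le_trans (norm_mxtrace_mulT _ _)); rewrite ler_wpM2l ?fnorm_ge0//.
by rewrite (le_trans (fnorm_mulmx _ _))// fnorm_tr expr2.
Qed.

Lemma is_derive_pderiv_line (k : nat) g (s : seq 'I_d) x h (t : R) :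
  Ck k g -> (size s < k)%N ->
  is_derive t 1 (fun t => pderiv s g (x + t *: h))
    (\sum_i h i 0 * pderiv (i :: s) g (x + t *: h)).
Proof.
move=> gk sk; apply: is_derive_C1_line => [y i|i].
  exact: (gk s (ltnW sk)).2.
exact: (gk (i :: s) sk).1.
Qed.

Lemma is_derive_sum_line (c : 'I_d -> R) (f df : 'I_d -> R -> R) (t : R) :
  (forall i, is_derive t 1 (f i) (df i t)) ->
  is_derive t 1 (fun t => \sum_i c i * f i t) (\sum_i c i * df i t).
Proof.
move=> fdf.
have -> : (fun t => \sum_i c i * f i t) = \sum_i (c i *: f i).
  by apply/funext => u; rewrite fct_sumE.
exact: is_derive_sum.
Qed.

Lemma is_derive_line1 (k : nat) g x h (t : R) : Ck k.+1 g ->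
  is_derive t 1 (fun t => g (x + t *: h)) (\sum_i h i 0 * pderiv [:: i] g (x + t *: h)).
Proof. by move=> gk; exact: (is_derive_pderiv_line (s := [::]) _ _ _ gk). Qed.

Lemma is_derive_line2 (k : nat) g x h (t : R) : Ck k.+2 g ->
  is_derive t 1 (fun t => \sum_j h j 0 * pderiv [:: j] g (x + t *: h))
    (qform (hess g (x + t *: h)) h).
Proof.
move=> gk; apply: is_derive_eq.
  apply: (@is_derive_sum_line _ _
    (fun j t => \sum_i h i 0 * pderiv [:: i; j] g (x + t *: h))) => j.
  exact: (is_derive_pderiv_line _ _ _ gk).
by apply: eq_bigr => j _; congr (_ * _); apply: eq_bigr => i _; rewrite mxE.
Qed.

Lemma is_derive_line3 (k : nat) g x h (t : R) : Ck k.+3 g ->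
  is_derive t 1 (fun t => qform (hess g (x + t *: h)) h)
    (third_form g (x + t *: h) h).
Proof.
move=> gk.
have -> : (fun t => qform (hess g (x + t *: h)) h) = (fun t =>
    \sum_j h j 0 * (\sum_i h i 0 * pderiv [:: i; j] g (x + t *: h))).
  apply/funext => u; apply: eq_bigr => j _; congr (_ * _).
  by apply: eq_bigr => i _; rewrite mxE.
apply: (@is_derive_sum_line _ _ (fun j t =>
  \sum_i h i 0 * (\sum_k h k 0 * pderiv [:: k; i; j] g (x + t *: h)))) => j.
apply: (@is_derive_sum_line _ _ (fun i t =>
  \sum_k h k 0 * pderiv [:: k; i; j] g (x + t *: h))) => i.
exact: (is_derive_pderiv_line _ _ _ gk).
Qed.

Lemma dot_grad g x h : dot (grad g x) h = \sum_i h i 0 * pderiv [:: i] g x.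
Proof. by apply: eq_bigr => i _; rewrite mxE mulrC. Qed.

(** The order is left open because the estimate serves both V, which is only C^2, and the C^3 test
    functions. *)
Lemma taylor2_Ck (k : nat) g x h (M : R) : Ck k.+2 g ->
  (forall y, fnorm (hess g y) <= M) ->
  `|g (x + h) - g x - dot (grad g x) h| <= M * fnorm h ^+ 2.
Proof.
move=> gk HM.
have := taylor2_le (fun t => is_derive_line1 x h t gk)
  (fun t => is_derive_line2 x h t gk) (M := M * fnorm h ^+ 2).
rewrite scale1r scale0r addr0 dot_grad; apply => t _.
by rewrite (le_trans (norm_qform_le _ _))// ler_wpM2r ?exprn_ge0 ?fnorm_ge0.
Qed.

Lemma pderiv_lipschitz (k : nat) g (s : seq 'I_d) (M : R) x h :
  Ck k g -> (size s < k)%N ->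
  (forall i y, `|pderiv (i :: s) g y| <= M) ->
  `|pderiv s g (x + h) - pderiv s g x| <= d%:R * (fnorm h * M).
Proof.
move=> gk sk gM.
have i01 : 0 <= (1 : R) <= 1 by rewrite ler01 lexx.
have := mean_value_le (fun t => is_derive_pderiv_line x h t gk sk)
  (M := d%:R * (fnorm h * M)) _ i01.
rewrite scale1r scale0r addr0; apply => t _.
exact: norm_sum_coord_le.
Qed.

(** One constant for everything that the one-step expansion uses. Each bound is homogeneous in g, so
    the constant of a linear combination is the matching combination of constants; this is how the
    constant of the tilt comes to be of order |mu|. *)
Record smooth_bounds (beta C : R) g : Prop := {
  sb_ge0 : 0 <= C;
  sb_lip : forall x h, `|g (x + h) - g x| <= C * fnorm h;
  sb_grad : forall x, fnorm (grad g x) <= C;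
  sb_hess : forall x, fnorm (hess g x) <= C;
  sb_grad_lip : forall x h, fnorm (grad g (x + h) - grad g x) <= C * fnorm h;
  sb_hess_lip : forall x h, fnorm (hess g (x + h) - hess g x) <= C * fnorm h;
  sb_taylor2 : forall x h,
    `|g (x + h) - g x - dot (grad g x) h| <= C * fnorm h ^+ 2;
  sb_taylor4 : forall x h,
    `|g (x + h) - g x - dot (grad g x) h - qform (hess g x) h / 2
      - third_form g x h / 6| <= C * (fnorm h ^+ 3 * fnorm h `^ beta) }.

Lemma seq_bounds_uniform (T : finType) (I : Type) (F : T -> I -> R) :
  (forall s, exists M, forall i, `|F s i| <= M) ->
  exists2 M, 0 <= M & forall s i, `|F s i| <= M.
Proof.
move=> /choice[M FM]; exists (\sum_s `|M s|); first exact: sumr_ge0.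
move=> s x; rewrite (le_trans (FM s x))// (le_trans (ler_norm _))//.
by rewrite (bigD1 s)//= lerDl sumr_ge0.
Qed.

Lemma Ck_holder_smooth_bounds (beta : R) g :
  0 <= beta -> Ck_holder 3 beta g -> exists C, smooth_bounds beta C g.
Proof.
move=> beta0 [gk gM gH].
have [M1 M10 gM1] := @seq_bounds_uniform 'I_d _ (fun i => pderiv [:: i] g)
  (fun i => gM [:: i] isT).
have [M2 M20 gM2] := @seq_bounds_uniform ('I_d * 'I_d)%type _
  (fun i => pderiv [:: i.1; i.2] g) (fun i => gM [:: i.1; i.2] isT).
have [M3 M30 gM3] := @seq_bounds_uniform ('I_d * 'I_d * 'I_d)%type _
  (fun i => pderiv [:: i.1.1; i.1.2; i.2] g)
  (fun i => gM [:: i.1.1; i.1.2; i.2] isT).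
have [L [L0 gL]] : exists L, 0 <= L /\ forall i j k x y,
    `|pderiv [:: i; j; k] g x - pderiv [:: i; j; k] g y| <= L * fnorm (x - y) `^ beta.
  have /choice[L gL] : forall s : 'I_d * 'I_d * 'I_d, exists L, forall x y,
      `|pderiv [:: s.1.1; s.1.2; s.2] g x - pderiv [:: s.1.1; s.1.2; s.2] g y|
      <= L * fnorm (x - y) `^ beta by move=> s; exact: gH.
  exists (\sum_s `|L s|); split; first exact: sumr_ge0.
  move=> i j k x y; rewrite (le_trans (gL (i, j, k) x y))//.
  rewrite ler_wpM2r ?powR_ge0// (le_trans (ler_norm _))//.
  by rewrite (bigD1 (i, j, k))//= lerDl sumr_ge0.
pose D : R := d%:R.
have D0 : 0 <= D by rewrite ler0n.
have col_le (v : 'cV[R]_d) M : (forall i, `|v i 0| <= M) -> fnorm v <= D * M.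
  move=> vM; apply: (le_trans (fnorm_le_sum _)); apply: sum_ord_le => i.
  by rewrite big_ord1.
have mx_le (v : 'M[R]_d) M : (forall i j, `|v i j| <= M) -> fnorm v <= D * (D * M).
  move=> vM; apply: (le_trans (fnorm_le_sum _)); apply: sum_ord_le => i.
  exact: sum_ord_le.
pose C := D * M1 + D * (D * M2) + D * (D * (D * M3)) + D * (D * (D * L)).
have H2 y : fnorm (hess g y) <= D * (D * M2).
  by apply: mx_le => i j; rewrite mxE (gM2 (i, j)).
have c1 : 0 <= D * M1 by rewrite mulr_ge0.
have c2 : 0 <= D * (D * M2) by rewrite !mulr_ge0.
have c3 : 0 <= D * (D * (D * M3)) by rewrite !mulr_ge0.
have c4 : 0 <= D * (D * (D * L)) by rewrite !mulr_ge0.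
exists C; split.
- by rewrite /C; lra.
- move=> x h; have := pderiv_lipschitz x h gk (s := [::]) isT gM1.
  move=> /le_trans; apply; rewrite mulrCA mulrC ler_wpM2r ?fnorm_ge0//.
  by rewrite /C; lra.
- move=> x; apply: (@le_trans _ _ (D * M1)); last by rewrite /C; lra.
  by apply: col_le => i; rewrite mxE.
- by move=> x; apply: (le_trans (H2 x)); rewrite /C; lra.
- move=> x h; apply: (@le_trans _ _ (D * (D * (fnorm h * M2)))).
    apply: col_le => i; rewrite !mxE.
    by apply: (pderiv_lipschitz (s := [:: i]) x h gk) => // j y; exact: (gM2 (j, i)).
  rewrite (_ : _ * _ = D * (D * M2) * fnorm h); last by ring.
  by rewrite ler_wpM2r ?fnorm_ge0// /C; lra.
- move=> x h; apply: (@le_trans _ _ (D * (D * (D * (fnorm h * M3))))).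
    apply: mx_le => i j; rewrite !mxE.
    apply: (pderiv_lipschitz (s := [:: i; j]) x h gk) => // k y.
    exact: (gM3 (k, i, j)).
  rewrite (_ : _ * _ = D * (D * (D * M3)) * fnorm h); last by ring.
  by rewrite ler_wpM2r ?fnorm_ge0// /C; lra.
- move=> x h; apply: (le_trans (taylor2_Ck x h gk H2)).
  by rewrite ler_wpM2r ?exprn_ge0 ?fnorm_ge0// /C; lra.
- move=> x h.
  have := taylor4_le (fun t => is_derive_line1 x h t gk)
    (fun t => is_derive_line2 x h t gk) (fun t => is_derive_line3 x h t gk)
    (M := C * (fnorm h ^+ 3 * fnorm h `^ beta)).
  rewrite scale1r scale0r addr0 -dot_grad; apply => t /andP[t0 t1].
  rewrite /third_form -sumrB; under eq_bigr do rewrite -mulrBr -sumrB.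
  apply: (@le_trans _ _ (d%:R * (fnorm h * (d%:R * (fnorm h * (d%:R * (fnorm h * (L * fnorm h `^ beta)))))))).
    apply: norm_sum_coord_le => i; under eq_bigr do rewrite -mulrBr -sumrB.
    apply: norm_sum_coord_le => j; under eq_bigr do rewrite -mulrBr.
    apply: norm_sum_coord_le => k; apply: (le_trans (gL _ _ _ _ _)).
    rewrite addrC addKr ler_wpM2l// fnormZ ge0_ler_powR// ?nnegrE ?mulr_ge0 ?fnorm_ge0//.
    by rewrite ger0_norm// ler_piMl ?fnorm_ge0.
  rewrite (_ : _ * _ = D * (D * (D * L)) * (fnorm h ^+ 3 * fnorm h `^ beta)); last first.
    by rewrite /D; ring.
  rewrite ler_wpM2r ?mulr_ge0 ?exprn_ge0 ?fnorm_ge0 ?powR_ge0//.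
  by rewrite /C; lra.
Qed.

End Smooth.

(** * Independence and the scheme *)

Section BorelVectors.
Set Implicit Arguments.
Unset Strict Implicit.
Context {R : realType}.

Lemma continuous_borelV_measurable (m : nat) (f : 'cV[R]_m -> R) :
  continuous f -> measurable_fun setT (f : borelV R m -> R).
Proof.
move=> cf; apply: (measurability _ (RGenOpens.measurableE R)).
move=> _ [_ [x [y ->] <-]]; rewrite setTI; apply: sub_sigma_algebra.
by move/continuousP : cf; apply; exact: interval_open.
Qed.

(* The Borel sets of the sup-norm topology are generated by countably many
   rational balls, which are boxes. *)
Lemma borelV_measurable_coord (m : nat) (disp : measure_display)
    (T : measurableType disp) (Z : T -> 'cV[R]_m) :
  (forall i, measurable_fun setT (fun w => Z w i 0)) ->
  measurable_fun setT (Z : T -> borelV R m).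
Proof.
move=> mZ; apply: (@measurability _ _ T (borelV R m) setT Z (@open 'cV[R]_m)) => //.
move=> _ [U oU <-]; rewrite setTI.
pose c (q : 'cV[rat]_m * nat) : 'cV[R]_m := map_mx ratr q.1.
pose box (q : 'cV[rat]_m * nat) : set 'cV[R]_m :=
  [set v | forall i, `|c q i 0 - v i 0| < q.2.+1%:R^-1].
(* Boxes that are not contained in U are replaced by the empty set, so that the union runs over a
   whole countable type. *)
pose F (q : 'cV[rat]_m * nat) : set T :=
  if pselect (box q `<=` U) then Z @^-1` (box q) else set0.
have -> : Z @^-1` U = \bigcup_q F q.
  apply/seteqP; split => [w /= UZw|w [q _]]; last first.
    by rewrite /F; case: pselect => //= qU; exact: qU.
  have := @open_nbhs_nbhs _ (Z w) U (conj oU UZw).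
  rewrite -nbhs_ballE => -[e /= e0 eU].
  have [n] : exists n : nat, n.+1%:R^-1 < e / 2.
    exists (Num.truncn (e / 2)^-1).
    by rewrite -ltf_pV2 ?(posrE, divr_gt0)// invrK truncnS_gt.
  move=> ne.
  have : 0 < n.+1%:R^-1 :> R by rewrite invr_gt0.
  move uE : (n.+1%:R^-1 : R) ne => u ne u0.
  have /choice[q qP] : forall i : 'I_m, exists q : rat,
      `|ratr q - Z w i 0| < u.
    move=> i; have [|q] := @rat_in_itvoo R (Z w i 0 - u) (Z w i 0 + u).
      by lra.
    by rewrite in_itv/= => /andP[? ?]; exists q; rewrite ltr_distlC; lra.
  exists (\col_i q i, n) => //; rewrite /F; case: pselect => [qU|] /=.
    by move=> i; rewrite /c !mxE uE.
  case => v vq; apply: eU; split => // i j; rewrite ord1.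
  rewrite /ball/= (_ : _ - _ = (Z w i 0 - ratr (q i)) + (ratr (q i) - v i 0)); last by ring.
  apply: (le_lt_trans (ler_normD _ _)); rewrite distrC.
  by have := qP i; have := vq i; rewrite /c !mxE uE /=; lra.
apply: countable_bigcupT_measurable; first exact: countableP.
move=> q; rewrite /F; case: (pselect _) => bU /=; last exact: measurable0.
have -> : Z @^-1` box q = \bigcap_i (fun w => Z w i 0) @^-1` [set v | `|c q i 0 - v| < q.2.+1%:R^-1].
  by apply/seteqP; split => [w h i _|w h i]; [exact: h|exact: (h i I)].
apply: fin_bigcap_measurable => [|i _]; first exact: finite_finset.
rewrite -[X in measurable X]setTI; apply: mZ => //.
exact: (measurable_ball (c q i 0)).
Qed.

End BorelVectors.

Section Independence.
Set Implicit Arguments.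
Unset Strict Implicit.
Local Open Scope ereal_scope.
Context {R : realType} {disp : measure_display} {Omega : measurableType disp}.
Variable P : probability Omega R.

(** Independence identifies the joint law with the product of the marginals, and Tonelli's theorem
    applies. Only the law of [Z] matters, so a copy [Z'] may stand for it: every innovation can be
    replaced by the first one. *)
Lemma ge0_integral_indep (d1 d2 : measure_display) (T1 : measurableType d1)
    (T2 : measurableType d2) (X : Omega -> T1) (Z Z' : Omega -> T2)
    (h : (T1 * T2)%type -> \bar R) :
  measurable_fun setT X -> measurable_fun setT Z -> measurable_fun setT Z' ->
  (forall A B, measurable A -> measurable B ->
    P (X @^-1` A `&` Z @^-1` B) = P (X @^-1` A) * P (Z @^-1` B)) ->
  (forall B, measurable B -> P (Z @^-1` B) = P (Z' @^-1` B)) ->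
  measurable_fun setT h -> (forall z, 0 <= h z) ->
  \int[P]_w h (X w, Z w) = \int[P]_w \int[P]_w' h (X w, Z' w').
Proof.
move=> mX mZ mZ' ind law mh h0.
pose X_ : {mfun Omega >-> T1} := HB.pack X (isMeasurableFun.Build _ _ _ _ X mX).
pose Z'_ : {mfun Omega >-> T2} := HB.pack Z' (isMeasurableFun.Build _ _ _ _ Z' mZ').
have mXZ : measurable_fun setT (fun w => (X w, Z w)) by exact: measurable_fun_pair.
pose XZ : {mfun Omega >-> (T1 * T2)%type} :=
  HB.pack (fun w => (X w, Z w)) (isMeasurableFun.Build _ _ _ _ _ mXZ).
have -> : \int[P]_w h (X w, Z w) = \int[distribution P XZ]_z h z.
  by rewrite ge0_integral_distribution.
have -> : \int[distribution P XZ]_z h z =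
    \int[distribution P X_ \x distribution P Z'_]_z h z.
  apply: eq_measure_integral => A mA _; apply/esym.
  apply: product_measure_unique => // B C mB mC.
  by have := ind _ _ mB mC; rewrite (law _ mC).
rewrite fubini_tonelli1// ge0_integral_distribution//; last first.
- by move=> x; apply: integral_ge0 => y _.
- exact: measurable_fun_fubini_tonelli_F.
apply: eq_integral => w _ /=; rewrite /fubini_F ge0_integral_distribution//.
exact: measurable_fun_pair2.
Qed.

(** Both sides, as functions of A, are finite measures that agree on the pi-system [G], hence on the
    sigma-algebra that it generates. *)
Lemma indep_g_sigma_algebra (d2 : measure_display) (T2 : measurableType d2)
    (G : set (set Omega)) (Z : Omega -> T2) (B : set T2) :
  G `<=` measurable -> setI_closed G -> G setT ->
  measurable_fun setT Z -> measurable B ->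
  (forall A, G A -> P (A `&` Z @^-1` B) = P A * P (Z @^-1` B)) ->
  forall A, <<s G >> A -> P (A `&` Z @^-1` B) = P A * P (Z @^-1` B).
Proof.
move=> Gm GI GT mZ mB GZB A sA.
have mZB : measurable (Z @^-1` B) by rewrite -[X in measurable X]setTI; exact: mZ.
pose k : {nonneg R} := NngNum (fine_ge0 (measure_ge0 P (Z @^-1` B))).
have kE : k%:num%:E = P (Z @^-1` B) by rewrite /= fineK// fin_num_measure.
suff : mrestr P mZB A = mscale k P A.
  by rewrite /mrestr/= /mscale/= -/k kE muleC.
apply: (@g_sigma_algebra_measure_unique _ R Omega G Gm (fun=> setT)) => //.
- by apply/seteqP; split => // w _; exists 0%N.
- by move=> C GC; rewrite [LHS](GZB _ GC) -kE muleC.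
- move=> _; apply: (@le_lt_trans _ _ 1%E); last exact: ltry.
  by apply: probability_le1; exact: measurableI.
Qed.

End Independence.

Section OneStep.
Set Implicit Arguments.
Unset Strict Implicit.
Context {R : realType} {d r : nat}.
Variables (b : 'cV[R]_d -> 'cV[R]_d) (sigma : 'cV[R]_d -> 'M[R]_(d, r)).

Definition one_step (g : R) (x : 'cV[R]_d) (u : 'cV[R]_r) : 'cV[R]_d :=
  x + g *: b x + Num.sqrt g *: (sigma x *m u).

(** The Lipschitz bound is Euclidean while the topology comes from the sup norm; [fnorm_le_sum]
    compares the two up to a factor d. *)
Lemma fnorm_lipschitz_continuous (f : 'cV[R]_d -> R) (L : R) :
  (forall x y, `|f x - f y| <= L * fnorm (x - y)) -> continuous f.
Proof.
move=> fL x; apply/(@cvgrPdist_lt _ _ _ (nbhs x) (nbhs_filter x)) => e e0.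
pose K : R := (`|L| + 1) * (d%:R + 1).
have K0 : 0 < K by rewrite mulr_gt0// ltr_wpDl// ler0n.
pose D := e / K; have D0 : 0 < D by rewrite divr_gt0.
have eE : e = K * D by rewrite /D mulrCA divff ?mulr1// gt_eqF.
near=> y.
have xy : ball x D y by near: y; exact: nbhsx_ballx.
apply: (le_lt_trans (fL x y)).
have le1 : fnorm (x - y) <= d%:R * D.
  apply: (le_trans (fnorm_le_sum _)); apply: sum_ord_le => i.
  rewrite big_ord1 !mxE; have [_ /(_ i 0)] := xy.
  by rewrite -ball_normE => /ltW.
have le2 : L * fnorm (x - y) <= `|L| * (d%:R * D).
  rewrite (@le_trans _ _ (`|L| * fnorm (x - y)))//.
    by rewrite ler_wpM2r ?fnorm_ge0// ler_norm.
  by rewrite ler_wpM2l.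
apply: (le_lt_trans le2).
rewrite eE mulrA ltr_pM2r// /K mulrDr mulr1 mulrDl mul1r.
by rewrite -addrA ltrDl ltr_wpDl// ?ler0n// ltr_wpDl.
Unshelve. all: by end_near.
Qed.

Lemma lipschitz_mx_continuous (m n : nat) (f : 'cV[R]_d -> 'M[R]_(m, n)) i j :
  lipschitz_mx f -> continuous (fun x => f x i j).
Proof.
move=> [L fL]; apply: (fnorm_lipschitz_continuous (L := L)) => x y.
apply: le_trans (fL x y).
by rewrite (_ : _ - _ = (f x - f y) i j) ?norm_coord_le// !mxE.
Qed.

Lemma borelV_coord_measurable (m : nat) (disp : measure_display)
    (T : measurableType disp) (Z : T -> 'cV[R]_m) i :
  measurable_fun setT (Z : T -> borelV R m) ->
  measurable_fun setT (fun w => Z w i 0).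
Proof.
move=> mZ; apply: (measurableT_comp (f := fun v : borelV R m => v i 0)) => //.
apply: continuous_borelV_measurable => x; exact: coord_continuous.
Qed.

Hypotheses (b_lip : lipschitz_mx b) (sigma_lip : lipschitz_mx sigma).

Lemma one_step_measurable (g : R) (disp : measure_display)
    (T : measurableType disp) (X : T -> 'cV[R]_d) (Z : T -> 'cV[R]_r) :
  measurable_fun setT (X : T -> borelV R d) ->
  measurable_fun setT (Z : T -> borelV R r) ->
  measurable_fun setT ((fun w => one_step g (X w) (Z w)) : T -> borelV R d).
Proof.
move=> mX mZ; apply: borelV_measurable_coord => i.
have comp (f : 'cV[R]_d -> R) : continuous f -> measurable_fun setT (fun w => f (X w)).
  by move=> cf; apply: (measurableT_comp (continuous_borelV_measurable cf)).
have -> : (fun w => one_step g (X w) (Z w) i 0) = (fun w => X w i 0 + g * b (X w) i 0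
    + Num.sqrt g * \sum_j sigma (X w) i j * Z w j 0).
  by apply/funext => w; rewrite !mxE.
apply: measurable_funD; first apply: measurable_funD.
- exact: borelV_coord_measurable.
- apply: measurable_funM => //; apply: (comp (fun x => b x i 0)).
  exact: lipschitz_mx_continuous.
- apply: measurable_funM => //; apply: measurable_sum => j.
  apply: measurable_funM; last exact: borelV_coord_measurable.
  apply: (comp (fun x => sigma x i j)).
  exact: lipschitz_mx_continuous.
Qed.

End OneStep.

(** * Integrating out the next innovation given the past *)

Section History.
Set Implicit Arguments.
Unset Strict Implicit.
Context {R : realType} {d r : nat} {disp : measure_display}
  {Omega : measurableType disp}.
Variable P : probability Omega R.
Variables (b : 'cV[R]_d -> 'cV[R]_d) (sigma : 'cV[R]_d -> 'M[R]_(d, r)).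
Variables (gamma : nat -> R).
Variables (X0 : Omega -> 'cV[R]_d) (U : nat -> Omega -> 'cV[R]_r).
Hypotheses (b_lip : lipschitz_mx b) (sigma_lip : lipschitz_mx sigma).
Hypotheses (hX0 : initial_cond P X0) (hGC : GC P X0 U).

Let X := scheme b sigma gamma X0 U.

Definition noise_events (n : nat) : set (set Omega) :=
  if n is 0%N then sigma_of X0 else sigma_of (U n).

(* The pi-system generating the sigma-algebra of X_0, U_1, .., U_n. *)
Definition history (n : nat) : set (set Omega) :=
  [set A | exists2 B : nat -> set Omega, (forall k, noise_events k (B k)) &
    A = \bigcap_(k in [set k | (k <= n)%N]) B k].

Let sigma_ofI (m : nat) (Z : Omega -> 'cV[R]_m) : setI_closed (sigma_of Z).
Proof.
move=> _ _ [A mA <-] [B mB <-]; exists (A `&` B); first exact: measurableI.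
by rewrite !setTI preimage_setI.
Qed.

Let noise_eventsI n : setI_closed (noise_events n).
Proof. by case: n => [|n]; exact: sigma_ofI. Qed.

Let noise_eventsT n : noise_events n setT.
Proof. by case: n => [|n]; exists setT => //; rewrite setTI preimage_setT. Qed.

Let noise_events_measurable n : noise_events n `<=` measurable.
Proof.
case: n => [|n] _ [A mA <-]; first exact: (X0_measurable hX0).
exact: (U_measurable hGC).
Qed.

Lemma history_measurable n : history n `<=` measurable.
Proof.
move=> _ [B nB ->]; apply: bigcap_measurable.
  by exists 0%N.
by move=> k _; exact: noise_events_measurable (nB k).
Qed.

Lemma history_setI n : setI_closed (history n).
Proof.
move=> _ _ [A nA ->] [B nB ->]; exists (fun k => A k `&` B k).
  by move=> k; exact: noise_eventsI.
by rewrite bigcapI.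
Qed.

Lemma history_setT n : history n setT.
Proof. by exists (fun=> setT) => //; apply/esym/bigcapT. Qed.

Lemma noise_events_history n k : (k <= n)%N -> noise_events k `<=` history n.
Proof.
move=> kn A kA; exists (fun j => if j == k then A else setT).
  by move=> j; case: eqP => [->|].
apply/seteqP; split => [w Aw j _|w /(_ k kn)]; first by case: ifP.
by rewrite eqxx.
Qed.

(** The product formula of mutual independence is used twice, for the indices 0, .., n+1 and for 0,
    .., n, and the two are compared. *)
Lemma history_indep n A B : history n A -> noise_events n.+1 B ->
  P (A `&` B) = (P A * P B)%E.
Proof.
move=> [C nC ->] nB.
pose D k := if k == n.+1 then B else C k.
have nD k : noise_events k (D k) by rewrite /D; case: eqP => [->|].
have DC k : (k <= n)%N -> D k = C k by rewrite /D; case: eqP => // ->; rewrite ltnn.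
have fin E : measurable E -> (fine (P E))%:E = P E.
  by move=> mE; rewrite fineK// fin_num_measure.
have mC : measurable (\bigcap_(k in [set k | (k <= n)%N]) C k).
  by apply: (@history_measurable n); exists C.
have indep := GC_indep hGC.
have := indep (iota 0 n.+2) D (iota_uniq _ _) (fun k _ => nD k).
have := indep (iota 0 n.+1) C (iota_uniq _ _) (fun k _ => nC k).
have iotaE m : [set` iota 0 m.+1] = [set k | (k <= m)%N].
  by apply/seteqP; split => k; rewrite /mkset mem_iota add0n ltnS.
rewrite !iotaE.
have -> : \bigcap_(k in [set k | (k <= n.+1)%N]) D k =
    \bigcap_(k in [set k | (k <= n)%N]) C k `&` B.
  apply/seteqP; split => [w h|w [h Bw] k /=].
    split => [k kn|]; first by rewrite -DC//; apply: h; exact: leqW.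
    by have := h n.+1 (leqnn _); rewrite /D eqxx.
  rewrite leq_eqVlt => /orP[/eqP ->|kn]; first by rewrite /D eqxx.
  by rewrite DC//; exact: h.
have prodE : \prod_(k <- iota 0 n.+1) fine (P (D k)) =
    \prod_(k <- iota 0 n.+1) fine (P (C k)).
  rewrite big_seq [RHS]big_seq; apply: eq_bigr => k.
  by rewrite mem_iota add0n ltnS => /andP[_ kn]; rewrite DC.
move=> -> ->; rewrite -(addn1 n.+1) iotaD big_cat big_seq1 EFinM add0n prodE.
by rewrite [X in fine (P X)]/D eqxx fin//; exact: noise_events_measurable nB.
Qed.

Notation hist n := (g_sigma_algebraType (history n)).

Let noise_measurable n k : (k <= n)%N -> forall A,
  noise_events k A -> measurable (A : set (hist n)).
Proof.
by move=> kn A kA; apply: sub_sigma_algebra; exact: noise_events_history kA.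
Qed.

Lemma scheme_history n k : (k <= n)%N ->
  measurable_fun setT (X k : hist n -> borelV R d).
Proof.
elim: k => [_|k IH kn].
  move=> _ A mA; apply: (noise_measurable (leq0n n)).
  by exists A.
have mU : measurable_fun setT (U k.+1 : hist n -> borelV R r).
  by move=> _ A mA; apply: (noise_measurable kn); exists A.
exact: (one_step_measurable b_lip sigma_lip _ (IH (ltnW kn)) mU).
Qed.

Lemma history_id_measurable n : measurable_fun setT (idfun : Omega -> hist n).
Proof.
move=> _ A mA; rewrite setTI preimage_id.
move: A mA; apply: smallest_sub; first exact: sigma_algebra_measurable.
exact: history_measurable.
Qed.

(** The whole past is treated as a single random element: the identity map from Omega to Omega
    endowed with the sigma-algebra of the history. Tonelli's theorem then takes the place of a
    conditional expectation. *)
Lemma ge0_integral_next n (h : (hist n * borelV R r)%type -> \bar R) :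
  measurable_fun setT h -> (forall z, (0 <= h z)%E) ->
  (\int[P]_w h (w, U n.+1 w) = \int[P]_w \int[P]_w' h (w, U 1%N w'))%E.
Proof.
move=> mh h0; have mU k := U_measurable hGC (ltn0Sn k).
apply: (ge0_integral_indep (@history_id_measurable n) (mU n) (mU 0%N)) => //.
- move=> A B mA mB; apply: (indep_g_sigma_algebra (@history_measurable n)
    (@history_setI n) (history_setT n) (mU n) mB) => // C hC.
  by apply: history_indep hC _; exists B => //; rewrite setTI.
- by move=> B mB; exact: (U_law hGC).
Qed.

End History.

Section NonnegativeIntegrals.
Set Implicit Arguments.
Unset Strict Implicit.
Local Open Scope ereal_scope.
Context {R : realType} {disp : measure_display} {Omega : measurableType disp}.

(* Unlike the library's [ge0_le_integral], no measurability is assumed. *)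
Lemma ge0_le_integralT (mu : {measure set Omega -> \bar R}) (f g : Omega -> \bar R) :
  (forall x, 0 <= f x) -> (forall x, f x <= g x) ->
  \int[mu]_x f x <= \int[mu]_x g x.
Proof.
move=> f0 fg; have g0 x : 0 <= g x by exact: le_trans (fg x).
rewrite !ge0_integralTE//; apply: ereal_sup_le => _ [h hf <-].
by exists h => // x; exact: le_trans (hf x) (fg x).
Qed.

End NonnegativeIntegrals.

Section SchemeExpectations.
Set Implicit Arguments.
Unset Strict Implicit.
Context {R : realType} {d r : nat} {disp : measure_display}
  {Omega : measurableType disp}.
Variable P : probability Omega R.
Variables (b : 'cV[R]_d -> 'cV[R]_d) (sigma : 'cV[R]_d -> 'M[R]_(d, r)).
Variables (gamma : nat -> R).
Variables (X0 : Omega -> 'cV[R]_d) (U : nat -> Omega -> 'cV[R]_r).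
Hypotheses (b_lip : lipschitz_mx b) (sigma_lip : lipschitz_mx sigma).
Hypotheses (hX0 : initial_cond P X0) (hGC : GC P X0 U).

Let X := scheme b sigma gamma X0 U.
Notation hist n := (g_sigma_algebraType (history X0 U n)).

Lemma scheme_measurable n : measurable_fun setT (X n : Omega -> borelV R d).
Proof.
have mX := @scheme_history _ _ _ _ Omega b sigma gamma X0 U b_lip sigma_lip n n (leqnn n).
exact: (measurableT_comp mX (@history_id_measurable _ _ _ _ _ _ _ _ hX0 hGC n)).
Qed.

Let X_measurable_fst n k (f : 'cV[R]_d -> R) : (k <= n)%N ->
  measurable_fun setT (f : borelV R d -> R) ->
  measurable_fun setT (fun z : (hist n * borelV R r)%type => f (X k z.1)).
Proof.
move=> kn mf; apply: (measurableT_comp mf).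
apply: measurableT_comp => //.
exact: (scheme_history gamma b_lip sigma_lip kn).
Qed.

Let next_measurable n (f : 'cV[R]_d -> R) :
  measurable_fun setT (f : borelV R d -> R) ->
  measurable_fun setT (fun z : (hist n * borelV R r)%type =>
    f (one_step b sigma (gamma n.+1) (X n z.1) z.2)).
Proof.
move=> mf; apply: (measurableT_comp mf).
apply: one_step_measurable => //.
apply: measurableT_comp => //.
exact: (scheme_history gamma b_lip sigma_lip (leqnn n)).
Qed.

Lemma exp_moment_next n (f : 'cV[R]_d -> R) :
  measurable_fun setT (f : borelV R d -> R) ->
  (\int[P]_w (expR (f (X n.+1 w)))%:E =
   \int[P]_w \int[P]_w'
     (expR (f (one_step b sigma (gamma n.+1) (X n w) (U 1 w'))))%:E)%E.
Proof.
move=> mf; apply: (ge0_integral_next hX0 hGC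
  (h := fun z => (expR (f (one_step b sigma (gamma n.+1) (X n z.1) z.2)))%:E)).
- apply/measurable_EFinP; apply: measurableT_comp => //.
  exact: next_measurable.
- by move=> z; rewrite lee_fin expR_ge0.
Qed.

(** Integrating out the newest innovation with the past frozen costs at most exp (Psi_n (X_n)),
    which is what the new term of the sum removes. Psi depends on k because the step does. *)
Lemma exp_supermartingale (f : 'cV[R]_d -> R) (Psi : nat -> 'cV[R]_d -> R) :
  measurable_fun setT (f : borelV R d -> R) ->
  (forall k, measurable_fun setT (Psi k : borelV R d -> R)) ->
  (forall k x,
    (\int[P]_w (expR (f (one_step b sigma (gamma k.+1) x (U 1 w)) - f x))%:E
     <= (expR (Psi k x))%:E)%E) ->
  forall n, (\int[P]_w (expR (f (X n w) - f (X0 w)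
    - \sum_(k < n) Psi k (X k w)))%:E <= 1)%E.
Proof.
move=> mf mPsi step; pose M n w := f (X n w) - f (X0 w) - \sum_(k < n) Psi k (X k w).
elim=> [|n IH].
  under eq_integral do rewrite big_ord0 subr0 subrr expR0.
  by rewrite integral_cst// mul1e; exact: probability_le1.
(* The next exponential is split into the factor c, known at time n, and the factor g, the only one
   to contain the new innovation. *)
pose c w := expR (M n w - Psi n (X n w)).
pose g x u := expR (f (one_step b sigma (gamma n.+1) x u) - f x).
have -> : (\int[P]_w (expR (f (X n.+1 w) - f (X0 w)
    - \sum_(k < n.+1) Psi k (X k w)))%:E
  = \int[P]_w (c w * g (X n w) (U n.+1 w))%:E)%E.
  apply: eq_integral => w _; rewrite /c /g -expRD big_ord_recr /=.
  rewrite /M -/(one_step b sigma (gamma n.+1) (X n w) (U n.+1 w)).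
  by congr (expR _)%:E; ring.
rewrite (ge0_integral_next hX0 hGC (n := n) (h := fun z => (c z.1 * g (X n z.1) z.2)%:E)).
- apply: le_trans IH; apply: ge0_le_integralT => w.
    by apply: integral_ge0 => w' _; rewrite lee_fin mulr_ge0 ?expR_ge0.
  under eq_integral do rewrite EFinM.
  rewrite /= ge0_integralZl_EFin ?expR_ge0//.
  + apply: (@le_trans _ _ ((c w)%:E * (expR (Psi n (X n w)))%:E)%E).
      by apply: lee_wpmul2l; [rewrite lee_fin expR_ge0|exact: step].
    by rewrite -EFinM /c -expRD subrK.
  + by move=> w' _; rewrite lee_fin expR_ge0.
  + apply/measurable_EFinP; apply: measurableT_comp => //.
    apply: measurable_funB => //.
    apply: (measurableT_comp mf).
    apply: (one_step_measurable b_lip sigma_lip _ (X := fun=> X n w)) => //.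
    exact: (U_measurable hGC).
- apply/measurable_EFinP; apply: measurable_funM.
    rewrite /c /M; apply: (measurableT_comp (@measurable_expR R)).
    apply: measurable_funB; last exact: X_measurable_fst.
    apply: measurable_funB; first apply: measurable_funB.
    + exact: X_measurable_fst.
    + exact: (X_measurable_fst (leq0n n)).
    + by apply: measurable_sum => k; apply: X_measurable_fst => //; exact: ltnW.
  rewrite /g; apply: (measurableT_comp (@measurable_expR R)).
  apply: measurable_funB; last exact: X_measurable_fst.
  exact: next_measurable.
- by move=> z; rewrite lee_fin mulr_ge0 ?expR_ge0.
Qed.

End SchemeExpectations.

(** * Laplace transform of one step *)

Section Means.
Set Implicit Arguments.
Unset Strict Implicit.
Context {R : realType} {disp : measure_display} {Omega : measurableType disp}.
Variable P : probability Omega R.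

(** Integrability and the value of the integral are carried together, so that means of polynomials
    in the noise follow by linearity alone. *)
Definition has_mean (f : Omega -> R) (m : R) : Prop :=
  P.-integrable setT (fun w => (f w)%:E) /\ (\int[P]_w (f w)%:E = m%:E)%E.

Lemma has_mean_eq (f g : Omega -> R) (m n : R) :
  f =1 g -> m = n -> has_mean f m -> has_mean g n.
Proof. by move=> /funext -> ->. Qed.

Lemma has_mean_cst (c : R) : has_mean (fun=> c) c.
Proof.
split; first exact: (finite_measure_integrable_cst P c).
by rewrite integral_cst// [X in (_ * X)%E](probability_setT P) mule1.
Qed.

Lemma has_meanD (f g : Omega -> R) (m n : R) :
  has_mean f m -> has_mean g n -> has_mean (fun w => f w + g w) (m + n).
Proof.
move=> [fi fm] [gi gn]; split.
  by under eq_fun do rewrite EFinD; exact: integrableD.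
by under eq_integral do rewrite EFinD; rewrite integralD// fm gn.
Qed.

Lemma has_meanZ (c : R) (f : Omega -> R) (m : R) :
  has_mean f m -> has_mean (fun w => c * f w) (c * m).
Proof.
move=> [fi fm]; split.
  by under eq_fun do rewrite EFinM; exact: integrableZl.
by under eq_integral do rewrite EFinM; rewrite integralZl// fm.
Qed.

Lemma has_mean_sum (I : Type) (s : seq I) (f : I -> Omega -> R) (m : I -> R) :
  (forall i, has_mean (f i) (m i)) ->
  has_mean (fun w => \sum_(i <- s) f i w) (\sum_(i <- s) m i).
Proof.
move=> fm; elim: s => [|i s IH].
  by apply: has_mean_eq (has_mean_cst 0) => [w|]; rewrite big_nil.
by apply: has_mean_eq (has_meanD (fm i) IH) => [w|]; rewrite big_cons.
Qed.

Lemma has_mean_le (f g : Omega -> R) (m : R) : (forall w, 0 <= f w) ->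
  (forall w, f w <= g w) -> has_mean g m -> (\int[P]_w (f w)%:E <= m%:E)%E.
Proof.
move=> f0 fg [gi <-]; apply: ge0_le_integralT => w; rewrite lee_fin//.
Qed.

Lemma integrable_le (f g : Omega -> R) : measurable_fun setT f ->
  (forall w, `|f w| <= g w) -> (\int[P]_w (g w)%:E < +oo)%E ->
  P.-integrable setT (fun w => (f w)%:E).
Proof.
move=> mf fg goo; apply/integrableP; split; first exact/measurable_EFinP.
apply: le_lt_trans goo; apply: ge0_le_integralT => w; first exact: abse_ge0.
by rewrite abse_EFin lee_fin.
Qed.

Lemma integrable_has_mean (f : Omega -> R) :
  P.-integrable setT (fun w => (f w)%:E) ->
  has_mean f (fine (\int[P]_w (f w)%:E)).
Proof. by move=> fi; split; rewrite ?fineK//; exact: integrable_fin_num. Qed.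

Variables (r : nat) (Z : Omega -> 'cV[R]_r).
Hypothesis mZ : measurable_fun setT (Z : Omega -> borelV R r).
Hypothesis expZ : forall c, 0 < c -> (\int[P]_w (expR (c * fnorm (Z w)))%:E < +oo)%E.
Hypothesis Z1 : forall i, (\int[P]_w (Z w i 0)%:E = 0)%E.
Hypothesis Z2 : forall i j, (\int[P]_w (Z w i 0 * Z w j 0)%:E = ((i == j)%:R : R)%:E)%E.
Hypothesis Z3 : forall i j k, (\int[P]_w (Z w i 0 * Z w j 0 * Z w k 0)%:E = 0)%E.

Let mZi i : measurable_fun setT (fun w => Z w i 0).
Proof. exact: borelV_coord_measurable. Qed.

Lemma expR_ge_coord (u : 'cV[R]_r) i : `|u i 0| <= expR (fnorm u).
Proof.
apply: (le_trans (norm_coord_le u i 0)).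
by have := expR_ge1Dx (fnorm u); lra.
Qed.

Lemma noise_mean1 i : has_mean (fun w => Z w i 0) 0.
Proof.
split=> //; apply: integrable_le (expZ ltr01) => // w.
by rewrite mul1r expR_ge_coord.
Qed.

Lemma noise_mean2 i j : has_mean (fun w => Z w i 0 * Z w j 0) (i == j)%:R.
Proof.
split=> //; apply: (integrable_le (g := fun w => expR (2 * fnorm (Z w)))) => [|w|].
- exact: measurable_funM.
- by rewrite normrM expRM_natl expr2 ler_pM ?expR_ge_coord.
- exact: expZ.
Qed.

Lemma noise_mean3 i j k : has_mean (fun w => Z w i 0 * Z w j 0 * Z w k 0) 0.
Proof.
split=> //; apply: (integrable_le (g := fun w => expR (3 * fnorm (Z w)))) => [|w|].
- by apply: measurable_funM => //; exact: measurable_funM.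
- rewrite !normrM expRM_natl !exprS expr0 mulr1 mulrA.
  by rewrite ler_pM ?mulr_ge0 ?ler_pM ?expR_ge_coord.
- exact: expZ.
Qed.

Variables (d : nat) (A : 'M[R]_(d, r)).

Lemma image_mean1 i : has_mean (fun w => (A *m Z w) i 0) 0.
Proof.
apply: has_mean_eq (has_mean_sum _ (fun j => has_meanZ (A i j) (noise_mean1 j))).
  by move=> w; rewrite mxE.
by rewrite big1// => j _; rewrite mulr0.
Qed.

Lemma image_mean2 i j :
  has_mean (fun w => (A *m Z w) i 0 * (A *m Z w) j 0) ((A *m A^T) i j).
Proof.
apply: has_mean_eq (has_mean_sum _ (fun k => has_meanZ (A i k)
  (has_mean_sum _ (fun l => has_meanZ (A j l) (noise_mean2 k l))))).
  move=> w; rewrite !mxE mulr_suml; apply: eq_bigr => k _.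
  by rewrite -mulrA mulr_sumr; congr (_ * _); apply: eq_bigr => l _; ring.
rewrite mxE; apply: eq_bigr => k _; congr (_ * _).
rewrite (bigD1 k)//= eqxx mulr1 big1 ?addr0 ?mxE// => l lk.
by rewrite eq_sym (negbTE lk) mulr0.
Qed.

Lemma image_mean3 i j k :
  has_mean (fun w => (A *m Z w) i 0 * (A *m Z w) j 0 * (A *m Z w) k 0) 0.
Proof.
apply: has_mean_eq (has_mean_sum _ (fun l => has_meanZ (A i l)
  (has_mean_sum _ (fun m => has_meanZ (A j m)
  (has_mean_sum _ (fun n => has_meanZ (A k n) (noise_mean3 l m n))))))).
  move=> w; rewrite !mxE !mulr_suml; apply: eq_bigr => l _.
  rewrite -!mulrA; congr (_ * _); rewrite [RHS]mulrCA [RHS]mulr_suml.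
  apply: eq_bigr => m _; rewrite -[RHS]mulrA; congr (_ * _).
  by rewrite [RHS]mulrA mulr_sumr; apply: eq_bigr => n _; ring.
rewrite big1// => l _; rewrite big1 ?mulr0// => m _; rewrite big1 ?mulr0// => n _.
by rewrite mulr0.
Qed.

End Means.

Section DotProduct.
Set Implicit Arguments.
Unset Strict Implicit.
Context {R : realType} {d : nat}.
Implicit Types (u v w : 'cV[R]_d) (c : R).

Lemma dotC u v : dot u v = dot v u.
Proof. by apply: eq_bigr => i _; rewrite mulrC. Qed.

Lemma dotDl u v w : dot (u + v) w = dot u w + dot v w.
Proof. by rewrite /dot -big_split; apply: eq_bigr => i _; rewrite mxE mulrDl. Qed.

Lemma dotZl c u v : dot (c *: u) v = c * dot u v.
Proof. by rewrite /dot mulr_sumr; apply: eq_bigr => i _; rewrite mxE mulrA. Qed.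

Lemma dotZr c u v : dot u (c *: v) = c * dot u v.
Proof. by rewrite dotC dotZl dotC. Qed.

Lemma dotBl u v w : dot (u - v) w = dot u w - dot v w.
Proof. by rewrite dotDl -scaleN1r dotZl mulN1r. Qed.

Lemma dotDr u v w : dot u (v + w) = dot u v + dot u w.
Proof. by rewrite dotC dotDl !(dotC u). Qed.

Lemma sqr_dot_qform u v : dot u v ^+ 2 = qform (u *m u^T) v.
Proof.
rewrite expr2 /dot mulr_suml; apply: eq_bigr => j _.
rewrite [u j 0 * _]mulrC -mulrA; congr (_ * _); rewrite mulr_sumr.
by apply: eq_bigr => i _; rewrite !mxE big_ord1 !mxE; ring.
Qed.

Lemma fnorm_dot u : fnorm u ^+ 2 = dot u u.
Proof. by rewrite fnorm_sqr_col; apply: eq_bigr => i _; rewrite expr2. Qed.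

End DotProduct.

(** Isolated so that linear arithmetic sees only atoms. The three errors are the Hölder remainder of
    f (e1), the replacement of the squared increment by its linear part squared (e2) and the cubic
    remainder of the exponential (x). *)
Lemma remainder_bookkeeping (R : realType) (eD D D2 l l2 q c x e1 e2 a1 a2 : R) :
  eD <= 1 + D + D2 / 2 + x -> D2 <= l2 + 2 * e2 ->
  D - l - q / 2 - c / 6 <= e1 -> e1 <= a1 -> e2 <= a2 -> x <= a2 ->
  eD <= 1 + l + 2^-1 * q + 6^-1 * c + 2^-1 * l2 + (a1 + 2 * a2).
Proof. lra. Qed.

(** * Pathwise expansion of one step of the scheme *)

Section Increment.
Set Implicit Arguments.
Unset Strict Implicit.
Context {R : realType} {d r : nat}.
Variables (b : 'cV[R]_d -> 'cV[R]_d).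
Variables (s Lb beta t1 : R).
Hypotheses (s0 : 0 < s).
Hypotheses (Lb0 : 0 <= Lb) (bL : forall x y, fnorm (b x - b y) <= Lb * fnorm (x - y)).
Hypotheses (beta0 : 0 <= beta) (beta1 : beta <= 1) (t10 : 0 <= t1).

Variables (f : 'cV[R]_d -> R) (M : R).
Hypotheses (M1 : M <= 1) (fC : Ck 3 f) (fM : smooth_bounds beta M f).
Hypothesis f_drift : lipschitz_const M (fun x => dot (b x) (grad f x)).

Let M0 : 0 <= M := sb_ge0 fM.

(** As b is unbounded, a Lipschitz bound on grad f alone would give g^2 |b x|^2, too large for the
    moments at hand. Writing z for a point of the segment, the difference of gradients against b x
    is split into the increment of <b, grad f> from x to z and <b z - b x, grad f z>. Both are
    linear in |z - x| <= g |b x|, which leaves a single factor |b x|. *)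
Lemma drift_taylor (g : R) x : 0 <= g ->
  `|f (x + g *: b x) - f x - g * dot (b x) (grad f x)|
    <= M * (1 + Lb) * (g ^+ 2 * fnorm (b x)).
Proof.
move=> g0.
have d0 (t : R) : is_derive t 1
    (fun t => f (x + t *: (g *: b x)) - t * (g * dot (b x) (grad f x)))
    (dot (grad f (x + t *: (g *: b x))) (g *: b x) - g * dot (b x) (grad f x)).
  have := is_derive_line1 x (g *: b x) t fC; rewrite -dot_grad => ?.
  by apply: is_derive_eq; rewrite scaler0 add0r /GRing.scale/= mulr1.
have i01 : 0 <= (1 : R) <= 1 by rewrite ler01 lexx.
have := mean_value_le d0 (M := M * (1 + Lb) * (g ^+ 2 * fnorm (b x))) _ i01.
rewrite scale1r scale0r addr0 mul1r mul0r subr0.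
rewrite (_ : _ - _ - _ = f (x + g *: b x) - f x - g * dot (b x) (grad f x)); last by ring.
apply => t /andP[t0 t1']; set z := x + t *: (g *: b x).
rewrite dotZr -mulrBr normrM (ger0_norm g0).
have zx : fnorm (z - x) <= g * fnorm (b x).
  rewrite /z addrC addKr fnormZ fnormZ ger0_norm// (ger0_norm g0).
  by rewrite ler_piMl// mulr_ge0 ?fnorm_ge0.
have -> : dot (grad f z) (b x) - dot (b x) (grad f x) =
    (dot (b z) (grad f z) - dot (b x) (grad f x)) - dot (b z - b x) (grad f z).
  by rewrite dotBl (dotC (grad f z)); ring.
rewrite (_ : M * (1 + Lb) * (g ^+ 2 * fnorm (b x)) =
  g * (M * (g * fnorm (b x)) + Lb * (g * fnorm (b x)) * M)); last by ring.
rewrite ler_wpM2l// (le_trans (ler_normB _ _))// lerD//.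
  by rewrite (le_trans (f_drift z x))// ler_wpM2l.
rewrite (le_trans (norm_dot_le _ _))// ler_pM ?fnorm_ge0//; last exact: sb_grad fM z.
by rewrite (le_trans (bL z x))// ler_wpM2l.
Qed.

(** The term in (grad f)(grad f)^T has the carré du champ as its mean. The Taylor remainder of f
    contributes M t^(3 + beta) and the expansion of the exponential M^2 t^3, both times one
    exponential of the noise norm. *)
Lemma expR_increment_le (t : R) y (A : 'M[R]_(d, r)) (u : 'cV[R]_r) h :
  0 <= t <= t1 -> fnorm A <= s -> h = t *: (A *m u) ->
  expR (f (y + h) - f y) <=
    1 + dot (grad f y) h + 2^-1 * qform (hess f y) h + 6^-1 * third_form f y h
    + 2^-1 * qform (grad f y *m (grad f y)^T) h
    + (M * (t ^+ 3 * t `^ beta) + 2 * M ^+ 2 * t ^+ 3) *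
      (6 * expR ((2 + t1) * s * fnorm u)).
Proof.
move=> /andP[t0 tt1] As hE; rewrite -sqr_dot_qform.
have := expR_le_quadratic (f (y + h) - f y).
set D := f (y + h) - f y; set l := dot (grad f y) h.
have Dh : `|D| <= M * fnorm h := sb_lip fM y h.
have lh : `|l| <= M * fnorm h.
  by rewrite (le_trans (norm_dot_le _ _))// ler_wpM2r ?fnorm_ge0// (sb_grad fM).
have Dl : `|D - l| <= M * fnorm h ^+ 2 := sb_taylor2 fM y h.
have := sb_taylor4 fM y h; rewrite -/D -/l ler_norml => /andP[_ D4].
have : 0 <= s * fnorm u by rewrite mulr_ge0 ?fnorm_ge0 // ltW.
move vE : (s * fnorm u) => v v0.
have hv : fnorm h <= t * v.
  rewrite hE fnormZ ger0_norm// ler_wpM2l// (le_trans (fnorm_mulmx _ _))//.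
  by rewrite -vE ler_wpM2r ?fnorm_ge0.
have h0 : 0 <= fnorm h := fnorm_ge0 h.
have D2 : D ^+ 2 <= l ^+ 2 + 2 * M ^+ 2 * fnorm h ^+ 3.
  rewrite -lerBlDl subr_sqr (le_trans (ler_norm _))// normrM.
  have Dl' : `|D + l| <= 2 * (M * fnorm h).
    by rewrite (le_trans (ler_normD _ _))// mulr_natl mulr2n lerD.
  rewrite (le_trans (ler_pM _ _ Dl Dl'))// le_eqVlt; apply/orP; left.
  by apply/eqP; ring.
(* M <= 1 removes M from the exponent, so that the noise moment in [laplace_cst] is the same for all
   tilts. *)
have eM : expR `|D| <= expR (t1 * v).
  rewrite ler_expR (le_trans Dh)// (le_trans (ler_piMl h0 M1))//.
  by rewrite (le_trans hv)// ler_wpM2r.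
have h3 : fnorm h ^+ 3 <= (t * v) ^+ 3 by apply: lerXn2r; rewrite ?nnegrE ?mulr_ge0//.
have M32 : M ^+ 3 <= M ^+ 2 by rewrite [M ^+ 3]exprSr ler_piMr ?exprn_ge0.
have D3 : `|D| ^+ 3 * expR `|D| <= M ^+ 2 * (t * v) ^+ 3 * expR (t1 * v).
  rewrite ler_pM ?exprn_ge0 ?expR_ge0//.
  rewrite (@le_trans _ _ ((M * fnorm h) ^+ 3))//.
    by apply: lerXn2r; rewrite ?nnegrE ?mulr_ge0//.
  by rewrite exprMn ler_pM ?exprn_ge0.
have hb : fnorm h `^ beta <= t `^ beta * (1 + v).
  rewrite (@le_trans _ _ ((t * v) `^ beta))//.
    by rewrite ge0_ler_powR ?nnegrE ?mulr_ge0.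
  rewrite powRM// ler_wpM2l ?powR_ge0//.
  have [v1|v1] := leP v 1.
    rewrite (@le_trans _ _ 1)//; last by rewrite lerDl.
    have one : 1 `^ beta = 1 :> R by rewrite powR1.
    by rewrite -[leRHS]one; apply: ge0_ler_powR; rewrite ?nnegrE.
  apply: (@le_trans _ _ (v `^ 1)); first by rewrite ler_powR// ltW.
  by rewrite powRr1// lerDr.
have E1 : 1 <= expR (t1 * v) by rewrite -expR0 ler_expR mulr_ge0.
(* The constant 6 is 3!, from v^3 / 3! <= exp v. One more factor exp v absorbs 1 + v, hence the 2 in
   the exponent. *)
have E2 : v ^+ 3 * (1 + v) * expR (t1 * v) <= 6 * expR ((2 + t1) * s * fnorm u).
  rewrite (_ : (2 + t1) * s * fnorm u = v + v + t1 * v); last by rewrite -vE; ring.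
  rewrite !expRD !mulrA ler_wpM2r ?expR_ge0// ler_pM ?exprn_ge0 ?addr_ge0//.
    by have := expR_ge1Dxn 2 v0; rewrite (_ : 3`!%:R = 6 :> R)//; lra.
  exact: expR_ge1Dx.
set E := 6 * expR _ in E2 *.
have E3 : v ^+ 3 * expR (t1 * v) <= E.
  apply: le_trans E2; rewrite ler_wpM2r ?expR_ge0// ler_peMr ?exprn_ge0//.
  by rewrite lerDl.
have E4 : v ^+ 3 * (1 + v) <= E.
  by apply: le_trans E2; rewrite ler_peMr// mulr_ge0 ?exprn_ge0// addr_ge0.
have E5 : v ^+ 3 <= E.
  by apply: le_trans E3; rewrite ler_peMr// exprn_ge0.
have r1 : M * (fnorm h ^+ 3 * fnorm h `^ beta) <= M * (t ^+ 3 * t `^ beta) * E.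
  rewrite -mulrA ler_wpM2l//.
  rewrite (le_trans (ler_pM _ _ h3 hb)) ?exprn_ge0 ?powR_ge0//.
  rewrite [leLHS](_ : _ = t ^+ 3 * t `^ beta * (v ^+ 3 * (1 + v))); last by ring.
  by rewrite ler_wpM2l// mulr_ge0 ?exprn_ge0 ?powR_ge0.
have r2 : M ^+ 2 * fnorm h ^+ 3 <= M ^+ 2 * t ^+ 3 * E.
  rewrite -mulrA ler_wpM2l ?exprn_ge0// (le_trans h3)// exprMn.
  by rewrite ler_wpM2l// exprn_ge0.
have r3 : M ^+ 2 * (t * v) ^+ 3 * expR (t1 * v) <= M ^+ 2 * t ^+ 3 * E.
  rewrite [leLHS](_ : _ = M ^+ 2 * t ^+ 3 * (v ^+ 3 * expR (t1 * v))); last by ring.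
  by rewrite ler_wpM2l// mulr_ge0 ?exprn_ge0.
move=> De; move: (le_trans De (lerD (lexx _) D3)) => {}De.
rewrite -mulrA in D2.
have := remainder_bookkeeping De D2 D4 r1 r2 r3; rewrite [in X in _ -> X]mulrDl.
by rewrite -[2 * M ^+ 2 * _]mulrA -[2 * _ * E]mulrA.
Qed.


End Increment.

Lemma laplace_bookkeeping (R : realType)
    (g L s2 G a e B df p T1 T2 F1 F2 m : R) :
  0 <= L -> 0 <= s2 -> 0 <= G -> 0 <= m * a -> 0 <= m ^+ 2 * e -> 0 <= B ->
  df - g * p <= (1 + L) * B ->
  g * T1 <= g * T2 + s2 * B -> g * F1 <= g * F2 + 2 * s2 * B ->
  df + (g * (2^-1 * T1 + 2^-1 * F1) + 6 * G * (m * a + 2 * m ^+ 2 * e)) <=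
  g * (p + 2^-1 * T2 + 2^-1 * F2)
    + (1 + L + 2 * s2 + 12 * G) * (m * a + m ^+ 2 * e + B).
Proof.
move=> L0 s0 G0; rewrite -(mulrA 2 (m ^+ 2) e).
move: (m * a) (m ^+ 2 * e) => x y x0 y0 B0 hd hT hF.
have p1 : 0 <= L * x by rewrite mulr_ge0.
have p2 : 0 <= s2 * x by rewrite mulr_ge0.
have p3 : 0 <= L * y by rewrite mulr_ge0.
have p4 : 0 <= s2 * y by rewrite mulr_ge0.
have p5 : 0 <= G * B by rewrite mulr_ge0.
have p6 : 0 <= G * x by rewrite mulr_ge0.
have p7 : 0 <= s2 * B by rewrite mulr_ge0.
lra.
Qed.

Section LaplaceTransform.
Set Implicit Arguments.
Unset Strict Implicit.
Context {R : realType} {disp : measure_display} {Omega : measurableType disp}.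
Variable P : probability Omega R.
Variables (d r : nat) (Z : Omega -> 'cV[R]_r).
Hypothesis mZ : measurable_fun setT (Z : Omega -> borelV R r).
Hypothesis expZ : forall c, 0 < c -> (\int[P]_w (expR (c * fnorm (Z w)))%:E < +oo)%E.
Hypothesis Z1 : forall i, (\int[P]_w (Z w i 0)%:E = 0)%E.
Hypothesis Z2 : forall i j, (\int[P]_w (Z w i 0 * Z w j 0)%:E = ((i == j)%:R : R)%:E)%E.
Hypothesis Z3 : forall i j k, (\int[P]_w (Z w i 0 * Z w j 0 * Z w k 0)%:E = 0)%E.

Section Means.
Variables (t : R) (A : 'M[R]_(d, r)).
Let h w := t *: (A *m Z w).

Lemma dot_mean (p : 'cV[R]_d) : has_mean P (fun w => dot p (h w)) 0.
Proof.
apply: has_mean_eq (has_mean_sum _ (fun i => has_meanZ (t * p i 0)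
    (image_mean1 mZ expZ Z1 A i))) => [w|].
  by apply: eq_bigr => i _; rewrite [in RHS]mxE; ring.
by rewrite big1// => i _; rewrite mulr0.
Qed.

Lemma qform_mean (H : 'M[R]_d) :
  has_mean P (fun w => qform H (h w)) (t ^+ 2 * \tr (A *m A^T *m H)).
Proof.
apply: has_mean_eq (has_mean_sum _ (fun j => has_mean_sum _ (fun i =>
    has_meanZ (t ^+ 2 * H i j) (image_mean2 mZ expZ Z2 A j i)))) => [w|].
  apply: eq_bigr => j _; rewrite mulr_sumr; apply: eq_bigr => i _.
  by rewrite [in RHS]mxE [h w i 0]mxE; ring.
rewrite /mxtrace mulr_sumr; apply: eq_bigr => j _; rewrite mxE mulr_sumr.
by apply: eq_bigr => i _; ring.
Qed.

Lemma third_form_mean (f : 'cV[R]_d -> R) y :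
  has_mean P (fun w => third_form f y (h w)) 0.
Proof.
apply: has_mean_eq (has_mean_sum _ (fun j => has_mean_sum _ (fun i =>
    has_mean_sum _ (fun k => has_meanZ (t ^+ 3 * pderiv [:: k; i; j] f y)
    (image_mean3 mZ expZ Z3 A j i k))))) => [w|].
  apply: eq_bigr => j _; rewrite mulr_sumr; apply: eq_bigr => i _.
  rewrite mulrA mulr_sumr; apply: eq_bigr => k _.
  by rewrite [h w j 0]mxE [h w i 0]mxE [h w k 0]mxE; ring.
rewrite big1// => j _; rewrite big1// => i _; rewrite big1// => k _.
by rewrite mulr0.
Qed.

End Means.
Variables (b : 'cV[R]_d -> 'cV[R]_d) (sigma : 'cV[R]_d -> 'M[R]_(d, r)).
Variables (s Lb beta t1 : R).
Hypotheses (s0 : 0 < s) (sigma_s : forall x, fnorm (sigma x) <= s).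
Hypotheses (Lb0 : 0 <= Lb) (bL : forall x y, fnorm (b x - b y) <= Lb * fnorm (x - y)).
Hypotheses (beta0 : 0 <= beta) (beta1 : beta <= 1) (t10 : 0 <= t1).

Variables (f : 'cV[R]_d -> R) (M : R).
Hypotheses (M1 : M <= 1) (fC : Ck 3 f) (fM : smooth_bounds beta M f).
Hypothesis f_drift : lipschitz_const M (fun x => dot (b x) (grad f x)).

Let M0 : 0 <= M := sb_ge0 fM.

(** 1 + Lb comes from [drift_taylor], 2 s^2 pays for moving the second-order coefficients back from
    x + g b x to x, and 12 bounds the two noise errors, with weights 6 and 2 * 6. *)
Definition laplace_cst : R :=
  1 + Lb + 2 * s ^+ 2
  + 12 * fine (\int[P]_w (expR ((2 + t1) * s * fnorm (Z w)))%:E).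

(** The step is taken in two stages: the deterministic move to y = x + g b x, then the noise,
    expanded around y. In this way no product of the unbounded drift with the noise ever has to be
    estimated. *)
Lemma one_step_laplace (g : R) x : 0 <= g -> Num.sqrt g <= t1 ->
  (\int[P]_w (expR (f (one_step b sigma g x (Z w)) - f x))%:E <=
    (expR (g * (generator b sigma f x + 2^-1 * carre_du_champ sigma f x)
      + laplace_cst * (M * (Num.sqrt g ^+ 3 * Num.sqrt g `^ beta)
        + M ^+ 2 * Num.sqrt g ^+ 3 + M * (g ^+ 2 * fnorm (b x)))))%:E)%E.
Proof.
move=> g0 gt1; set t := Num.sqrt g; set y := x + g *: b x; set A := sigma x.
have t0 : 0 <= t := sqrtr_ge0 g.
have tg : t ^+ 2 = g by rewrite sqr_sqrtr.
have c0 : 0 < (2 + t1) * s by rewrite mulr_gt0// ltr_pwDl.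
have mE : has_mean P (fun w => expR ((2 + t1) * s * fnorm (Z w)))
    (fine (\int[P]_w (expR ((2 + t1) * s * fnorm (Z w)))%:E)).
  apply: integrable_has_mean; apply: (integrable_le _ _ (expZ c0)) => [|w].
    apply: (measurableT_comp (@measurable_expR R)); apply: measurable_funM => //.
    apply: (measurableT_comp (f := fun v : borelV R r => fnorm v)) => //.
    apply: continuous_borelV_measurable.
    apply: (fnorm_lipschitz_continuous (L := 1)) => u v; rewrite mul1r ler_norml.
    have := fnormD (u - v) v; have := fnormD (v - u) u.
    by rewrite !subrK -[v - u]opprB fnormN => ? ?; apply/andP; split; lra.
  by rewrite ger0_norm ?expR_ge0.
set G0 := fine _ in mE.
have G00 : 0 <= G0 by apply: fine_ge0; apply: integral_ge0 => w _; rewrite lee_fin expR_ge0.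
have KE : laplace_cst = 1 + Lb + 2 * s ^+ 2 + 12 * G0 by [].
pose err := M * (t ^+ 3 * t `^ beta) + 2 * M ^+ 2 * t ^+ 3.
have mean := has_meanD (has_meanD (has_meanD (has_meanD (has_meanD (has_mean_cst P 1)
  (dot_mean t A (grad f y))) (has_meanZ 2^-1 (qform_mean t A (hess f y))))
  (has_meanZ 6^-1 (third_form_mean t A f y)))
  (has_meanZ 2^-1 (qform_mean t A (grad f y *m (grad f y)^T))))
  (has_meanZ err (has_meanZ 6 mE)).
have le1 : (\int[P]_w (expR (f (y + t *: (A *m Z w)) - f y))%:E <=
    (expR (g * (2^-1 * \tr (A *m A^T *m hess f y)
      + 2^-1 * fnorm (A^T *m grad f y) ^+ 2) + 6 * G0 * err))%:E)%E.
  apply: le_trans (has_mean_le _ _ mean) _ => [w|w|].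
  - exact: expR_ge0.
  - apply: (expR_increment_le s0 beta0 beta1 t10 M1 fM y _ _ (erefl (t *: (A *m Z w)))).
      by rewrite t0.
    exact: sigma_s.
  rewrite lee_fin tg mulr0 !addr0.
  have -> : \tr (A *m A^T *m (grad f y *m (grad f y)^T)) = fnorm (A^T *m grad f y) ^+ 2.
    rewrite /fnorm sqr_sqrtr; last first.
      by rewrite mxtrace_mulT; apply: sumr_ge0 => k _; rewrite -expr2 sqr_ge0.
    rewrite trmx_mul trmxK -!mulmxA mxtrace_mulC.
    by rewrite !mulmxA mxtrace_mulC !mulmxA.
  set X := g * _; set Y := g * _.
  apply: le_trans (expR_ge1Dx _); rewrite /X /Y le_eqVlt; apply/orP; left.
  by apply/eqP; ring.
have -> : (\int[P]_w (expR (f (one_step b sigma g x (Z w)) - f x))%:E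
    = (expR (f y - f x))%:E * \int[P]_w (expR (f (y + t *: (A *m Z w)) - f y))%:E)%E.
  rewrite -ge0_integralZl_EFin ?expR_ge0//.
    apply: eq_integral => w _; rewrite -EFinM -expRD; congr (expR _)%:E.
    by rewrite /one_step -/y -/t -/A; ring.
  apply/measurable_EFinP; apply: (measurableT_comp (@measurable_expR R)).
  apply: measurable_funB => //.
  have fcont : continuous f := (fC (s := [::]) isT).1.
  apply: (measurableT_comp (continuous_borelV_measurable fcont)).
  apply: borelV_measurable_coord => i.
  have -> : (fun w => (y + t *: (A *m Z w)) i 0) =
      (fun w => y i 0 + t * \sum_j A i j * Z w j 0).
    by apply/funext => w; rewrite !mxE.
  apply: measurable_funD => //; apply: measurable_funM => //.
  apply: measurable_sum => j; apply: measurable_funM => //.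
  exact: borelV_coord_measurable.
apply: (le_trans (lee_wpmul2l _ le1)); first by rewrite lee_fin expR_ge0.
rewrite -EFinM -expRD lee_fin ler_expR.
have := drift_taylor Lb0 bL fC fM f_drift x g0; rewrite -/y ler_norml => /andP[_ drift].
have bx0 : 0 <= fnorm (b x) := fnorm_ge0 _.
have gb : fnorm (g *: b x) = g * fnorm (b x) by rewrite fnormZ ger0_norm.
have s20 : 0 <= s ^+ 2 := sqr_ge0 s.
(* The coefficients found at y are brought back to x. The displacement being g b x, each change
   costs M g |b x|, and the factor g in front makes it of order g^2 |b x|. *)
have trace : \tr (A *m A^T *m hess f y) <= \tr (A *m A^T *m hess f x)
    + s ^+ 2 * (M * (g * fnorm (b x))).
  rewrite -lerBlDl -raddfB /= -mulmxBr (le_trans (ler_norm _))//.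
  rewrite -[hess f y - _]trmxK (le_trans (norm_mxtrace_mulT _ _))// fnorm_tr.
  rewrite ler_pM ?fnorm_ge0//; last by rewrite -gb; exact: sb_hess_lip fM x _.
  by rewrite (le_trans (fnorm_mulmx _ _))// fnorm_tr expr2 ler_pM ?fnorm_ge0 ?sigma_s.
have carre : fnorm (A^T *m grad f y) ^+ 2 <= fnorm (A^T *m grad f x) ^+ 2
    + 2 * s ^+ 2 * (M * (g * fnorm (b x))).
  have ATs : fnorm A^T <= s by rewrite fnorm_tr sigma_s.
  have n1 : fnorm (A^T *m grad f y) <= fnorm (A^T *m grad f x) + s * (M * (g * fnorm (b x))).
    rewrite -[grad f y](subrK (grad f x)) mulmxDr addrC (le_trans (fnormD _ _))//.
    rewrite lerD2l (le_trans (fnorm_mulmx _ _))// ler_pM ?fnorm_ge0//.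
    by rewrite -gb; exact: sb_grad_lip fM x _.
  have n2 z : fnorm (A^T *m grad f z) <= s.
    rewrite (le_trans (fnorm_mulmx _ _))// -[leRHS]mulr1 ler_pM ?fnorm_ge0//.
    by rewrite (le_trans (sb_grad fM z)).
  have := n2 y; have := n2 x; move: n1.
  have := fnorm_ge0 (A^T *m grad f y); have := fnorm_ge0 (A^T *m grad f x).
  move: (fnorm (A^T *m grad f x)) (fnorm (A^T *m grad f y)) => p q p0 q0 n1 ps qs.
  rewrite -lerBlDl subr_sqr.
  have dle : q - p <= s * (M * (g * fnorm (b x))) by rewrite lerBlDl.
  have d0 : 0 <= s * (M * (g * fnorm (b x))) by rewrite !mulr_ge0// ltW.
  rewrite (@le_trans _ _ (s * (M * (g * fnorm (b x))) * (q + p)))//.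
    by rewrite ler_wpM2r// addr_ge0.
  rewrite (@le_trans _ _ (s * (M * (g * fnorm (b x))) * (s + s)))//.
    by rewrite ler_wpM2l// lerD.
  by rewrite le_eqVlt; apply/orP; left; apply/eqP; ring.
rewrite /generator /carre_du_champ -/A KE /err.
apply: laplace_bookkeeping => //.
- by rewrite !mulr_ge0 ?exprn_ge0 ?powR_ge0.
- by rewrite !mulr_ge0 ?exprn_ge0.
- by rewrite !mulr_ge0// sqr_ge0.
- by rewrite (le_trans drift)// le_eqVlt; apply/orP; left; apply/eqP; ring.
- by rewrite (le_trans (ler_wpM2l g0 trace))// le_eqVlt; apply/orP; left; apply/eqP; ring.
- by rewrite (le_trans (ler_wpM2l g0 carre))// le_eqVlt; apply/orP; left; apply/eqP; ring.
Qed.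

End LaplaceTransform.

(** * Lyapunov function and exponential moments *)

Section NoiseMoments.
Set Implicit Arguments.
Unset Strict Implicit.
Context {R : realType} {d r : nat} {disp : measure_display}
  {Omega : measurableType disp} (P : probability Omega R).
Variables (X0 : Omega -> 'cV[R]_d) (U : nat -> Omega -> 'cV[R]_r).
Hypothesis hGC : GC P X0 U.

Lemma fnorm_lipschitz (m : nat) : @lipschitz_const R m 1 (@fnorm R m 1).
Proof.
move=> u v; rewrite mul1r ler_norml.
have := fnormD (u - v) v; have := fnormD (v - u) u.
by rewrite !subrK -[v - u]opprB fnormN => ? ?; apply/andP; split; lra.
Qed.

Lemma GC_exp_moment (c : R) : 0 < c ->
  (\int[P]_w (expR (c * fnorm (U 1%N w)))%:E < +oo)%E.
Proof.
move=> c0; have := U_concentration hGC (@fnorm_lipschitz r) c0.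
by rewrite unlock => /le_lt_trans; apply; rewrite ltry.
Qed.

Lemma GC_mean1 i : (\int[P]_w (U 1%N w i 0)%:E = 0)%E.
Proof. by have := U_mean hGC i; rewrite unlock. Qed.

Lemma GC_mean2 i j :
  (\int[P]_w (U 1%N w i 0 * U 1%N w j 0)%:E = ((i == j)%:R : R)%:E)%E.
Proof. by have := U_cov hGC i j; rewrite unlock. Qed.

Lemma GC_mean3 i j k :
  (\int[P]_w (U 1%N w i 0 * U 1%N w j 0 * U 1%N w k 0)%:E = 0)%E.
Proof. by have := U_third hGC i j k; rewrite unlock. Qed.

End NoiseMoments.

Section Lyapunov.
Set Implicit Arguments.
Unset Strict Implicit.
Context {R : realType} {d r : nat}.
Variables (b : 'cV[R]_d -> 'cV[R]_d) (sigma : 'cV[R]_d -> 'M[R]_(d, r)).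
Variables (V : 'cV[R]_d -> R) (vstar CV alphaV betaV : R).
Hypothesis hLV : lyapunov b sigma V vstar CV alphaV betaV.
Variable s : R.
Hypotheses (s0 : 0 < s) (sigma_s : forall x, fnorm (sigma x) <= s).

Notation W x := (Num.sqrt (V x)).
Let N := sup_norm (hess V).

Lemma V_gt0 x : 0 < V x.
Proof. exact: lt_le_trans (vstar_gt0 hLV) (V_ge hLV x). Qed.

Lemma W_gt0 x : 0 < W x.
Proof. by rewrite sqrtr_gt0 V_gt0. Qed.

Lemma W_sqr x : W x ^+ 2 = V x.
Proof. by rewrite sqr_sqrtr// ltW ?V_gt0. Qed.

Lemma W_ge x : Num.sqrt vstar <= W x.
Proof. by rewrite ler_wsqrtr// (V_ge hLV). Qed.

Lemma W_continuous : continuous (fun x => W x).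
Proof.
move=> x; apply: continuous_comp; last exact: sqrt_continuous.
exact: ((V_C2 hLV) [::] isT).1.
Qed.

Lemma fnorm_hess_le x : fnorm (hess V x) <= N.
Proof. by apply: ub_le_sup; [exact: V_hess hLV|exists x]. Qed.

Let N0 : 0 <= N.
Proof. exact: le_trans (fnorm_ge0 _) (fnorm_hess_le 0). Qed.

Lemma fnorm_b_le x : fnorm (b x) <= Num.sqrt CV * W x.
Proof.
rewrite -sqrtrM; last exact: ltW (CV_gt0 hLV).
rewrite -[leLHS]ger0_norm ?fnorm_ge0// -sqrtr_sqr ler_wsqrtr//.
by apply: le_trans (V_CV hLV x); rewrite lerDr sqr_ge0.
Qed.

Lemma fnorm_gradV_le x : fnorm (grad V x) <= Num.sqrt CV * W x.
Proof.
rewrite -sqrtrM; last exact: ltW (CV_gt0 hLV).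
rewrite -[leLHS]ger0_norm ?fnorm_ge0// -sqrtr_sqr ler_wsqrtr//.
by apply: le_trans (V_CV hLV x); rewrite lerDl sqr_ge0.
Qed.

(** The square root lies below its tangent at V x, which transfers the one-step estimates from V to
    W. *)
Lemma W_concave x y : W y <= W x + (V y - V x) / (2 * W x).
Proof.
have wx := W_gt0 x.
have -> : W x + (V y - V x) / (2 * W x) = (W x ^+ 2 + W y ^+ 2) / (2 * W x).
  have -> : V y - V x = W y ^+ 2 - W x ^+ 2 by rewrite !W_sqr.
  by field; rewrite gt_eqF.
rewrite ler_pdivlMr ?mulr_gt0// -subr_ge0.
by rewrite (_ : _ - _ = (W x - W y) ^+ 2) ?sqr_ge0//; ring.
Qed.

(** The reason for working with W instead of V: its gradient grad V / (2 W) is bounded, so the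
    concentration inequality of the innovations applies to W. *)
Lemma W_lipschitz x h : `|W (x + h) - W x| <= Num.sqrt CV * fnorm h.
Proof.
have d0 (t : R) : is_derive t 1 (fun t => W (x + t *: h))
    (dot (grad V (x + t *: h)) h / (2 * W (x + t *: h))).
  have dV := is_derive_line1 x h t (V_C2 hLV); rewrite -dot_grad in dV.
  have ds := is_derive1_sqrt (V_gt0 (x + t *: h)).
  apply: is_derive_eq.
  by rewrite /GRing.scale/=; field; rewrite gt_eqF ?W_gt0.
have i01 : 0 <= (1 : R) <= 1 by rewrite ler01 lexx.
have := mean_value_le d0 (M := Num.sqrt CV * fnorm h) _ i01.
rewrite scale1r scale0r addr0; apply => t _; set y := x + t *: h.
have wy := W_gt0 y.
have w2 : 0 <= 2 * W y by rewrite mulr_ge0// ltW.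
rewrite normrM normfV (ger0_norm w2) ler_pdivrMr ?mulr_gt0// (le_trans (norm_dot_le _ _))//.
rewrite (@le_trans _ _ (Num.sqrt CV * W y * fnorm h))//.
  by rewrite ler_wpM2r ?fnorm_ge0 ?fnorm_gradV_le.
have c0 : 0 <= Num.sqrt CV * fnorm h * W y by rewrite !mulr_ge0 ?sqrtr_ge0 ?fnorm_ge0.
rewrite [leLHS]mulrAC [leRHS]mulrCA mulr_natl mulr2n.
by rewrite lerDl.
Qed.

Definition drift_cst : R := (betaV + s ^+ 2 * N) / (2 * Num.sqrt vstar).

(** Half of the contraction alphaV V pays for the second-order Taylor term, by the smallness of the
    step. Division by 2 W, in passing from V to W, halves the rest, hence alphaV / 4; the constant
    is controlled by W >= sqrt vstar. *)
Lemma W_drift (g : R) x : 0 <= g -> g * (CV * N) <= alphaV / 2 ->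
  W (x + g *: b x) <= W x - alphaV / 4 * g * W x + g * drift_cst.
Proof.
move=> g0 gN; apply: (le_trans (W_concave x _)).
have wx := W_gt0 x.
have w0 : 0 < Num.sqrt vstar by rewrite sqrtr_gt0 (vstar_gt0 hLV).
pose B := betaV + s ^+ 2 * N.
have B0 : 0 <= B by rewrite addr_ge0 ?(betaV_ge0 hLV)// mulr_ge0// sqr_ge0.
have Vy : V (x + g *: b x) - V x <= - (alphaV / 2) * g * V x + g * B.
  have := taylor2_Ck x (g *: b x) (V_C2 hLV) fnorm_hess_le.
  rewrite ler_norml => /andP[_].
  rewrite dotZr fnormZ exprMn ger0_norm// -/N => T.
  have trc : - \tr (sigma x *m (sigma x)^T *m hess V x) <= s ^+ 2 * N.
    rewrite (le_trans (ler_norm _))// normrN -[hess V x]trmxK.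
    rewrite (le_trans (norm_mxtrace_mulT _ _))// fnorm_tr.
    rewrite ler_pM ?fnorm_ge0 ?fnorm_hess_le//.
    rewrite (le_trans (fnorm_mulmx _ _))// fnorm_tr expr2.
    by rewrite ler_pM ?fnorm_ge0 ?sigma_s.
  have := V_generator hLV x; rewrite /generator => gen.
  have bV : fnorm (b x) ^+ 2 <= CV * V x.
    by apply: le_trans (V_CV hLV x); rewrite lerDr sqr_ge0.
  have e1 : N * (g ^+ 2 * fnorm (b x) ^+ 2) <= alphaV / 2 * g * V x.
    rewrite (@le_trans _ _ (N * (g ^+ 2 * (CV * V x))))//.
      by rewrite !ler_wpM2l ?sqr_ge0.
    rewrite [leLHS](_ : _ = g * (CV * N) * (g * V x)); last by ring.
    by rewrite -[leRHS]mulrA ler_wpM2r// mulr_ge0// ltW ?V_gt0.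
  have s2N : 0 <= s ^+ 2 * N by rewrite mulr_ge0// sqr_ge0.
  have dotb : dot (grad V x) (b x) <= - alphaV * V x + B.
    by rewrite dotC /B; lra.
  have := ler_wpM2l g0 dotb; move: T e1.
  set p := g * dot _ _; set q := N * _.
  by rewrite /p; lra.
have wle : g * B / (2 * W x) <= g * drift_cst.
  rewrite /drift_cst -/B -mulrA ler_wpM2l// ler_wpM2l// lef_pV2 ?posrE ?mulr_gt0//.
  by rewrite ler_wpM2l// W_ge.
rewrite -addrA lerD2l (@le_trans _ _ ((- (alphaV / 2) * g * V x + g * B) / (2 * W x)))//.
  by rewrite ler_pM2r// invr_gt0 mulr_gt0.
rewrite mulrDl lerD// le_eqVlt; apply/orP; left; apply/eqP.
have -> : - (alphaV / 2) * g * V x = - (alphaV / 2) * g * W x ^+ 2 by rewrite W_sqr.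
by field; rewrite gt_eqF.
Qed.

End Lyapunov.

Section ExpConvexity.
Set Implicit Arguments.
Unset Strict Implicit.
Context {R : realType}.

(* From the tangent line of [expR] at the barycenter. *)
Lemma expR_jensen (I : Type) (s : seq I) (p x : I -> R) :
  (forall i, 0 <= p i) -> \sum_(i <- s) p i = 1 ->
  expR (\sum_(i <- s) p i * x i) <= \sum_(i <- s) p i * expR (x i).
Proof.
move=> p0 p1; set m := \sum_(i <- s) p i * x i.
have tangent i : expR m * (1 + (x i - m)) <= expR (x i).
  by rewrite -[x i in leRHS](subrKC m) expRD ler_wpM2l ?expR_ge0 ?expR_ge1Dx.
apply: (@le_trans _ _ (\sum_(i <- s) p i * (expR m * (1 + (x i - m))))); last first.
  by apply: ler_sum => i _; rewrite ler_wpM2l.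
have -> : \sum_(i <- s) p i * (expR m * (1 + (x i - m))) =
    expR m * (\sum_(i <- s) p i + (\sum_(i <- s) p i * x i - (\sum_(i <- s) p i) * m)).
  rewrite mulr_suml -sumrB -big_split mulr_sumr; apply: eq_bigr => i _ /=; ring.
by rewrite p1 mul1r subrr addr0 mulr1.
Qed.

Lemma expR_convex (u x y : R) : 0 <= u -> u <= 1 ->
  expR ((1 - u) * x + u * y) <= (1 - u) * expR x + u * expR y.
Proof.
move=> u0 u1.
have := @expR_jensen bool [:: true; false] (fun i => if i then 1 - u else u)
  (fun i => if i then x else y).
rewrite !big_cons !big_nil !addr0; apply => [i|]; last by rewrite subrK.
by case: i; rewrite // subr_ge0.
Qed.

End ExpConvexity.

Section LyapunovMoments.
Set Implicit Arguments.
Unset Strict Implicit.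
Context {R : realType} {d r : nat} {disp : measure_display}
  {Omega : measurableType disp} (P : probability Omega R).
Variables (b : 'cV[R]_d -> 'cV[R]_d) (sigma : 'cV[R]_d -> 'M[R]_(d, r)).
Variables (X0 : Omega -> 'cV[R]_d) (U : nat -> Omega -> 'cV[R]_r).
Hypotheses (b_lip : lipschitz_mx b) (sigma_lip : lipschitz_mx sigma).
Hypotheses (hX0 : initial_cond P X0) (hGC : GC P X0 U).
Variables (V : 'cV[R]_d -> R) (vstar CV alphaV betaV : R).
Hypothesis hLV : lyapunov b sigma V vstar CV alphaV betaV.
Variable s : R.
Hypotheses (s0 : 0 < s) (sigma_s : forall x, fnorm (sigma x) <= s).

Notation W x := (Num.sqrt (V x)).
Let N := sup_norm (hess V).

Let mU1 : measurable_fun setT (U 1%N : Omega -> borelV R r) := U_measurable hGC (leqnn 1).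

Definition moment_cst : R :=
  drift_cst V vstar betaV s + N * s ^+ 2 / (2 * Num.sqrt vstar) + CV * s ^+ 2 / 2.

Lemma affine_noise_measurable (y : 'cV[R]_d) (t : R) (A : 'M[R]_(d, r)) :
  measurable_fun setT ((fun w => y + t *: (A *m U 1 w)) : Omega -> borelV R d).
Proof.
apply: borelV_measurable_coord => i.
have -> : (fun w => (y + t *: (A *m U 1 w)) i 0) =
    (fun w => y i 0 + t * \sum_j A i j * U 1 w j 0).
  by apply/funext => w; rewrite !mxE.
apply: measurable_funD => //; apply: measurable_funM => //.
apply: measurable_sum => j; apply: measurable_funM => //.
exact: borelV_coord_measurable.
Qed.

(** The linear term of V has mean zero, so the mean of W moves by O(g), whereas the Lipschitz bound
    alone would give O(sqrt g). *)
Lemma W_mean (g : R) (y : 'cV[R]_d) (A : 'M[R]_(d, r)) : 0 <= g -> fnorm A <= s ->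
  exists2 m, has_mean P (fun w => W (y + Num.sqrt g *: (A *m U 1 w))) m &
    m <= W y + g * (N * s ^+ 2 / (2 * Num.sqrt vstar)).
Proof.
move=> g0 As; set t := Num.sqrt g; pose h w := t *: (A *m U 1 w).
have tg : t ^+ 2 = g by rewrite sqr_sqrtr.
have wy := W_gt0 hLV y.
have Q := has_meanD (has_mean_cst P (W y)) (has_meanZ (2 * W y)^-1
  (has_meanD (dot_mean mU1 (GC_exp_moment hGC) (GC_mean1 hGC) t A (grad V y))
    (has_meanZ N (qform_mean mU1 (GC_exp_moment hGC) (GC_mean2 hGC) t A 1%:M)))).
have qform1 (k : 'cV[R]_d) : qform 1%:M k = fnorm k ^+ 2.
  rewrite fnorm_sqr_col; apply: eq_bigr => j _; rewrite expr2; congr (_ * _).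
  rewrite (bigD1 j)//= mxE eqxx mulr1 big1 ?addr0// => i ij.
  by rewrite mxE (negbTE ij) mulr0.
have WQ w : W (y + h w) <= W y + (2 * W y)^-1 * (dot (grad V y) (h w)
    + N * qform 1%:M (h w)).
  apply: (le_trans (W_concave hLV y _)); rewrite lerD2l mulrC ler_wpM2l//.
  have := taylor2_Ck y (h w) (V_C2 hLV) (fnorm_hess_le hLV).
  by rewrite ler_norml qform1 -/N => /andP[_]; lra.
have mW : measurable_fun setT (fun w => W (y + h w)).
  apply: (measurableT_comp (continuous_borelV_measurable (W_continuous hLV))).
  exact: affine_noise_measurable.
have Wi : P.-integrable setT (fun w => (W (y + h w))%:E).
  apply: (le_integrable measurableT _ _ Q.1); first exact/measurable_EFinP.
  move=> w _; rewrite !abse_EFin lee_fin ger0_norm ?sqrtr_ge0//.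
  by rewrite (le_trans (WQ w))// ler_norm.
have WM := integrable_has_mean Wi.
eexists; first exact: WM.
rewrite -lee_fin -[leLHS]WM.2.
apply: (le_trans (has_mean_le _ WQ Q)) => [w|]; first exact: sqrtr_ge0.
rewrite lee_fin add0r lerD2l mulmx1 tg.
rewrite [leLHS](_ : _ = g * (N * \tr (A *m A^T) / (2 * W y))); last by ring.
rewrite ler_wpM2l//.
have N0 : 0 <= N := le_trans (fnorm_ge0 _) (fnorm_hess_le hLV 0).
rewrite ler_pM ?mulr_ge0 ?invr_ge0 ?mulr_ge0 ?sqrtr_ge0//.
- by rewrite mxtrace_mulT; apply: sumr_ge0 => k _; rewrite -expr2 sqr_ge0.
- rewrite ler_wpM2l// (le_trans (ler_norm _))// (le_trans (norm_mxtrace_mulT _ _))//.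
  by rewrite expr2 ler_pM ?fnorm_ge0.
- have w0 : 0 < Num.sqrt vstar by rewrite sqrtr_gt0 (vstar_gt0 hLV).
  by rewrite lef_pV2 ?posrE ?mulr_gt0// ler_pM2l// (W_ge hLV).
Qed.

(** As a function of the innovation, W after the step is Lipschitz with constant L = sqrt CV * sqrt
    g * s. Concentration around its mean costs l^2 L^2 / 2, which is of order g l^2. *)
Lemma W_laplace (g l : R) x : 0 < g -> 0 < l -> g * (CV * N) <= alphaV / 2 ->
  (\int[P]_w (expR (l * W (one_step b sigma g x (U 1 w))))%:E <=
   (expR (l * (W x - alphaV / 4 * g * W x) + g * moment_cst * (l + l ^+ 2)))%:E)%E.
Proof.
move=> g0 l0 gN; set t := Num.sqrt g; set A := sigma x; set y := x + g *: b x.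
have t0 : 0 < t by rewrite sqrtr_gt0.
have tg : t ^+ 2 = g by rewrite sqr_sqrtr// ltW.
have CV0 := CV_gt0 hLV.
pose L := Num.sqrt CV * (t * s).
have L0 : 0 < L by rewrite !mulr_gt0 ?sqrtr_gt0.
have [m Wm mle] := W_mean y (ltW g0) (sigma_s x).
rewrite -/A -/t in Wm.
have lip : lipschitz_const 1 (fun u : 'cV[R]_r => L^-1 * W (y + t *: (A *m u))).
  move=> u v; rewrite mul1r -mulrBr normrM gtr0_norm ?invr_gt0//.
  rewrite mulrC ler_pdivrMr// mulrC.
  have -> : y + t *: (A *m u) = (y + t *: (A *m v)) + t *: (A *m (u - v)).
    rewrite -[in LHS](subrK v u) mulmxDr scalerDr.
    by rewrite (addrC (t *: (A *m (u - v)))) addrA.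
  apply: (le_trans (W_lipschitz hLV _ _)); rewrite /L -mulrA ler_wpM2l ?sqrtr_ge0//.
  rewrite fnormZ (ger0_norm (ltW t0)) -mulrA ler_wpM2l ?(ltW t0)//.
  by rewrite (le_trans (fnorm_mulmx _ _))// ler_wpM2r ?fnorm_ge0// sigma_s.
have := U_concentration hGC lip (mulr_gt0 l0 L0).
rewrite !unlock (has_meanZ L^-1 Wm).2 /=.
have -> : (\int[P]_w (expR (l * L * (L^-1 * W (y + t *: (A *m U 1 w)))))%:E =
    \int[P]_w (expR (l * W (one_step b sigma g x (U 1 w))))%:E)%E.
  by apply: eq_integral => w _; rewrite -mulrA (mulVKf (lt0r_neq0 L0)).
have -> : l * L * (L^-1 * m) = l * m by rewrite -mulrA (mulVKf (lt0r_neq0 L0)).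
move=> /le_trans; apply; rewrite lee_fin ler_expR.
have Wy := W_drift hLV sigma_s x (ltW g0) gN; rewrite -/y in Wy.
have L2 : L ^+ 2 = g * (CV * s ^+ 2).
  by rewrite /L !exprMn tg sqr_sqrtr ?(ltW CV0)//; ring.
rewrite exprMn L2.
set D := drift_cst _ _ _ _ in Wy; set E := N * s ^+ 2 / _ in mle.
have D0 : 0 <= D.
  rewrite /D /drift_cst mulr_ge0 ?invr_ge0 ?mulr_ge0 ?sqrtr_ge0//.
  rewrite addr_ge0 ?(betaV_ge0 hLV)// mulr_ge0 ?sqr_ge0//.
  exact: le_trans (fnorm_ge0 _) (fnorm_hess_le hLV 0).
have s00 : 0 <= s := ltW s0.
have E0 : 0 <= E.
  rewrite /E mulr_ge0 ?invr_ge0 ?mulr_ge0 ?sqrtr_ge0 ?sqr_ge0//.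
  exact: le_trans (fnorm_ge0 _) (fnorm_hess_le hLV 0).
have C0 : 0 <= CV * s ^+ 2 / 2 by rewrite divr_ge0// mulr_ge0 ?sqr_ge0 ?(ltW CV0).
rewrite /moment_cst -/D -/E.
have mW : l * m <= l * (W x - alphaV / 4 * g * W x + g * D + g * E).
  by rewrite ler_wpM2l ?(ltW l0)// (le_trans mle)// lerD2r.
apply: (le_trans (lerD mW (lexx _))).
rewrite [leLHS](_ : _ = l * (W x - alphaV / 4 * g * W x) +
  g * ((D + E) * l + CV * s ^+ 2 / 2 * l ^+ 2)); last by field.
rewrite lerD2l -(mulrA g) ler_wpM2l ?(ltW g0)//.
rewrite -subr_ge0.
rewrite (_ : _ - _ = (D + E) * l ^+ 2 + CV * s ^+ 2 / 2 * l); last by ring.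
by rewrite addr_ge0// mulr_ge0 ?addr_ge0 ?sqr_ge0 ?(ltW l0).
Qed.

Variable gamma : nat -> R.
Hypothesis gamma0 : forall k, (1 <= k)%N -> 0 < gamma k.
Hypothesis gamma1 : forall k, (1 <= k)%N -> gamma k <= gamma 1%N.
Hypothesis gammaN : forall k, (1 <= k)%N -> gamma k * (CV * N) <= alphaV / 2.

Let X := scheme b sigma gamma X0 U.

(** W grows linearly, so completing the square gives l W <= e |x|^2 + O(l + l^2), and e |X_0|^2 has
    a finite exponential moment for small e. *)
Lemma W_initial_moment : exists2 C, 0 <= C & forall l, 0 <= l ->
  (\int[P]_w (expR (l * W (X0 w)))%:E <= (expR (C * (1 + l ^+ 2)))%:E)%E.
Proof.
have [l0 l0_gt0 exp0] := X0_exp hX0.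
pose e := l0 / 2.
have e0 : 0 < e by rewrite divr_gt0.
have el : e < l0 by rewrite /e; lra.
have := exp0 e el; rewrite unlock.
set I := (\int[P]_w _)%E => Ioo.
have I0 : (0 <= I)%E by apply: integral_ge0 => w _; rewrite lee_fin expR_ge0.
have IE : (fine I)%:E = I by rewrite fineK// ge0_fin_numE.
have K0 : 0 <= fine I by exact: fine_ge0.
pose D := CV / (4 * e).
have D0 : 0 <= D by rewrite divr_ge0 ?(ltW (CV_gt0 hLV))// mulr_ge0// ltW.
have W00 : 0 <= W 0 := sqrtr_ge0 _.
exists (W 0 + D + fine I); first by rewrite !addr_ge0.
move=> l l_ge0.
have pw x : l * W x <= l * W 0 + D * l ^+ 2 + e * fnorm x ^+ 2.
  have Wx : W x <= W 0 + Num.sqrt CV * fnorm x.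
    have := W_lipschitz hLV 0 x; rewrite add0r ler_norml => /andP[_]; lra.
  apply: (le_trans (ler_wpM2l l_ge0 Wx)); rewrite mulrDr -addrA lerD2l.
  rewrite -subr_ge0 (_ : _ - _ = e * (fnorm x - l * Num.sqrt CV / (2 * e)) ^+ 2).
    by rewrite mulr_ge0 ?sqr_ge0// ltW.
  have -> : D = Num.sqrt CV ^+ 2 / (4 * e) by rewrite sqr_sqrtr// ltW ?(CV_gt0 hLV).
  by field; rewrite gt_eqF.
apply: (@le_trans _ _ ((expR (l * W 0 + D * l ^+ 2))%:E * I)%E).
  rewrite /I -ge0_integralZl_EFin ?expR_ge0//.
  - apply: ge0_le_integralT => w; first by rewrite lee_fin expR_ge0.
    by rewrite -EFinM -expRD lee_fin ler_expR.
  - apply/measurable_EFinP; apply: (measurableT_comp (@measurable_expR R)).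
    apply: measurable_funM => //.
    apply: (measurableT_comp (f := fun v : borelV R d => fnorm v ^+ 2)); last first.
      exact: (X0_measurable hX0).
    apply: measurable_funX; apply: continuous_borelV_measurable.
    exact: fnorm_lipschitz_continuous (@fnorm_lipschitz R d).
rewrite -IE -EFinM lee_fin.
have fI : fine I <= expR (fine I) by have := expR_ge1Dx (fine I); lra.
apply: (le_trans (ler_wpM2l (expR_ge0 _) fI)); rewrite -expRD ler_expR.
have l1 : l <= 1 + l ^+ 2.
  by have := sqr_ge0 (l - 1); rewrite sqrrB expr1n mulr1; have := sqr_ge0 l; lra.
have := ler_wpM2r W00 l1; have := mulr_ge0 K0 (sqr_ge0 l); lra.
Qed.

(** The drift makes the exponent after a step a convex combination of l W (X_n) and a constant c.
    Convexity of exp then propagates the same bound by induction, uniformly in n and without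
    changing l. *)
Lemma W_moment : exists2 C, 0 <= C & forall l n, 0 <= l ->
  (\int[P]_w (expR (l * W (X n w)))%:E <= (expR (C * (1 + l ^+ 2)))%:E)%E.
Proof.
have [C0 C00 init] := W_initial_moment.
have a0 := alphaV_gt0 hLV.
have g10 := gamma0 (leqnn 1).
(* Small enough for k <= alphaV / 4 and for k gamma_j <= 1 at every step, so that k gamma_j is a
   legitimate convex weight. *)
pose k := alphaV / 4 / (1 + alphaV * gamma 1%N).
have den0 : 0 < 1 + alphaV * gamma 1%N by rewrite addr_gt0 ?mulr_gt0.
have k0 : 0 < k by rewrite !divr_gt0.
have kg j : (1 <= j)%N -> 0 <= k * gamma j <= 1.
  move=> j1; rewrite mulr_ge0 ?(ltW k0) ?(ltW (gamma0 j1))//=.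
  apply: (@le_trans _ _ (k * gamma 1%N)).
    by rewrite ler_wpM2l ?gamma1 ?(ltW k0).
  rewrite /k mulrAC ler_pdivrMr// mul1r.
  by have := mulr_gt0 a0 g10; lra.
have ka : k <= alphaV / 4.
  rewrite /k ler_pdivrMr// ler_peMr ?divr_ge0 ?(ltW a0)// lerDl.
  by rewrite mulr_ge0 ?(ltW a0) ?(ltW g10).
have mc0 : 0 <= moment_cst.
  have s00 : 0 <= s := ltW s0.
  have N0 : 0 <= N := le_trans (fnorm_ge0 _) (fnorm_hess_le hLV 0).
  have CV0 := ltW (CV_gt0 hLV).
  by rewrite /moment_cst /drift_cst -/N !addr_ge0 ?mulr_ge0 ?invr_ge0 ?mulr_ge0 ?addr_ge0
    ?sqrtr_ge0 ?(betaV_ge0 hLV) ?mulr_ge0 ?sqr_ge0.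
(* C dominates the initial moment and the constant c of the convex combination, as l + l^2 <= 2 (1 +
   l^2). *)
pose C := C0 + 2 * moment_cst / k.
have mk0 : 0 <= moment_cst / k by rewrite divr_ge0// ltW.
have CC0 : C0 <= C by rewrite /C lerDl -mulrA mulr_ge0.
have Cge0 : 0 <= C := le_trans C00 CC0.
exists C => // l n.
(* The concentration inequality requires a positive parameter, so l = 0 is treated apart. *)
rewrite le_eqVlt => /predU1P[<-|l0].
  under eq_integral do rewrite mul0r expR0.
  rewrite integral_cst// mul1e (le_trans (probability_le1 P _))// lee_fin.
  by rewrite -[leLHS]expR0 ler_expR expr0n addr0 mulr1.
set Q := expR (C * (1 + l ^+ 2)).
elim: n => [|n IH].
  apply: (le_trans (init _ (ltW l0))); rewrite lee_fin ler_expR ler_wpM2r//.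
  by rewrite addr_ge0 ?sqr_ge0.
have gn : (1 <= n.+1)%N by [].
have mlW : measurable_fun setT ((fun x => l * W x) : borelV R d -> R).
  apply: measurable_funM => //.
  exact: continuous_borelV_measurable (W_continuous hLV).
rewrite (exp_moment_next gamma b_lip sigma_lip hX0 hGC n mlW).
pose u := k * gamma n.+1.
have /andP[u0 u1] := kg _ gn.
rewrite -/u in u0 u1.
pose c := moment_cst / k * (l + l ^+ 2).
have cQ : expR c <= Q.
  rewrite ler_expR /c /C.
  have l1 : l + l ^+ 2 <= 2 * (1 + l ^+ 2).
    have := sqr_ge0 (l - 1); rewrite sqrrB expr1n mulr1; have := sqr_ge0 l; lra.
  apply: (le_trans (ler_wpM2l mk0 l1)).
  have := mulr_ge0 C00 (addr_ge0 ler01 (sqr_ge0 l)).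
  by move=> H; rewrite -subr_ge0 (_ : _ - _ = C0 * (1 + l ^+ 2))//; ring.
have mW : measurable_fun setT (fun w => expR (l * W (X n w))).
  apply: (measurableT_comp (@measurable_expR R)).
  apply: (measurableT_comp mlW).
  exact: (scheme_measurable gamma b_lip sigma_lip hX0 hGC n).
apply: (@le_trans _ _ (\int[P]_w ((1 - u)%:E * (expR (l * W (X n w)))%:E + (u * expR c)%:E))%E).
  apply: ge0_le_integralT => w; first by apply: integral_ge0 => w' _; rewrite lee_fin expR_ge0.
  apply: (le_trans (W_laplace (X n w) (gamma0 gn) l0 (gammaN gn))).
  rewrite -EFinM -EFinD lee_fin.
  have wx := sqrtr_ge0 (V (X n w)).
  apply: (@le_trans _ _ (expR ((1 - u) * (l * W (X n w)) + u * c))).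
    rewrite ler_expR /u /c.
    have kk : k * gamma n.+1 * (moment_cst / k * (l + l ^+ 2)) =
        gamma n.+1 * moment_cst * (l + l ^+ 2) by field; rewrite gt_eqF.
    rewrite kk lerD2r.
    have := ler_wpM2r (mulr_ge0 (mulr_ge0 (ltW l0) (ltW (gamma0 gn))) wx) ka; lra.
  exact: expR_convex.
have fin_ge0 w : (0 <= (1 - u)%:E * (expR (l * W (X n w)))%:E)%E.
  by rewrite -EFinM lee_fin mulr_ge0 ?expR_ge0// subr_ge0.
have mfin : measurable_fun setT (fun w => ((1 - u)%:E * (expR (l * W (X n w)))%:E)%E).
  by apply: measurable_funeM; exact/measurable_EFinP.
have cst_ge0 : (0 <= (u * expR c)%:E)%E by rewrite lee_fin mulr_ge0 ?expR_ge0.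
rewrite ge0_integralD// ge0_integralZl_EFin ?subr_ge0//; last first.
  exact/measurable_EFinP.
rewrite integral_cst//.
apply: (@le_trans _ _ ((1 - u)%:E * Q%:E + (u * expR c)%:E)%E).
  apply: leeD; first by apply: lee_wpmul2l => //; rewrite lee_fin subr_ge0.
  rewrite -[leRHS]mule1; apply: lee_wpmul2l; first by rewrite lee_fin mulr_ge0 ?expR_ge0.
  exact: probability_le1.
rewrite -EFinM -EFinD lee_fin.
have := ler_wpM2l u0 cQ; lra.
Qed.

End LyapunovMoments.

(** * Asymptotics of the steps *)

Section StepAsymptotics.
Set Implicit Arguments.
Unset Strict Implicit.
Context {R : realType}.

Lemma cvg0P (u : nat -> R) :
  (forall e : R, 0 < e -> exists N, forall n, (N <= n)%N -> `|u n| <= e) ->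
  u @ \oo --> (0 : R).
Proof.
move=> uP; apply/cvgrPdist_le => e e0; have [N uN] := uP e e0.
by exists N => // n Nn; rewrite sub0r normrN; exact: uN.
Qed.

Lemma natr_powRN_small (q e : R) : 0 < q -> 0 < e ->
  exists2 m, (0 < m)%N & forall n, (m <= n)%N -> n%:R `^ (- q) <= e.
Proof.
move=> q0 e0; pose x := e^-1 `^ q^-1.
exists (Num.truncn x).+1 => // n mn.
have xn : x <= n%:R.
  by rewrite (le_trans (ltW (truncnS_gt x)))// ler_nat.
have x0 : 0 < x by rewrite powR_gt0// invr_gt0.
have n0 : 0 < n%:R :> R by exact: lt_le_trans xn.
rewrite powRN -[leRHS]invrK lef_pV2 ?posrE ?powR_gt0 ?invr_gt0//.
have -> : e^-1 = x `^ q.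
  by rewrite /x -powRrM mulVf ?gt_eqF// powRr1// invr_ge0 ltW.
by apply: ge0_ler_powR; rewrite ?nnegrE ?(ltW q0) ?(ltW x0) ?(ltW n0).
Qed.

(** The integral comparison in discrete form, from ln (1 - 1 / y) <= - 1 / y and exp t >= 1 + t. *)
Lemma powRN_telescope (p : R) k : 1 < p ->
  (p - 1) * k.+2%:R `^ (- p) <= k.+1%:R `^ (1 - p) - k.+2%:R `^ (1 - p) :> R.
Proof.
move=> p1; set x : R := k.+1%:R; set y : R := k.+2%:R.
have x0 : 0 < x by rewrite ltr0n.
have y0 : 0 < y by rewrite ltr0n.
have yx : y = x + 1 by rewrite /x /y -natr1.
have ln_xy : ln x - ln y <= - y^-1.
  rewrite -ln_div ?posrE// (_ : x / y = 1 + - y^-1); last first.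
    by rewrite -[x](addrK 1) -yx mulrDl divff ?gt_eqF// mulN1r.
  apply: le_ln1Dx; rewrite ltrN2 invf_lt1//.
  by rewrite /y ltr1n.
have split_y : y `^ (1 - p) = y `^ (- p) * y.
  by rewrite addrC powRD ?(gt_eqF y0) ?implybT// powRr1// ltW.
have -> : x `^ (1 - p) = y `^ (1 - p) * expR ((1 - p) * (ln x - ln y)).
  by rewrite /powR !gt_eqF// -expRD; congr expR; ring.
rewrite split_y; set E := expR _; set z := y `^ (- p).
rewrite (_ : z * y * E - z * y = z * (y * (E - 1))); last by ring.
rewrite [leLHS]mulrC ler_wpM2l ?powR_ge0//.
have e1 : (p - 1) / y <= E - 1.
  have := expR_ge1Dx ((1 - p) * (ln x - ln y)).
  have : (p - 1) / y <= (1 - p) * (ln x - ln y).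
    have p10 : 0 <= p - 1 by rewrite subr_ge0 ltW.
    move: ln_xy; move: (ln x - ln y) => D /(ler_wpM2l p10).
    by rewrite mulrN -[1 - p]opprB mulNr lerNr.
  by move=> H1 H2; apply: (le_trans H1); rewrite lerBrDl.
have := ler_wpM2l (ltW y0) e1.
by rewrite mulrCA divff ?gt_eqF// mulr1.
Qed.

Lemma powRN_tail (p : R) (m n : nat) : 1 < p -> (0 < m <= n)%N ->
  \sum_(m <= k < n) k.+1%:R `^ (- p) <= m%:R `^ (1 - p) / (p - 1).
Proof.
move=> p1 /andP[m0 mn]; rewrite ler_pdivlMr ?subr_gt0//.
apply: (@le_trans _ _ (m%:R `^ (1 - p) - n%:R `^ (1 - p))); last first.
  by rewrite gerBl powR_ge0.
rewrite -(subnKC mn); elim: (n - m)%N => [|k IH].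
  by rewrite addn0 big_geq// mul0r subrr.
rewrite addnS big_nat_recr ?leq_addr//= mulrDl.
have := powRN_telescope (m + k).-1 p1.
rewrite prednK ?addn_gt0 ?m0// mulrC => T.
by have := lerD IH T; rewrite addrA subrK.
Qed.

Variables (gamma : nat -> R) (theta beta : R).
Hypotheses (hgamma : steps gamma theta) (beta0 : 0 < beta) (beta1 : beta <= 1).
Hypotheses (theta_gt : (2 + beta)^-1 < theta) (theta1 : theta <= 1).

Let theta0 : 0 < theta.
Proof. by rewrite (lt_trans _ theta_gt)// invr_gt0 addr_gt0. Qed.

Let gamma0 k : 0 < gamma k.+1 := gamma_gt0 hgamma (ltn0Sn k).

Lemma gamma_le1 k : (1 <= k)%N -> gamma k <= gamma 1%N.
Proof.
case: k => // k _; elim: k => [//|k IH].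
exact: le_trans (gamma_decr hgamma (ltn0Sn k)) IH.
Qed.

Lemma GammaE n : Gamma gamma n = \sum_(0 <= k < n) gamma k.+1.
Proof. by rewrite /Gamma big_add1. Qed.

Lemma Gamma_ge0 n : 0 <= Gamma gamma n.
Proof. by rewrite GammaE sumr_ge0// => k _; rewrite ltW. Qed.

Lemma Gamma_gt0 n : (1 <= n)%N -> 0 < Gamma gamma n.
Proof.
case: n => // n _; rewrite GammaE big_nat_recr//= ltr_wpDl//.
by rewrite sumr_ge0// => k _; rewrite ltW.
Qed.

(** As theta <= 1, the steps eventually dominate a multiple of 1 / k, which is at least the
    increment of ln from k to k + 1. *)
Lemma Gamma_infty (A : R) : exists N, forall n, (N <= n)%N -> A <= Gamma gamma n.
Proof.
have [n0 [C [C1 asympC]]] := gamma_asymp hgamma.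
have C0 : 0 < C := lt_le_trans ltr01 C1.
pose m := n0.+1.
have harm n : (m <= n)%N -> C^-1 * (ln n.+1%:R - ln m.+1%:R) <= Gamma gamma n.
  move=> mn; rewrite -(subnKC mn); elim: (n - m)%N => [|k IH].
    by rewrite addn0 subrr mulr0 Gamma_ge0.
  rewrite addnS GammaE big_nat_recr//= -GammaE.
  set j := (m + k)%N in IH *.
  have j0 : 0 < j.+1%:R :> R by rewrite ltr0n.
  have lnj : ln j.+2%:R - ln j.+1%:R <= j.+1%:R `^ (- theta) :> R.
    rewrite -ln_div ?posrE// (_ : j.+2%:R / j.+1%:R = 1 + j.+1%:R^-1); last first.
      by rewrite -[j.+2%:R]natr1 mulrDl divff ?gt_eqF// mul1r.
    apply: (le_trans (le_ln1Dx _)); first by rewrite (@lt_trans _ _ 0)// ?ltrN10 ?invr_gt0.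
    rewrite -(powR_inv1 (ltW j0)).
    by have := @ler_powR R j.+1%:R; apply; rewrite ?ler1n// lerN2.
  have /asympC/andP[lo _] : (n0 <= j.+1)%N.
    by rewrite /j /m addSn; apply: leqW; rewrite leqW// leq_addr.
  have Ci : 0 <= C^-1 by rewrite invr_ge0 ltW.
  have Cj := ler_wpM2l Ci lnj.
  move: IH lo Cj; move: (C^-1) (ln _) (ln _) (ln _) => c u v w.
  by rewrite !mulrBr; lra.
have [e [N0 eN]] : exists e : R, 0 < e /\ e = expR (C * `|A| + ln m.+1%:R).
  by eexists; split; last reflexivity; exact: expR_gt0.
exists (maxn m (Num.truncn e)) => n; rewrite geq_max => /andP[mn en].
apply: (le_trans _ (harm n mn)).
have : C * `|A| + ln m.+1%:R <= ln n.+1%:R.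
  rewrite -[leLHS]expRK ler_ln ?posrE ?expR_gt0 ?ltr0n// -eN.
  by rewrite (le_trans (ltW (truncnS_gt e)))// ler_nat ltnS.
move=> H; apply: (le_trans (ler_norm A)).
rewrite mulrC ler_pdivlMr//; lra.
Qed.

Lemma gamma_small_eventually (e : R) : 0 < e ->
  exists m, forall k, (m <= k)%N -> gamma k.+1 <= e.
Proof.
move=> e0; have [n0 [C [C1 asympC]]] := gamma_asymp hgamma.
have C0 : 0 < C := lt_le_trans ltr01 C1.
have [m m0 mP] := natr_powRN_small theta0 (divr_gt0 e0 C0).
exists (maxn m n0) => k; rewrite geq_max => /andP[mk nk].
have /asympC/andP[_ up] := leqW nk.
apply: (le_trans up); rewrite mulrC -ler_pdivlMr//.
by apply: mP; exact: leqW.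
Qed.

(** Any fixed head of the sum is negligible against D, so only tails matter. It is applied with D =
    sqrt Gamma_n and D = Gamma_n. *)
Lemma cvg0_ratio (u D : nat -> R) : (forall k, 0 <= u k) ->
  (forall n, 0 <= D n) -> (forall A : R, exists N, forall n, (N <= n)%N -> A <= D n) ->
  (forall e : R, 0 < e -> exists m, forall n, (m <= n)%N ->
    \sum_(m <= k < n) u k <= e * D n) ->
  (fun n => (\sum_(0 <= k < n) u k) / D n) @ \oo --> (0 : R).
Proof.
move=> u0 D0 Doo tail; apply: cvg0P => e e0.
have e20 : 0 < e / 2 by rewrite divr_gt0.
have [m tailm] := tail _ e20.
pose H := \sum_(0 <= k < m) u k.
have [N DN] := Doo (H / (e / 2) + 1).
exists (maxn m N) => n; rewrite geq_max => /andP[mn Nn].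
have H0 : 0 <= H by apply: sumr_ge0.
have Dn : 0 < D n.
  by rewrite (lt_le_trans _ (DN n Nn))// ltr_wpDl// divr_ge0// ltW.
rewrite ger0_norm ?divr_ge0 ?sumr_ge0// ler_pdivrMr//.
rewrite (big_cat_nat (leq0n m) mn)//= -/H.
have HD : H <= e / 2 * D n.
  rewrite mulrC -ler_pdivrMr//; apply: (le_trans _ (DN n Nn)).
  by rewrite lerDl.
by have := tailm n mn; lra.
Qed.

Let sqrt_Gamma_infty (A : R) : exists N, forall n, (N <= n)%N -> A <= Num.sqrt (Gamma gamma n).
Proof.
have [N NP] := Gamma_infty (A ^+ 2); exists N => n /NP An.
by rewrite (le_trans (ler_norm A))// -sqrtr_sqr ler_wsqrtr.
Qed.

Lemma cauchy_schwarz_nat (a c : nat -> R) m n :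
  (forall k, 0 <= a k) -> (forall k, 0 <= c k) ->
  \sum_(m <= k < n) Num.sqrt (a k) * Num.sqrt (c k) <=
  Num.sqrt (\sum_(m <= k < n) a k) * Num.sqrt (\sum_(m <= k < n) c k).
Proof.
move=> a0 c0; rewrite !(big_addn 0 _ m)/= !big_mkord.
apply: (le_trans (ler_norm _)); apply: (le_trans (cauchy_schwarz_sum _ _)).
by rewrite le_eqVlt; apply/orP; left; apply/eqP; congr (Num.sqrt _ * Num.sqrt _);
  apply: eq_bigr => k _; rewrite sqr_sqrtr.
Qed.

(** This is gamma_{k+1}^((3 + beta) / 2), in the form in which the Taylor remainder for a
    displacement of order sqrt gamma_{k+1} produces it. *)
Definition bias_step k : R :=
  Num.sqrt (gamma k.+1) ^+ 3 * Num.sqrt (gamma k.+1) `^ beta.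

Lemma bias_step_ge0 k : 0 <= bias_step k.
Proof. by rewrite mulr_ge0 ?powR_ge0// exprn_ge0. Qed.

(* By Cauchy-Schwarz it suffices that [gamma_k ^ (2 + beta)] be summable,
   which is the role of [theta > 1 / (2 + beta)]. *)
Lemma bias_cvg0 :
  (fun n => (\sum_(0 <= k < n) bias_step k) / Num.sqrt (Gamma gamma n)) @ \oo --> (0 : R).
Proof.
apply: cvg0_ratio; [exact: bias_step_ge0|by move=> n; exact: sqrtr_ge0
  |exact: sqrt_Gamma_infty|move=> e e0].
have [n0 [C [C1 asympC]]] := gamma_asymp hgamma.
have C0 : 0 < C := lt_le_trans ltr01 C1.
pose p := theta * (2 + beta).
have p1 : 1 < p.
  by rewrite /p -[ltLHS](@mulVf _ (2 + beta)) ?gt_eqF ?addr_gt0// ltr_pM2r ?addr_gt0.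
pose c k : R := gamma k.+1 ^+ 2 * gamma k.+1 `^ beta.
pose K := C ^+ 2 * C `^ beta.
have K0 : 0 < K by rewrite mulr_gt0 ?exprn_gt0 ?powR_gt0.
(* The exponent (3 + beta) / 2 is split as 1/2 + (2 + beta) / 2: the first factor sums to Gamma_n,
   the second is square summable. *)
have cE k : bias_step k = Num.sqrt (gamma k.+1) * Num.sqrt (c k).
  have g0 := ltW (gamma0 k).
  rewrite /c sqrtrM ?sqr_ge0// sqrtr_sqr ger0_norm//.
  have -> : Num.sqrt (gamma k.+1 `^ beta) = Num.sqrt (gamma k.+1) `^ beta.
    by rewrite -(powR12_sqrt g0) -(powR12_sqrt (powR_ge0 _ _)) powRAC.
  by rewrite /bias_step exprS sqr_sqrtr// mulrA.
have c_le k : (n0 <= k)%N -> c k <= K * k.+1%:R `^ (- p).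
  move=> nk; have /asympC/andP[_ up] := leqW nk.
  set x : R := k.+1%:R in up *.
  have x0 : 0 < x by rewrite ltr0n.
  have g0 := ltW (gamma0 k).
  have -> : K * x `^ (- p) = (C * x `^ (- theta)) ^+ 2 * (C * x `^ (- theta)) `^ beta.
    rewrite powRM ?powR_ge0 ?(ltW C0)// -powRrM exprMn.
    have -> : x `^ (- p) = x `^ (- theta) ^+ 2 * x `^ (- theta * beta).
      rewrite expr2 -!powRD ?(gt_eqF x0) ?implybT//; congr (_ `^ _).
      by rewrite /p; ring.
    by rewrite /K; ring.
  rewrite ler_pM ?sqr_ge0 ?powR_ge0//.
    by apply: lerXn2r; rewrite ?nnegrE// mulr_ge0 ?powR_ge0 ?(ltW C0).
  by apply: ge0_ler_powR; rewrite ?nnegrE ?(ltW beta0)// mulr_ge0 ?powR_ge0 ?(ltW C0).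
have q0 : 0 < p - 1 by rewrite subr_gt0.
have e'0 : 0 < e ^+ 2 * (p - 1) / K by rewrite !mulr_gt0 ?invr_gt0 ?exprn_gt0.
have [m m0 mP] := natr_powRN_small q0 e'0.
exists (maxn m n0) => n Mn; set M := maxn m n0 in Mn *.
have M0 : (0 < M)%N by rewrite (leq_trans m0)// leq_maxl.
under eq_bigr do rewrite cE.
apply: (le_trans (cauchy_schwarz_nat _ _ _ _)) => [k|k|].
- exact: ltW.
- by rewrite mulr_ge0 ?sqr_ge0 ?powR_ge0.
have h1 : Num.sqrt (\sum_(M <= k < n) gamma k.+1) <= Num.sqrt (Gamma gamma n).
  rewrite ler_wsqrtr// GammaE [leRHS](big_cat_nat (leq0n M) Mn)//= lerDr sumr_ge0// => k _.
  exact: ltW.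
have h2 : Num.sqrt (\sum_(M <= k < n) c k) <= e.
  rewrite -[leRHS](ger0_norm (ltW e0)) -sqrtr_sqr ler_wsqrtr//.
  apply: (@le_trans _ _ (\sum_(M <= k < n) K * k.+1%:R `^ (- p))).
    rewrite big_nat_cond [leRHS]big_nat_cond; apply: ler_sum => k /andP[/andP[Mk _] _].
    by apply: c_le; rewrite (leq_trans _ Mk)// leq_maxr.
  rewrite -mulr_sumr mulrC -ler_pdivlMr//.
  apply: (le_trans (powRN_tail p1 _)); first by rewrite M0.
  rewrite ler_pdivrMr// -opprB (le_trans (mP _ (leq_maxl _ _)))//.
  by rewrite mulrAC.
by rewrite mulrC ler_pM ?sqrtr_ge0.
Qed.

(** A weighted Cesàro mean: the ratio averages sqrt gamma_k, which tends to 0, with the weights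
    gamma_k. *)
Lemma cube_cvg0 :
  (fun n => (\sum_(0 <= k < n) Num.sqrt (gamma k.+1) ^+ 3) / Gamma gamma n) @ \oo --> (0 : R).
Proof.
apply: cvg0_ratio; [by move=> k; rewrite exprn_ge0|exact: Gamma_ge0|exact: Gamma_infty|].
move=> e e0; have [m mP] := gamma_small_eventually (exprn_gt0 2 e0).
exists m => n mn.
apply: (@le_trans _ _ (\sum_(m <= k < n) e * gamma k.+1)).
  rewrite big_nat_cond [leRHS]big_nat_cond; apply: ler_sum => k /andP[/andP[mk _] _].
  have g0 := ltW (gamma0 k).
  rewrite exprS sqr_sqrtr// ler_wpM2r//.
  by rewrite -[leRHS](ger0_norm (ltW e0)) -sqrtr_sqr ler_wsqrtr// mP.
rewrite -mulr_sumr ler_wpM2l ?(ltW e0)// GammaE [leRHS](big_cat_nat (leq0n m) mn)//=.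
by rewrite lerDr sumr_ge0// => k _; exact: ltW.
Qed.

(** gamma^2 exceeds gamma^((3 + beta) / 2) only by the bounded factor gamma^((1 - beta) / 2), so the
    sum of squares needs no estimate of its own. *)
Lemma square_step_le k :
  gamma k.+1 ^+ 2 <= Num.sqrt (gamma 1%N) `^ (1 - beta) * bias_step k.
Proof.
set x := Num.sqrt (gamma k.+1).
have x0 : 0 < x by rewrite sqrtr_gt0.
have -> : gamma k.+1 ^+ 2 = x ^+ 3 * (x `^ beta * x `^ (1 - beta)).
  rewrite -powRD ?(gt_eqF x0) ?implybT// subrKC powRr1 ?(ltW x0)// -exprSr.
  by rewrite (exprM x 2 2) sqr_sqrtr// ltW.
rewrite /bias_step -/x mulrA [leRHS]mulrC ler_wpM2l//.
  by rewrite mulr_ge0 ?exprn_ge0 ?powR_ge0 ?(ltW x0).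
apply: ge0_ler_powR; rewrite ?nnegrE ?sqrtr_ge0 ?subr_ge0//.
by rewrite ler_wsqrtr// gamma_le1.
Qed.

(** The total mass of the terms in W: one each for X_0 and X_n, whence the 2, and gamma_{k+1}^2 for
    X_k. *)
Definition weight n : R := 2 + \sum_(0 <= k < n) gamma k.+1 ^+ 2.

Lemma weight_ge2 n : 2 <= weight n.
Proof. by rewrite lerDl sumr_ge0// => k _; exact: sqr_ge0. Qed.

Lemma weight_cvg0 :
  (fun n => weight n / Num.sqrt (Gamma gamma n)) @ \oo --> (0 : R).
Proof.
set K := Num.sqrt (gamma 1%N) `^ (1 - beta).
apply: cvg0P => e e0.
have K0 : 0 <= K by exact: powR_ge0.
have e'0 : 0 < e / 2 / (K + 1) by rewrite !divr_gt0// ltr_wpDl.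
have /cvgrPdist_le/(_ _ e'0)[N1 _ N1P] := bias_cvg0.
have [N2 N2P] := sqrt_Gamma_infty (2 / (e / 2)).
exists (maxn N1 (maxn N2 1)) => n; rewrite !geq_max => /and3P[n1 n2 n3].
have G0 : 0 < Num.sqrt (Gamma gamma n) by rewrite sqrtr_gt0 Gamma_gt0.
have := N1P n n1; rewrite sub0r normrN ger0_norm; last first.
  by rewrite divr_ge0 ?sqrtr_ge0// sumr_ge0// => k _; exact: bias_step_ge0.
rewrite ler_pdivrMr// => B.
rewrite ger0_norm ?divr_ge0 ?sqrtr_ge0 ?(le_trans _ (weight_ge2 n))//.
rewrite ler_pdivrMr// /weight.
have two : 2 <= e / 2 * Num.sqrt (Gamma gamma n).
  by have := N2P n n2; rewrite ler_pdivrMr ?divr_gt0// mulrC.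
have sq : \sum_(0 <= k < n) gamma k.+1 ^+ 2 <= e / 2 * Num.sqrt (Gamma gamma n).
  apply: (@le_trans _ _ (K * \sum_(0 <= k < n) bias_step k)).
    by rewrite mulr_sumr; apply: ler_sum => k _; exact: square_step_le.
  apply: (le_trans (ler_wpM2l K0 B)); rewrite mulrA ler_wpM2r ?(ltW G0)//.
  rewrite mulrCA ler_piMr ?divr_ge0 ?(ltW e0)//.
  by rewrite ler_pdivrMr ?mul1r ?lerDl// ltr_wpDl.
lra.
Qed.

End StepAsymptotics.

(** * Tilting by a solution of the Poisson equation *)

Section LinearCombination.
Set Implicit Arguments.
Unset Strict Implicit.
Context {R : realType} {d : nat}.
Implicit Types (f g : 'cV[R]_d -> R) (s : seq 'I_d) (x h : 'cV[R]_d).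

Lemma pderiv_lin (k : nat) f g (a c : R) s : Ck k f -> Ck k g ->
  (size s <= k)%N -> pderiv s (fun x => a * f x + c * g x) =
  (fun x => a * pderiv s f x + c * pderiv s g x).
Proof.
move=> fk gk; elim: s => [//|i s IH] /= sk.
rewrite (IH (ltnW sk)); apply/funext => x.
have df := (fk s (ltnW sk)).2 sk x i; have dg := (gk s (ltnW sk)).2 sk x i.
rewrite (_ : (fun y => _) = a *: pderiv s f + c *: pderiv s g); last exact/funext.
have ak := derivableZ (k := a) df; have ck := derivableZ (k := c) dg.
by rewrite (deriveD ak ck) (deriveZ a df) (deriveZ c dg).
Qed.

Lemma Ck_lin (k : nat) f g (a c : R) : Ck k f -> Ck k g ->
  Ck k (fun x => a * f x + c * g x).
Proof.
move=> fk gk s sk; rewrite (pderiv_lin a c fk gk sk).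
have -> : (fun x => a * pderiv s f x + c * pderiv s g x) =
    a *: pderiv s f + c *: pderiv s g by exact/funext.
split=> [x|sk' x i].
  have /= fx := (fk s sk).1 x; have /= gx := (gk s sk).1 x.
  exact: (cvgD (cvgZl_tmp (k := a) fx) (cvgZl_tmp (k := c) gx)).
exact: derivableD (derivableZ (k := a) ((fk s sk).2 sk' x i))
  (derivableZ (k := c) ((gk s sk).2 sk' x i)).
Qed.

Lemma grad_lin (k : nat) f g (a c : R) x : Ck k.+1 f -> Ck k.+1 g ->
  grad (fun x => a * f x + c * g x) x = a *: grad f x + c *: grad g x.
Proof.
move=> fk gk; apply/colP => i.
by rewrite mxE (pderiv_lin a c fk gk (s := [:: i]))// !mxE.
Qed.

Lemma hess_lin (k : nat) f g (a c : R) x : Ck k.+2 f -> Ck k.+2 g ->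
  hess (fun x => a * f x + c * g x) x = a *: hess f x + c *: hess g x.
Proof.
move=> fk gk; apply/matrixP => i j.
have H := pderiv_lin a c fk gk (s := [:: i; j]) isT.
rewrite [LHS]mxE H [RHS]mxE [X in _ = X + _]mxE [X in _ = _ + X]mxE.
by rewrite [X in _ = _ * X + _]mxE [X in _ = _ + _ * X]mxE.
Qed.

Lemma sum_lin (F G : 'I_d -> R) (a c : R) h :
  \sum_i h i 0 * (a * F i + c * G i) =
  a * (\sum_i h i 0 * F i) + c * (\sum_i h i 0 * G i).
Proof.
by rewrite !mulr_sumr -big_split; apply: eq_bigr => i _ /=; ring.
Qed.

Lemma third_form_lin f g (a c : R) x h : Ck 3 f -> Ck 3 g ->
  third_form (fun x => a * f x + c * g x) x h =
  a * third_form f x h + c * third_form g x h.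
Proof.
move=> fk gk; rewrite /third_form -sum_lin; apply: eq_bigr => j _; congr (_ * _).
rewrite -sum_lin; apply: eq_bigr => i _; congr (_ * _).
rewrite -sum_lin; apply: eq_bigr => k _; congr (_ * _).
by rewrite (pderiv_lin a c fk gk (s := [:: k; i; j])).
Qed.

Lemma qform_lin (A B : 'M[R]_d) (a c : R) h :
  qform (a *: A + c *: B) h = a * qform A h + c * qform B h.
Proof.
rewrite /qform -sum_lin; apply: eq_bigr => j _; congr (_ * _).
by rewrite -sum_lin; apply: eq_bigr => i _; rewrite !mxE.
Qed.

Lemma generator_lin (r : nat) b (sigma : 'cV[R]_d -> 'M[R]_(d, r)) f g (a c : R) x :
  Ck 3 f -> Ck 3 g ->
  generator b sigma (fun x => a * f x + c * g x) x =
  a * generator b sigma f x + c * generator b sigma g x.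
Proof.
move=> fk gk; rewrite /generator (grad_lin a c x fk gk) (hess_lin a c x fk gk).
move: (b x) (_ *m _) (grad f x) (grad g x) (hess f x) (hess g x) => B S u v A C.
rewrite dotDr !dotZr mulmxDr -!scalemxAr mxtraceD !mxtraceZ.
by move: (dot B u) (dot B v) (\tr _) (\tr _) => *; ring.
Qed.

Lemma norm_lin_le (a c u v M1 M2 N : R) : 0 <= N -> `|u| <= M1 * N -> `|v| <= M2 * N ->
  `|a * u + c * v| <= (`|a| * M1 + `|c| * M2) * N.
Proof.
move=> N0 u1 v1; rewrite (le_trans (ler_normD _ _))// !normrM.
have := ler_wpM2l (normr_ge0 a) u1; have := ler_wpM2l (normr_ge0 c) v1.
by rewrite mulrDl -!mulrA => ? ?; exact: lerD.
Qed.

Lemma fnorm_lin_le (m n : nat) (a c M1 M2 N : R) (u v : 'M[R]_(m, n)) :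
  0 <= N -> fnorm u <= M1 * N -> fnorm v <= M2 * N ->
  fnorm (a *: u + c *: v) <= (`|a| * M1 + `|c| * M2) * N.
Proof.
move=> N0 u1 v1; rewrite (le_trans (fnormD _ _))// !fnormZ.
have := ler_wpM2l (normr_ge0 a) u1; have := ler_wpM2l (normr_ge0 c) v1.
by rewrite mulrDl -!mulrA => ? ?; exact: lerD.
Qed.

Lemma fnorm_linB_le (m n : nat) (a c M1 M2 N : R) (u1 u2 v1 v2 : 'M[R]_(m, n)) :
  0 <= N -> fnorm (v1 - v2) <= M2 * N -> fnorm (u1 - u2) <= M1 * N ->
  fnorm (a *: u1 + c *: v1 - (a *: u2 + c *: v2)) <= (`|a| * M1 + `|c| * M2) * N.
Proof.
by move=> N0 Hv Hu; rewrite opprD addrACA -!scalerBr; exact: fnorm_lin_le.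
Qed.

Lemma smooth_bounds_lin (beta a c M1 M2 : R) f g : Ck 3 f -> Ck 3 g ->
  smooth_bounds beta M1 f -> smooth_bounds beta M2 g ->
  smooth_bounds beta (`|a| * M1 + `|c| * M2) (fun x => a * f x + c * g x).
Proof.
move=> fk gk f1 g1.
have gradE x := grad_lin a c x fk gk; have hessE x := hess_lin a c x fk gk.
split.
- by rewrite addr_ge0 ?mulr_ge0 ?(sb_ge0 f1) ?(sb_ge0 g1).
- move=> x h.
  have alg (f1' f0 g1' g0 : R) :
    a * f0 + c * g0 - (a * f1' + c * g1') = a * (f0 - f1') + c * (g0 - g1') by ring.
  rewrite alg.
  exact: norm_lin_le (fnorm_ge0 _) (sb_lip f1 _ _) (sb_lip g1 _ _).
- move=> x; rewrite gradE -[leRHS]mulr1.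
  have u1 := sb_grad f1 x; have v1 := sb_grad g1 x.
  by apply: (fnorm_lin_le _ _ ler01); rewrite mulr1.
- move=> x; rewrite hessE -[leRHS]mulr1.
  have u1 := sb_hess f1 x; have v1 := sb_hess g1 x.
  by apply: (fnorm_lin_le _ _ ler01); rewrite mulr1.
- move=> x h; rewrite !gradE; have := sb_grad_lip f1 x h; have := sb_grad_lip g1 x h.
  exact: fnorm_linB_le (fnorm_ge0 _).
- move=> x h; rewrite !hessE; have := sb_hess_lip f1 x h; have := sb_hess_lip g1 x h.
  exact: fnorm_linB_le (fnorm_ge0 _).
- move=> x h; rewrite gradE dotDl !dotZl.
  have alg (f2 f1' f0 g2 g1' g0 : R) :
      a * f0 + c * g0 - (a * f1' + c * g1') - (a * f2 + c * g2) =
      a * (f0 - f1' - f2) + c * (g0 - g1' - g2) by ring.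
  rewrite alg.
  exact: norm_lin_le (exprn_ge0 _ (fnorm_ge0 _)) (sb_taylor2 f1 _ _) (sb_taylor2 g1 _ _).
- move=> x h; rewrite gradE hessE dotDl !dotZl qform_lin third_form_lin//.
  have N0 : 0 <= fnorm h ^+ 3 * fnorm h `^ beta.
    by rewrite mulr_ge0 ?powR_ge0// exprn_ge0 ?fnorm_ge0.
  have alg (f4 f3 f2 f1' f0 g4 g3 g2 g1' g0 : R) :
      a * f0 + c * g0 - (a * f1' + c * g1') - (a * f2 + c * g2) -
      (a * f3 + c * g3) / 2 - (a * f4 + c * g4) / 6 =
      a * (f0 - f1' - f2 - f3 / 2 - f4 / 6) + c * (g0 - g1' - g2 - g3 / 2 - g4 / 6).
    by field.
  rewrite alg.
  exact: norm_lin_le N0 (sb_taylor4 f1 _ _) (sb_taylor4 g1 _ _).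
Qed.

Lemma smooth_bounds_le (beta M1 M2 : R) f : M1 <= M2 ->
  smooth_bounds beta M1 f -> smooth_bounds beta M2 f.
Proof.
move=> M12 f1.
have le N : 0 <= N -> M1 * N <= M2 * N by move=> N0; rewrite ler_wpM2r.
split=> *; first exact: le_trans (sb_ge0 f1) M12.
- by apply: (le_trans (sb_lip f1 _ _)); rewrite le ?fnorm_ge0.
- by apply: (le_trans (sb_grad f1 _)).
- by apply: (le_trans (sb_hess f1 _)).
- by apply: (le_trans (sb_grad_lip f1 _ _)); rewrite le ?fnorm_ge0.
- by apply: (le_trans (sb_hess_lip f1 _ _)); rewrite le ?fnorm_ge0.
- by apply: (le_trans (sb_taylor2 f1 _ _)); rewrite le ?exprn_ge0 ?fnorm_ge0.
- by apply: (le_trans (sb_taylor4 f1 _ _)); rewrite le ?mulr_ge0 ?powR_ge0 ?exprn_ge0 ?fnorm_ge0.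
Qed.

Lemma drift_lipschitz_lin (b : 'cV[R]_d -> 'cV[R]_d) f g (a c M1 M2 : R) :
  Ck 3 f -> Ck 3 g ->
  lipschitz_const M1 (fun x => dot (b x) (grad f x)) ->
  lipschitz_const M2 (fun x => dot (b x) (grad g x)) ->
  lipschitz_const (`|a| * M1 + `|c| * M2)
    (fun x => dot (b x) (grad (fun x => a * f x + c * g x) x)).
Proof.
move=> fk gk f1 g1 x y; rewrite !(grad_lin a c _ fk gk) !dotDr !dotZr.
have alg (f1' f0 g1' g0 : R) :
  a * f0 + c * g0 - (a * f1' + c * g1') = a * (f0 - f1') + c * (g0 - g1') by ring.
by rewrite alg; exact: norm_lin_le (fnorm_ge0 _) (f1 x y) (g1 x y).
Qed.

(** Used with a of order mu and c of order mu^2: only the term in a^2 has to be exact, the rest is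
    of order |mu|^3. *)
Lemma carre_du_champ_lin_le (r : nat) (sigma : 'cV[R]_d -> 'M[R]_(d, r)) f g
    (a c s M : R) x : Ck 3 f -> Ck 3 g -> 0 <= s -> fnorm (sigma x) <= s ->
  fnorm (grad f x) <= M -> fnorm (grad g x) <= M ->
  carre_du_champ sigma (fun x => a * f x + c * g x) x <=
  a ^+ 2 * carre_du_champ sigma f x + (2 * `|a * c| + c ^+ 2) * (s * M) ^+ 2.
Proof.
move=> fk gk s0 sx fM gM; rewrite /carre_du_champ (grad_lin a c x fk gk).
rewrite mulmxDr -!scalemxAr.
have bound (u : 'cV[R]_d) : fnorm u <= M -> fnorm ((sigma x)^T *m u) <= s * M.
  move=> uM; rewrite (le_trans (fnorm_mulmx _ _))// fnorm_tr.
  by rewrite ler_pM ?fnorm_ge0.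
move/bound: fM; move/bound: gM; move: (_ *m grad f x) (_ *m grad g x) => u v vM uM.
rewrite !fnorm_dot dotDl !dotDr !dotZl !dotZr (dotC v u) -!fnorm_dot.
have uv : `|dot u v| <= (s * M) ^+ 2.
  by rewrite (le_trans (norm_dot_le _ _))// expr2 ler_pM ?fnorm_ge0.
have vv : fnorm v ^+ 2 <= (s * M) ^+ 2 by rewrite lerXn2r ?nnegrE ?fnorm_ge0 ?(le_trans _ vM) ?fnorm_ge0.
have ac : a * c * dot u v <= `|a * c| * (s * M) ^+ 2.
  by rewrite (le_trans (ler_norm _))// normrM ler_wpM2l.
have cc := ler_wpM2l (sqr_ge0 c) vv.
rewrite -subr_ge0 (_ : _ - _ = 2 * (`|a * c| * (s * M) ^+ 2 - a * c * dot u v) +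
  (c ^+ 2 * (s * M) ^+ 2 - c ^+ 2 * fnorm v ^+ 2)); last by ring.
by rewrite addr_ge0 ?mulr_ge0 ?subr_ge0.
Qed.

End LinearCombination.

Section TiltedStep.
Set Implicit Arguments.
Unset Strict Implicit.
Context {R : realType} {d r : nat} {disp : measure_display}
  {Omega : measurableType disp} (P : probability Omega R).
Variables (b : 'cV[R]_d -> 'cV[R]_d) (sigma : 'cV[R]_d -> 'M[R]_(d, r)).
Variables (X0 : Omega -> 'cV[R]_d) (U : nat -> Omega -> 'cV[R]_r).
Hypotheses (b_lip : lipschitz_mx b) (sigma_lip : lipschitz_mx sigma).
Hypotheses (hGC : GC P X0 U).
Variables (V : 'cV[R]_d -> R) (vstar CV alphaV betaV : R).
Hypothesis hLV : lyapunov b sigma V vstar CV alphaV betaV.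
Variables (s Lb : R).
Hypotheses (s0 : 0 < s) (sigma_s : forall x, fnorm (sigma x) <= s).
Hypotheses (Lb0 : 0 <= Lb)
  (bL : forall x y, fnorm (b x - b y) <= Lb * fnorm (x - y)).
Variables (beta t1 : R).
Hypotheses (beta0 : 0 <= beta) (beta1 : beta <= 1) (t10 : 0 <= t1).
Variables (phi psi : 'cV[R]_d -> R) (M m : R).
Hypotheses (phiC : Ck 3 phi) (psiC : Ck 3 psi).
Hypotheses (phiM : smooth_bounds beta M phi) (psiM : smooth_bounds beta M psi).
Hypotheses (phi_drift : lipschitz_const M (fun x => dot (b x) (grad phi x)))
  (psi_drift : lipschitz_const M (fun x => dot (b x) (grad psi x))).
Hypothesis poisson : forall x,
  generator b sigma psi x = carre_du_champ sigma phi x - m.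

Lemma generator_measurable (f : 'cV[R]_d -> R) : Ck 3 f ->
  measurable_fun setT (generator b sigma f : borelV R d -> R).
Proof.
move=> fC.
have mD l : (size l <= 3)%N -> measurable_fun setT (pderiv l f : borelV R d -> R).
  by move=> l3; apply: continuous_borelV_measurable; exact: (fC l l3).1.
have mb i : measurable_fun setT ((fun x => b x i 0) : borelV R d -> R).
  by apply: continuous_borelV_measurable; exact: lipschitz_mx_continuous.
have ms i j : measurable_fun setT ((fun x => sigma x i j) : borelV R d -> R).
  by apply: continuous_borelV_measurable; exact: lipschitz_mx_continuous.
rewrite /generator; apply: measurable_funD.
  apply: measurable_sum => i; apply: measurable_funM; first exact: mb.
  under eq_fun do rewrite mxE.
  exact: (mD [:: i]).
apply: measurable_funM => //; apply: measurable_sum => i.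
under eq_fun do rewrite mxE.
apply: measurable_sum => j; apply: measurable_funM.
  under eq_fun do rewrite mxE.
  apply: measurable_sum => k; apply: measurable_funM; first exact: ms.
  under eq_fun do rewrite mxE.
  exact: ms.
under eq_fun do rewrite mxE.
exact: (mD [:: j; i]).
Qed.

Lemma laplace_cst_ge0 (Z : Omega -> 'cV[R]_r) : 0 <= laplace_cst P Z s Lb t1.
Proof.
have s00 := ltW s0.
rewrite /laplace_cst !addr_ge0 ?mulr_ge0 ?fine_ge0//.
by apply: integral_ge0 => w _; rewrite lee_fin expR_ge0.
Qed.

(** The terms in G, of size mu^2 / 2, cancel between the generator of psi and the carré du champ of
    the tilt, leaving mu^2 m / 2. The remaining errors are gathered under one constant; |mu| <= 1
    lets |mu|^3 absorb mu^4. *)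
Lemma tilt_bookkeeping (g mu A G Gf S2 LC B c q w K : R) :
  0 <= g -> 0 <= S2 -> 0 <= LC -> 0 <= M -> 0 <= K -> 0 <= w -> 0 <= B -> 0 <= c ->
  `|mu| <= 1 -> q <= K * w ->
  Gf <= (- mu) ^+ 2 * G + (2 * `|- mu * - (mu ^+ 2 / 2)| + (- (mu ^+ 2 / 2)) ^+ 2) * S2 ->
  g * (- mu * A + - (mu ^+ 2 / 2) * (G - m) + 2^-1 * Gf)
    + LC * (2 * `|mu| * M * B + (2 * `|mu| * M) ^+ 2 * c + 2 * `|mu| * M * (g ^+ 2 * q))
  <= g * (- mu * A + mu ^+ 2 * m / 2)
    + (2 * S2 + LC * (2 * M + 4 * M ^+ 2 + 2 * M * K)) *
      (`|mu| ^+ 3 * g + `|mu| * B + mu ^+ 2 * c + `|mu| * (g ^+ 2 * w)).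
Proof.
move=> g0 S20 LC0 M0 K0 w0 B0 c0 mu1 qK Gfle.
have -> : mu ^+ 2 = `|mu| ^+ 2 by rewrite real_normK// num_real.
have e1 : `|- mu * - (mu ^+ 2 / 2)| = `|mu| ^+ 3 / 2.
  by rewrite mulrNN normrM [X in _ * X]normrM normrX (ger0_norm (_ : 0 <= 2^-1)) ?invr_ge0// mulrA -exprS.
rewrite e1 sqrrN in Gfle.
have e2 : mu ^+ 2 = `|mu| ^+ 2 by rewrite real_normK// num_real.
rewrite sqrrN e2 in Gfle.
have u0 : 0 <= `|mu| by [].
move: `|mu| u0 mu1 Gfle {e1 e2} => u u0 u1 Gfle.
have u43 : u ^+ 4 <= u ^+ 3 by rewrite exprSr ler_piMr ?exprn_ge0.
have S2u : (u ^+ 3 + u ^+ 4 / 4) * S2 <= 2 * (u ^+ 3 * S2).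
  rewrite mulrA ler_wpM2r//; have := exprn_ge0 3 u0; lra.
have h1 : g * (- mu * A + - (u ^+ 2 / 2) * (G - m) + 2^-1 * Gf) <=
    g * (- mu * A + u ^+ 2 * m / 2) + u ^+ 3 * g * S2.
  rewrite (_ : u ^+ 3 * g * S2 = g * (u ^+ 3 * S2)); last by ring.
  rewrite -mulrDr ler_wpM2l//.
  have e : (u ^+ 2 / 2) ^+ 2 = u ^+ 4 / 4 by field.
  rewrite e (_ : 2 * (u ^+ 3 / 2) = u ^+ 3) in Gfle; last by field.
  rewrite -subr_ge0 (_ : _ - _ = 2^-1 * (u ^+ 2 * G + 2 * (u ^+ 3 * S2) - Gf)).
    by rewrite mulr_ge0 ?invr_ge0// subr_ge0 (le_trans Gfle)// lerD2l.
  by field.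
have uM : 0 <= 2 * u * M by rewrite !mulr_ge0.
have h2 : 2 * u * M * (g ^+ 2 * q) <= 2 * u * M * (g ^+ 2 * (K * w)).
  by rewrite ler_wpM2l// ler_wpM2l ?sqr_ge0.
have h3 := ler_wpM2l LC0 (lerD (lexx (2 * u * M * B + (2 * u * M) ^+ 2 * c)) h2).
apply: (le_trans (lerD h1 h3)); rewrite -addrA lerD2l.
have t1_0 : 0 <= u ^+ 3 * g by rewrite mulr_ge0 ?exprn_ge0.
have t2_0 : 0 <= u * B by rewrite mulr_ge0.
have t3_0 : 0 <= u ^+ 2 * c by rewrite mulr_ge0 ?exprn_ge0.
have t4_0 : 0 <= u * (g ^+ 2 * w) by rewrite !mulr_ge0 ?sqr_ge0.
rewrite [leLHS](_ : _ = S2 * (u ^+ 3 * g) + LC * (2 * M) * (u * B)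
  + LC * (4 * M ^+ 2) * (u ^+ 2 * c) + LC * (2 * M * K) * (u * (g ^+ 2 * w))); last by ring.
move: (u ^+ 3 * g) (u * B) (u ^+ 2 * c) (u * (g ^+ 2 * w)) t1_0 t2_0 t3_0 t4_0
  => a1 a2 a3 a4 a10 a20 a30 a40.
have k1 : 0 <= LC * (2 * M) by rewrite !mulr_ge0.
have k2 : 0 <= LC * (4 * M ^+ 2) by rewrite !mulr_ge0 ?sqr_ge0.
have k3 : 0 <= LC * (2 * M * K) by rewrite !mulr_ge0.
rewrite !(mulrDr LC); move: (LC * (2 * M)) (LC * (4 * M ^+ 2)) (LC * (2 * M * K)) k1 k2 k3
  => p1 p2 p3 k1 k2 k3.
rewrite -subr_ge0 (_ : _ - _ = S2 * a1 + (p1 + p2 + p3) * a1 + (2 * S2 + p2 + p3) * a2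
  + (2 * S2 + p1 + p3) * a3 + (2 * S2 + p1 + p2) * a4); last by ring.
by rewrite !addr_ge0 ?mulr_ge0 ?addr_ge0 ?mulr_ge0.
Qed.

Definition tilt_cst : R :=
  2 * (s * M) ^+ 2 + laplace_cst P (U 1%N) s Lb t1 *
    (2 * M + 4 * M ^+ 2 + 2 * M * Num.sqrt CV).

Lemma tilt_cst_ge0 : 0 <= tilt_cst.
Proof.
have M0 := sb_ge0 phiM; have := laplace_cst_ge0 (U 1%N).
rewrite /tilt_cst; move: (laplace_cst _ _ _ _ _) => c c0.
have q0 := sqrtr_ge0 CV; have s00 := ltW s0.
by rewrite !addr_ge0 ?mulr_ge0 ?addr_ge0 ?mulr_ge0.
Qed.

(* The Poisson equation trades [mu ^+ 2 / 2 * carre_du_champ sigma phi x] for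
   its mean at the price of tilting by [- (mu ^+ 2 / 2) * psi] as well. *)
Definition tilt (mu : R) x : R := - mu * phi x + - (mu ^+ 2 / 2) * psi x.

Lemma tilt_step (mu g : R) x : 0 <= g -> Num.sqrt g <= t1 ->
  `|mu| <= 1 -> 2 * `|mu| * M <= 1 ->
  (\int[P]_w (expR (tilt mu (one_step b sigma g x (U 1%N w)) - tilt mu x))%:E <=
   (expR (g * (- mu * generator b sigma phi x + mu ^+ 2 * m / 2)
     + tilt_cst * (`|mu| ^+ 3 * g + `|mu| * (Num.sqrt g ^+ 3 * Num.sqrt g `^ beta)
       + mu ^+ 2 * Num.sqrt g ^+ 3 + `|mu| * (g ^+ 2 * Num.sqrt (V x)))))%:E)%E.
Proof.
move=> g0 gt1 mu1 muM.
have M0 := sb_ge0 phiM.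
(* As mu^2 / 2 <= |mu|, every bound on the tilt is of first order in |mu|; 2 |mu| M <= 1 is then the
   condition M <= 1 of [one_step_laplace]. *)
have coef : `|- mu| * M + `|- (mu ^+ 2 / 2)| * M <= 2 * `|mu| * M.
  rewrite !normrN -mulrDl ler_wpM2r// normrM normrX (ger0_norm (_ : 0 <= 2^-1)) ?invr_ge0//.
  have : `|mu| ^+ 2 <= `|mu| by rewrite expr2 ler_piMr.
  have := normr_ge0 mu; lra.
have fC : Ck 3 (tilt mu) by exact: Ck_lin.
have fM : smooth_bounds beta (2 * `|mu| * M) (tilt mu).
  by apply: smooth_bounds_le coef _; exact: smooth_bounds_lin.
have fD : lipschitz_const (2 * `|mu| * M) (fun x => dot (b x) (grad (tilt mu) x)).
  move=> y z; apply: (le_trans (drift_lipschitz_lin (- mu) (- (mu ^+ 2 / 2))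
    phiC psiC phi_drift psi_drift y z)).
  by rewrite ler_wpM2r ?fnorm_ge0.
have := one_step_laplace (U_measurable hGC (leqnn 1)) (GC_exp_moment hGC)
  (GC_mean1 hGC) (GC_mean2 hGC) (GC_mean3 hGC) s0 sigma_s Lb0 bL beta0 beta1 t10
  muM fC fM fD x g0 gt1.
move=> /le_trans; apply; rewrite lee_fin ler_expR.
have := carre_du_champ_lin_le (- mu) (- (mu ^+ 2 / 2)) phiC psiC (ltW s0) (sigma_s x)
  (sb_grad phiM x) (sb_grad psiM x).
rewrite (generator_lin b sigma (- mu) (- (mu ^+ 2 / 2)) x phiC psiC) poisson => Gle.
apply: tilt_bookkeeping => //.
- exact: sqr_ge0.
- exact: laplace_cst_ge0.
- exact: (fnorm_b_le hLV).

Qed.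

End TiltedStep.

(** * Jensen, Hölder and Markov inequalities for exponentials *)

Section ExponentialIntegrals.
Set Implicit Arguments.
Unset Strict Implicit.
Context {R : realType} {disp : measure_display} {Omega : measurableType disp}.
Variable P : probability Omega R.

Lemma integral_expR_jensen (I : Type) (l : seq I) (p : I -> R) (x : I -> Omega -> R)
    (K : R) : (forall i, 0 <= p i) -> \sum_(i <- l) p i = 1 ->
  (forall i, measurable_fun setT (x i)) ->
  (forall i, (\int[P]_w (expR (x i w))%:E <= (expR K)%:E)%E) ->
  (\int[P]_w (expR (\sum_(i <- l) p i * x i w))%:E <= (expR K)%:E)%E.
Proof.
move=> p0 p1 mx xK.
have mex i : measurable_fun setT (fun w => (expR (x i w))%:E).
  by apply/measurable_EFinP; apply: (measurableT_comp (@measurable_expR R)).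
apply: (@le_trans _ _ (\int[P]_w (\sum_(i <- l) ((p i)%:E * (expR (x i w))%:E)))%E).
  apply: ge0_le_integralT => w; first by rewrite lee_fin expR_ge0.
  rewrite (eq_bigr (fun i => (p i * expR (x i w))%:E))//.
  by rewrite sumEFin lee_fin; exact: expR_jensen.
rewrite ge0_integral_sum//; last 2 first.
- by move=> i; exact: measurable_funeM.
- by move=> i w _; rewrite mule_ge0 ?lee_fin ?expR_ge0.
apply: (@le_trans _ _ (\sum_(i <- l) ((p i)%:E * (expR K)%:E))%E).
  apply: lee_sum => i _; rewrite ge0_integralZl_EFin//.
  by apply: lee_wpmul2l; rewrite ?lee_fin.
rewrite (eq_bigr (fun i => (p i * expR K)%:E))//.
by rewrite sumEFin -mulr_suml p1 mul1r.
Qed.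

(* Hölder's inequality, obtained from the convexity of [expR] applied to [f]
   and to [g - K]. *)
Lemma integral_expR_holder (u K : R) (f g : Omega -> R) :
  0 <= u -> u <= 1 -> measurable_fun setT f -> measurable_fun setT g ->
  (\int[P]_w (expR (f w))%:E <= 1)%E ->
  (\int[P]_w (expR (g w))%:E <= (expR K)%:E)%E ->
  (\int[P]_w (expR ((1 - u) * f w + u * g w))%:E <= (expR (u * K))%:E)%E.
Proof.
move=> u0 u1 mf mg f1 gK.
have := @integral_expR_jensen bool [:: true; false] (fun i => if i then 1 - u else u)
  (fun i w => if i then f w else g w - K) 0.
under eq_integral do rewrite !big_cons !big_nil !addr0.
rewrite !big_cons !big_nil !addr0 expR0 subrK => J.
have u1' : 0 <= 1 - u by rewrite subr_ge0.
have {}J : (\int[P]_w (expR ((1 - u) * f w + u * (g w - K)))%:E <= 1)%E.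
  apply: J => //; first by case.
    by case=> //; exact: measurable_funB.
  case=> //; under eq_integral do rewrite expRD mulrC EFinM.
  rewrite ge0_integralZl_EFin ?expR_ge0//.
  - apply: (@le_trans _ _ ((expR (- K))%:E * (expR K)%:E)%E).
      by apply: lee_wpmul2l; rewrite ?lee_fin ?expR_ge0.
    by rewrite -EFinM -expRD addNr expR0.
  - by apply/measurable_EFinP; apply: (measurableT_comp (@measurable_expR R)).
have -> : (\int[P]_w (expR ((1 - u) * f w + u * g w))%:E =
    \int[P]_w ((expR (u * K))%:E * (expR ((1 - u) * f w + u * (g w - K)))%:E))%E.
  by apply: eq_integral => w _; rewrite -EFinM -expRD; congr (expR _)%:E; ring.
rewrite ge0_integralZl_EFin ?expR_ge0//.
- by rewrite -[leRHS]mule1; apply: lee_wpmul2l; rewrite ?lee_fin ?expR_ge0.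
- apply/measurable_EFinP; apply: (measurableT_comp (@measurable_expR R)).
  apply: measurable_funD; apply: measurable_funM => //.
  exact: measurable_funB.
Qed.

Lemma markov_expR (x t : R) (f : Omega -> R) : 0 <= x -> measurable_fun setT f ->
  (P [set w | (t <= f w)%R] <=
   (expR (- (x * t)))%:E * \int[P]_w (expR (x * f w))%:E)%E.
Proof.
move=> x0 mf; set A := [set w | _].
have mA : measurable A.
  rewrite (_ : A = [set: Omega] `&` f @^-1` `[t, +oo[).
    by apply: mf => //; exact: measurable_itv.
  by rewrite setTI; apply/seteqP; split => w; rewrite /A/= in_itv/= andbT.
rewrite -(setIT A) -integral_indic//.
rewrite -ge0_integralZl_EFin ?expR_ge0//.
- apply: ge0_le_integralT => w; first by rewrite lee_fin indicE.
  rewrite -EFinM lee_fin -expRD indicE.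
  case: (boolP (w \in A)) => [|_]; last exact: expR_ge0.
  rewrite inE /A/= => tf; rewrite -[leLHS]expR0 ler_expR addrC subr_ge0.
  exact: ler_wpM2l.
- apply/measurable_EFinP; apply: (measurableT_comp (@measurable_expR R)).
  exact: measurable_funM.
Qed.

End ExponentialIntegrals.

Section LaplaceOfSums.
Set Implicit Arguments.
Unset Strict Implicit.
Context {R : realType} {d r : nat} {disp : measure_display}
  {Omega : measurableType disp} (P : probability Omega R).
Variables (b : 'cV[R]_d -> 'cV[R]_d) (sigma : 'cV[R]_d -> 'M[R]_(d, r)).
Variables (X0 : Omega -> 'cV[R]_d) (U : nat -> Omega -> 'cV[R]_r).
Hypotheses (b_lip : lipschitz_mx b) (sigma_lip : lipschitz_mx sigma).
Hypotheses (hX0 : initial_cond P X0) (hGC : GC P X0 U).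
Variables (V : 'cV[R]_d -> R) (vstar CV alphaV betaV : R).
Hypothesis hLV : lyapunov b sigma V vstar CV alphaV betaV.
Variables (s Lb : R).
Hypotheses (s0 : 0 < s) (sigma_s : forall x, fnorm (sigma x) <= s).
Hypotheses (Lb0 : 0 <= Lb)
  (bL : forall x y, fnorm (b x - b y) <= Lb * fnorm (x - y)).
Variables (gamma : nat -> R).
Hypotheses (gamma0 : forall k, (1 <= k)%N -> 0 < gamma k)
  (gamma1 : forall k, (1 <= k)%N -> gamma k <= gamma 1%N)
  (gammaN : forall k, (1 <= k)%N -> gamma k * (CV * sup_norm (hess V)) <= alphaV / 2).
Variable (beta : R).
Hypotheses (beta0 : 0 <= beta) (beta1 : beta <= 1).
Variables (phi psi : 'cV[R]_d -> R) (M m : R).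
Hypotheses (phiC : Ck 3 phi) (psiC : Ck 3 psi).
Hypotheses (phiM : smooth_bounds beta M phi) (psiM : smooth_bounds beta M psi).
Hypotheses (phi_drift : lipschitz_const M (fun x => dot (b x) (grad phi x)))
  (psi_drift : lipschitz_const M (fun x => dot (b x) (grad psi x))).
Hypotheses (phi_W : forall x, `|phi x| <= M * (1 + Num.sqrt (V x)))
  (psi_W : forall x, `|psi x| <= M * (1 + Num.sqrt (V x))).
Hypothesis (m0 : 0 <= m).
Hypothesis poisson : forall x,
  generator b sigma psi x = carre_du_champ sigma phi x - m.

Notation W x := (Num.sqrt (V x)).
Notation X := (scheme b sigma gamma X0 U).
Let D := tilt_cst P U CV s Lb (Num.sqrt (gamma 1%N)) M.

Definition weighted_sum n w : R :=
  \sum_(0 <= k < n) gamma k.+1 * generator b sigma phi (X k w).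

Let growth := 2 * M * (1 + (Num.sqrt vstar)^-1).

(** W is bounded below by sqrt vstar, so the constant in the growth condition is absorbed and the
    bound is a pure multiple of W, as the average over the W (X_k) requires. *)
Lemma tilt_growth (mu : R) x : `|mu| <= 1 ->
  `|tilt phi psi mu x| <= `|mu| * growth * W x.
Proof.
move=> mu1; have M0 := sb_ge0 phiM.
have w1 : 1 + W x <= (1 + (Num.sqrt vstar)^-1) * W x.
  rewrite mulrDl mul1r addrC lerD2l mulrC ler_pdivlMr ?mul1r ?(W_ge hLV)//.
  by rewrite sqrtr_gt0 (vstar_gt0 hLV).
have mu2 : mu ^+ 2 / 2 <= `|mu|.
  rewrite -(real_normK (num_real mu)) ler_pdivrMr// expr2.
  by rewrite ler_wpM2l// (le_trans mu1)// ler1n.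
have M1 := ler_wpM2l M0 w1.
rewrite /tilt (le_trans (ler_normD _ _))// !normrM !normrN.
rewrite (ger0_norm (_ : 0 <= mu ^+ 2 / 2)) ?divr_ge0 ?sqr_ge0//.
have h1 := ler_wpM2l (normr_ge0 mu) (le_trans (phi_W x) M1).
have h2 : mu ^+ 2 / 2 * `|psi x| <= `|mu| * (M * ((1 + (Num.sqrt vstar)^-1) * W x)).
  apply: ler_pM => //; first by rewrite divr_ge0 ?sqr_ge0.
  exact: le_trans (psi_W x) M1.
apply: (le_trans (lerD h1 h2)).
by rewrite le_eqVlt; apply/orP; left; apply/eqP; rewrite /growth; ring.
Qed.

Let growth_ge0 : 0 <= growth.
Proof.
have M0 := sb_ge0 phiM; have v0 := sqrtr_ge0 vstar.
by rewrite /growth !mulr_ge0// addr_ge0 ?invr_ge0.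
Qed.

Let D0 : 0 <= D.
Proof. exact: (tilt_cst_ge0 _ _ _ s0 Lb0 _ phiM). Qed.

(** Solving the supermartingale exponent for S leaves boundary terms and a weighted sum, all
    gathered in one multiple of W0 + Wn + Q. The factor 1 - u0 is dropped from the nonnegative error
    terms. *)
Lemma holder_bookkeeping (u0 u G DD tn t0 S L Q W0 Wn : R) :
  0 <= u0 -> 0 <= 1 - u0 -> 0 <= u -> 0 <= G -> 0 <= DD -> 0 <= L -> 0 <= Q -> 0 <= W0 -> 0 <= Wn ->
  `|tn| <= u * G * Wn -> `|t0| <= u * G * W0 ->
  (1 - u0) * S <= (1 - u0) * (tn - t0 - (- S + L + DD * (u * Q))) +
    u * (G + DD) * (W0 + Wn + Q) + L.
Proof.
move=> u00 u01 u_ge0 G0 DD0 L0 Q0 W00 Wn0.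
rewrite !ler_norml => /andP[tn1 _] /andP[_ t02].
have e1 : 0 <= (1 - u0) * (tn + u * G * Wn) by rewrite mulr_ge0// -[X in _ + X]opprK subr_ge0.
have e2 : 0 <= (1 - u0) * (u * G * W0 - t0) by rewrite mulr_ge0// subr_ge0.
have uG : 0 <= u * G by rewrite mulr_ge0.
have uD : 0 <= u * DD by rewrite mulr_ge0.
rewrite -subr_ge0 (_ : _ - _ = (1 - u0) * (tn + u * G * Wn) + (1 - u0) * (u * G * W0 - t0)
  + u0 * L + u0 * (u * G * (W0 + Wn)) + u0 * (u * DD * Q) + u * G * Q
  + u * DD * (W0 + Wn)); last by ring.
have a1 : 0 <= W0 + Wn by rewrite addr_ge0.
have a2 : 0 <= u0 * L by rewrite mulr_ge0.
have a3 : 0 <= u0 * (u * G * (W0 + Wn)) by rewrite mulr_ge0// mulr_ge0.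
have a4 : 0 <= u0 * (u * DD * Q) by rewrite mulr_ge0// mulr_ge0.
have a5 : 0 <= u * G * Q by rewrite mulr_ge0.
have a6 : 0 <= u * DD * (W0 + Wn) by rewrite mulr_ge0.
exact: addr_ge0 (addr_ge0 (addr_ge0 (addr_ge0 (addr_ge0 (addr_ge0 e1 e2) a2) a3) a4) a5) a6.
Qed.

Definition laplace_error (mu : R) n : R :=
  `|mu| ^+ 3 * Gamma gamma n + `|mu| * (\sum_(0 <= k < n) bias_step gamma beta k)
  + mu ^+ 2 * (\sum_(0 <= k < n) Num.sqrt (gamma k.+1) ^+ 3).

Let step_psi (mu : R) k x : R :=
  gamma k.+1 * (- mu * generator b sigma phi x + mu ^+ 2 * m / 2)
     + D * (`|mu| ^+ 3 * gamma k.+1 + `|mu| * bias_step gamma beta k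
       + mu ^+ 2 * Num.sqrt (gamma k.+1) ^+ 3 + `|mu| * (gamma k.+1 ^+ 2 * W x)).

Let step_psi_measurable mu k : measurable_fun setT (step_psi mu k : borelV R d -> R).
Proof.
have mG := generator_measurable b_lip sigma_lip phiC.
have mW : measurable_fun setT ((fun x => W x) : borelV R d -> R).
  exact: continuous_borelV_measurable (W_continuous hLV).
apply: measurable_funD; apply: measurable_funM => //.
  by apply: measurable_funD => //; exact: measurable_funM.
by apply: measurable_funD => //; apply: measurable_funM => //; exact: measurable_funM.
Qed.

Let tilt_measurable mu : measurable_fun setT (tilt phi psi mu : borelV R d -> R).
Proof.
apply: continuous_borelV_measurable.
exact: (Ck_lin (- mu) (- (mu ^+ 2 / 2)) phiC psiC (s := [::]) isT).1.
Qed.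

Let sum_step_psi mu n w : \sum_(k < n) step_psi mu k (X k w) =
  - (mu * weighted_sum n w)
  + (mu ^+ 2 * m / 2 * Gamma gamma n + D * laplace_error mu n)
  + D * (`|mu| * \sum_(0 <= k < n) gamma k.+1 ^+ 2 * W (X k w)).
Proof.
rewrite -(big_mkord xpredT (fun k => step_psi mu k (X k w))) /step_psi.
rewrite /laplace_error /weighted_sum GammaE !mulr_sumr -!big_split !mulr_sumr.
rewrite -sumrN -!big_split; apply: eq_bigr => k _ /=.
by move: (generator _ _ _ _) (bias_step _ _ _) (W _) => *; ring.
Qed.

Lemma weighted_sum_measurable n : measurable_fun setT (weighted_sum n).
Proof.
apply: measurable_sum => k; apply: measurable_funM => //.
apply: (measurableT_comp (generator_measurable b_lip sigma_lip phiC)).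
exact: (scheme_measurable gamma b_lip sigma_lip hX0 hGC k).
Qed.

Lemma laplace_weighted_sum : exists2 C, 0 <= C & forall mu n, (1 <= n)%N ->
  `|mu| <= 1 -> 2 * `|mu| * M <= 1 ->
  let del := weight gamma n / Num.sqrt (Gamma gamma n) in del <= 1 ->
  (\int[P]_w (expR ((1 - del) * (mu * weighted_sum n w)))%:E <=
   (expR (mu ^+ 2 * m / 2 * Gamma gamma n + C * (laplace_error mu n
     + del * (1 + mu ^+ 2 * Gamma gamma n))))%:E)%E.
Proof.
have [C C0 momC] := W_moment b_lip sigma_lip hX0 hGC hLV s0 sigma_s gamma0 gamma1 gammaN.
pose g := growth + D; have g0 : 0 <= g by rewrite addr_ge0.
have C'0 : 0 <= C * (1 + g ^+ 2) by rewrite mulr_ge0 ?addr_ge0 ?sqr_ge0.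
exists (D + C * (1 + g ^+ 2)) => [|mu n n1 mu1 muM del del1]; first by rewrite addr_ge0.
set G := Gamma gamma n; set T := weight gamma n in del del1 *.
have G0 : 0 < G.
  rewrite /G GammaE; case: n n1 {del del1 G T} => // n _.
  by rewrite big_nat_recr//= ltr_wpDl ?gamma0// sumr_ge0// => k _; rewrite ltW ?gamma0.
have sG0 : 0 < Num.sqrt G by rewrite sqrtr_gt0.
have T0 : 0 < T by exact: lt_le_trans (weight_ge2 _ _).
have del0 : 0 <= del by rewrite divr_ge0 ?(ltW T0) ?(ltW sG0).
have mX k : measurable_fun setT (X k : Omega -> borelV R d).
  exact: (scheme_measurable gamma b_lip sigma_lip hX0 hGC k).
have mW : measurable_fun setT ((fun x => W x) : borelV R d -> R).
  exact: continuous_borelV_measurable (W_continuous hLV).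
have step k x : (\int[P]_w (expR (tilt phi psi mu (one_step b sigma (gamma k.+1) x (U 1 w))
    - tilt phi psi mu x))%:E <= (expR (step_psi mu k x))%:E)%E.
  apply: (tilt_step hGC hLV s0 sigma_s Lb0 bL beta0 beta1 _ phiC psiC phiM psiM
    phi_drift psi_drift poisson) => //; first exact: ltW (gamma0 _).
  by rewrite ler_wsqrtr ?gamma1.
have sup := exp_supermartingale b_lip sigma_lip hX0 hGC (@tilt_measurable mu)
  (@step_psi_measurable mu) step n.
(* Chosen so that del * l / T = |mu| g: the average below, once multiplied by del, is exactly the
   remainder of [holder_bookkeeping]. *)
pose l := `|mu| * g * Num.sqrt G.
have l0 : 0 <= l by rewrite !mulr_ge0 ?(ltW sG0).
(* Indices of the average: [None] stands for X_0, [Some None] for X_n and [Some (Some k)] for X_k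
   with weight gamma_{k+1}^2. Dividing by T makes the weights sum to 1. *)
pose I := option (option nat).
pose sq : seq I := [:: None, Some None & [seq Some (Some k) | k <- index_iota 0 n]].
pose p (i : I) : R := if i is Some (Some k) then gamma k.+1 ^+ 2 / T else T^-1.
pose ix (i : I) := if i is Some j then (if j is Some k then k else n) else 0%N.
have p0 i : 0 <= p i.
  by case: i => [[k|]|] /=; rewrite ?divr_ge0 ?invr_ge0 ?sqr_ge0 ?(ltW T0).
have p1 : \sum_(i <- sq) p i = 1.
  rewrite !big_cons big_map /= -mulr_suml -[1 in RHS](divff (lt0r_neq0 T0)).
  by rewrite [X in _ = X / _](_ : T = 2 + \sum_(0 <= k < n) gamma k.+1 ^+ 2)//; ring.
have momK k : (\int[P]_w (expR (l * W (X k w)))%:E <= (expR (C * (1 + l ^+ 2)))%:E)%E.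
  exact: momC.
have mlW k : measurable_fun setT (fun w => l * W (X k w)).
  by apply: measurable_funM => //; exact: (measurableT_comp mW).
have JB := @integral_expR_jensen _ _ _ P I sq p (fun i w => l * W (X (ix i) w)) _
  p0 p1 (fun i => mlW (ix i)) (fun i => momK (ix i)).
have mA : measurable_fun setT (fun w => tilt phi psi mu (X n w) - tilt phi psi mu (X0 w)
    - \sum_(k < n) step_psi mu k (X k w)).
  apply: measurable_funB; first apply: measurable_funB.
  - exact: (measurableT_comp (@tilt_measurable mu)).
  - exact: (measurableT_comp (@tilt_measurable mu) (mX 0%N)).
  - apply: measurable_sum => k.
    exact: (measurableT_comp (@step_psi_measurable mu k)).
have mB : measurable_fun setT (fun w => \sum_(i <- sq) p i * (l * W (X (ix i) w))).
  by apply: measurable_sum => i; apply: measurable_funM.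
have H := integral_expR_holder del0 del1 mA mB sup JB.
pose L := mu ^+ 2 * m / 2 * G + D * laplace_error mu n.
have L0 : 0 <= L.
  have B0 : 0 <= \sum_(0 <= k < n) bias_step gamma beta k.
    by rewrite sumr_ge0// => k _; exact: bias_step_ge0.
  have S0 : 0 <= \sum_(0 <= k < n) Num.sqrt (gamma k.+1) ^+ 3.
    by rewrite sumr_ge0// => k _; rewrite exprn_ge0.
  have q0 := sqr_ge0 mu; have c0 := exprn_ge0 3 (normr_ge0 mu).
  have G00 := ltW G0.
  rewrite /L /laplace_error -/G addr_ge0//; first by rewrite mulr_ge0// divr_ge0// mulr_ge0.
  rewrite mulr_ge0// addr_ge0//; last exact: mulr_ge0.
  by rewrite addr_ge0//; exact: mulr_ge0.
have pw w : (1 - del) * (mu * weighted_sum n w) <=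
    ((1 - del) * (tilt phi psi mu (X n w) - tilt phi psi mu (X0 w)
    - \sum_(k < n) step_psi mu k (X k w)) + del * \sum_(i <- sq) p i * (l * W (X (ix i) w)))
    + L.
  have Q0 : 0 <= \sum_(0 <= k < n) gamma k.+1 ^+ 2 * W (X k w).
    by rewrite sumr_ge0// => k _; rewrite mulr_ge0 ?sqr_ge0 ?sqrtr_ge0.
  have -> : del * (\sum_(i <- sq) p i * (l * W (X (ix i) w))) =
      `|mu| * g * (W (X0 w) + W (X n w) + \sum_(0 <= k < n) gamma k.+1 ^+ 2 * W (X k w)).
    rewrite !big_cons big_map /=.
    have -> : \sum_(j <- index_iota 0 n) gamma j.+1 ^+ 2 / T * (l * W (X j w)) =
        T^-1 * l * \sum_(0 <= k < n) gamma k.+1 ^+ 2 * W (X k w).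
      by rewrite mulr_sumr; apply: eq_bigr => k _; ring.
    rewrite /del /l; move: (\sum_(0 <= k < n) _) (W (X0 w)) (W (X n w)) => q w0 wn.
    by field; rewrite !gt_eqF.
  rewrite sum_step_psi -/L.
  apply: holder_bookkeeping; rewrite ?sqrtr_ge0 ?subr_ge0//; exact: tilt_growth.
apply: (@le_trans _ _ ((expR L)%:E * (expR (del * (C * (1 + l ^+ 2))))%:E)%E); last first.
  rewrite -EFinM -expRD lee_fin ler_expR /L -addrA lerD2l.
  (* The moment cost l^2 is comparable to the Gaussian exponent; it becomes an error only through
     the factor del in front. *)
  have -> : l ^+ 2 = g ^+ 2 * (mu ^+ 2 * G).
    by rewrite /l !exprMn real_normK ?num_real// sqr_sqrtr ?(ltW G0)//; ring.
  have xG : 0 <= mu ^+ 2 * G by rewrite mulr_ge0 ?sqr_ge0 ?(ltW G0).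
  have E0 : 0 <= laplace_error mu n.
    rewrite /laplace_error; have G00 := ltW G0.
    rewrite addr_ge0//; first rewrite addr_ge0//.
    - by rewrite mulr_ge0 ?exprn_ge0.
    - by rewrite mulr_ge0// sumr_ge0// => k _; exact: bias_step_ge0.
    - by rewrite mulr_ge0 ?sqr_ge0// sumr_ge0// => k _; rewrite exprn_ge0.
  move: (laplace_error mu n) (mu ^+ 2 * G) E0 xG => e x e0 x0.
  have y0 := mulr_ge0 C'0 e0.
  have y1 : 0 <= D * (del * (1 + x)) by rewrite mulr_ge0// mulr_ge0// addr_ge0.
  have y2 : 0 <= C * (del * (g ^+ 2 + x)).
    by rewrite mulr_ge0// mulr_ge0// addr_ge0 ?sqr_ge0.
  rewrite -subr_ge0 (_ : _ - _ = C * (1 + g ^+ 2) * e + D * (del * (1 + x))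
    + C * (del * (g ^+ 2 + x))); last by ring.
  by rewrite !addr_ge0.
apply: (@le_trans _ _ (\int[P]_w ((expR L)%:E * (expR ((1 - del) *
    (tilt phi psi mu (X n w) - tilt phi psi mu (X0 w)
    - \sum_(k < n) step_psi mu k (X k w)) +
    del * \sum_(i <- sq) p i * (l * W (X (ix i) w))))%:E))%E).
  apply: ge0_le_integralT => w; first by rewrite lee_fin expR_ge0.
  by rewrite -EFinM -expRD lee_fin ler_expR [leRHS]addrC; exact: pw.
rewrite ge0_integralZl_EFin ?expR_ge0//.
  by apply: lee_wpmul2l; rewrite ?lee_fin ?expR_ge0.
apply/measurable_EFinP; apply: (measurableT_comp (@measurable_expR R)).
by apply: measurable_funD; exact: measurable_funM.
Qed.

End LaplaceOfSums.

(** * Deviations of the empirical measure *)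

Section EmpiricalIntegral.
Set Implicit Arguments.
Unset Strict Implicit.
Context {R : realType} {d r : nat} {disp : measure_display}
  {Omega : measurableType disp}.
Variables (b : 'cV[R]_d -> 'cV[R]_d) (sigma : 'cV[R]_d -> 'M[R]_(d, r)).
Variables (X0 : Omega -> 'cV[R]_d) (U : nat -> Omega -> 'cV[R]_r).
Variable gamma : nat -> R.
Hypothesis gamma0 : forall k, (1 <= k)%N -> 0 < gamma k.

Notation X := (scheme b sigma gamma X0 U).

Let Gamma0 n : 0 <= (Gamma gamma n)^-1.
Proof.
by rewrite invr_ge0 GammaE sumr_ge0// => k _; rewrite ltW// gamma0.
Qed.

Let gammaS0 k : 0 <= gamma k.+1.
Proof. exact: ltW (gamma0 (ltn0Sn k)). Qed.

Lemma ge0_integral_empirical n w (h : borelV R d -> R) :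
  measurable_fun setT h -> (forall x, 0 <= h x) ->
  (\int[empirical b sigma gamma X0 U n w]_x (h x)%:E =
   ((Gamma gamma n)^-1 * \sum_(k < n) gamma k.+1 * h (X k w))%:E)%E.
Proof.
move=> mh h0.
have mhE : measurable_fun setT (EFin \o h) by exact/measurable_EFinP.
have hE0 x : setT x -> (0 <= (h x)%:E)%E by rewrite lee_fin.
rewrite /empirical ge0_integral_mscale//= ger0_norm ?Gamma0//.
rewrite ge0_integral_measure_sum// EFinM; congr (_ * _)%E.
rewrite -sumEFin; apply: eq_bigr => k _.
rewrite ge0_integral_mscale//= ger0_norm ?gammaS0//.
by rewrite integral_dirac// diracT mul1e EFinM.
Qed.

Lemma Rintegral_empirical n w (h : borelV R d -> R) : measurable_fun setT h ->
  \int[empirical b sigma gamma X0 U n w]_x h x =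
  (Gamma gamma n)^-1 * \sum_(0 <= k < n) gamma k.+1 * h (X k w).
Proof.
move=> mh; rewrite /Rintegral integralE.
rewrite (_ : (fun x => (h x)%:E) = EFin \o h)// funerpos funerneg.
rewrite !ge0_integral_empirical; last 4 first.
- exact: measurable_funrneg.
- by move=> x; exact: funrneg_ge0.
- exact: measurable_funrpos.
- by move=> x; exact: funrpos_ge0.
rewrite -EFinB/= -mulrBr big_mkord -sumrB; congr (_ * _); apply: eq_bigr => k _.
rewrite -mulrBr; congr (_ * _).
by have := congr1 (fun f => f (X k w)) (funrposBneg h).
Qed.

End EmpiricalIntegral.

Section Tails.
Set Implicit Arguments.
Unset Strict Implicit.
Context {R : realType} {disp : measure_display} {Omega : measurableType disp}.
Variable P : probability Omega R.

Lemma two_sided_chernoff (S : Omega -> R) (q x t L : R) :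
  measurable_fun setT S -> 0 <= q -> 0 <= x ->
  (forall y, `|y| = x -> (\int[P]_w (expR (q * (y * S w)))%:E <= (expR L)%:E)%E) ->
  (P [set w | (t <= `|S w|)%R] <= (2 * expR (- (q * x * t) + L))%:E)%E.
Proof.
move=> mS q0 x0 lap.
have half (e : R) : `|e * x| = x ->
    (P [set w | (t <= e * S w)%R] <= (expR (- (q * x * t) + L))%:E)%E.
  move=> ex; have meS : measurable_fun setT (fun w => e * S w) by exact: measurable_funM.
  apply: (le_trans (markov_expR P t (mulr_ge0 q0 x0) meS)).
  rewrite expRD EFinM; apply: lee_wpmul2l; first by rewrite lee_fin expR_ge0.
  apply: le_trans (lap _ ex); apply: ge0_le_integralT => w; first by rewrite lee_fin expR_ge0.
  by rewrite lee_fin ler_expR le_eqVlt; apply/orP; left; apply/eqP; ring.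
have meas (e : R) : measurable [set w | t <= e * S w].
  rewrite (_ : [set w | t <= e * S w] = [set: Omega] `&` (fun w => e * S w) @^-1` `[t, +oo[).
    by apply: measurable_funM => //; exact: measurable_itv.
  by rewrite setTI; apply/seteqP; split => w /=; rewrite in_itv/= andbT.
have -> : [set w | t <= `|S w|] = [set w | t <= 1 * S w] `|` [set w | t <= -1 * S w].
  apply/seteqP; split => w /=; rewrite mul1r mulN1r ler_normr.
    by case/orP; [left|right].
  by case=> ->; rewrite ?orbT.
apply: (le_trans (measureU2 P (meas 1) (meas (-1)))).
rewrite mulr2n mulrDl mul1r EFinD; apply: leeD; apply: half.
  by rewrite mul1r ger0_norm.
by rewrite mulN1r normrN ger0_norm.
Qed.

Lemma exponent_bound (m C G B Cu del rho a x e : R) : 0 < m -> 0 <= C -> 0 < G ->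
  0 < a -> 0 <= B -> 0 <= Cu -> 0 <= del -> a / Num.sqrt G <= rho ->
  x = a / (m * Num.sqrt G) ->
  e = 2 * del + (1 + 2 / m) *
    (C * (rho / m + B / Num.sqrt G + Cu / G + del)) ->
  - ((1 - del) * x * (a * Num.sqrt G)) + (x ^+ 2 * m / 2 * G +
    C * (x ^+ 3 * G + x * B + x ^+ 2 * Cu + del * (1 + x ^+ 2 * G)))
  <= - ((1 - e) * (a ^+ 2 / (2 * m))) + e.
Proof.
move=> m0 C0 G0 a0 B0 Cu0 del0 arho xdef edef.
have g0 : 0 < Num.sqrt G by rewrite sqrtr_gt0.
have gE : G = Num.sqrt G ^+ 2 by rewrite sqr_sqrtr// ltW.
move: (Num.sqrt G) g0 gE arho xdef edef => g g0 -> arho xdef edef.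
pose z := a / m; have z0 : 0 < z by rewrite divr_gt0.
have aE : a = z * m by rewrite /z divfK ?gt_eqF.
have xE : x = z / g by rewrite xdef /z invfM mulrA.
have xg : x ^+ 2 * g ^+ 2 = z ^+ 2 by rewrite xE -exprMn divfK ?gt_eqF.
have zrho : z / g <= rho / m by rewrite /z mulrAC ler_wpM2r ?invr_ge0 ?(ltW m0).
have z1 : z <= 1 + z ^+ 2.
  by have := sqr_ge0 (z - 1); have := sqr_ge0 z; rewrite sqrrB mulr1 expr1n; lra.
pose y := B / g; have y0 : 0 <= y by rewrite divr_ge0// ltW.
pose v := Cu / g ^+ 2; have v0 : 0 <= v by rewrite divr_ge0// ltW ?exprn_gt0.
have e1 : x ^+ 3 * g ^+ 2 <= (1 + z ^+ 2) * (rho / m).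
  rewrite (_ : x ^+ 3 * g ^+ 2 = z ^+ 2 * (z / g)); last by rewrite exprS -mulrA xg xE; ring.
  apply: ler_pM => //; [exact: sqr_ge0|by rewrite divr_ge0 ?ltW|by rewrite lerDr].
have e2 : x * B <= (1 + z ^+ 2) * y.
  rewrite (_ : x * B = z * y); last by rewrite xE /y; ring.
  by rewrite ler_wpM2r.
have e3 : x ^+ 2 * Cu <= (1 + z ^+ 2) * v.
  rewrite (_ : x ^+ 2 * Cu = z ^+ 2 * v); last by rewrite xE /v; field; rewrite gt_eqF.
  by rewrite ler_wpM2r// lerDr.
pose eta := rho / m + y + v + del.
have E : C * (x ^+ 3 * g ^+ 2 + x * B + x ^+ 2 * Cu + del * (1 + x ^+ 2 * g ^+ 2)) <=
    C * eta * (1 + z ^+ 2).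
  rewrite -mulrA ler_wpM2l// xg /eta.
  have -> : (rho / m + y + v + del) * (1 + z ^+ 2) = (1 + z ^+ 2) * (rho / m)
    + (1 + z ^+ 2) * y + (1 + z ^+ 2) * v + del * (1 + z ^+ 2) by ring.
  by rewrite lerD// lerD// lerD.
have xag : x * (a * g) = z ^+ 2 * m by rewrite xE aE; field; rewrite gt_eqF.
have am : a ^+ 2 / (2 * m) = z ^+ 2 * m / 2 by rewrite aE; field; rewrite gt_eqF.
rewrite -(mulrA (1 - del)) xag am.
have -> : x ^+ 2 * m / 2 * g ^+ 2 = z ^+ 2 * m / 2 by rewrite -xg; ring.
apply: (le_trans (lerD (lexx _) (lerD (lexx _) E))).
have eE : e = 2 * del + (1 + 2 / m) * (C * eta) by exact: edef.
have eta0 : 0 <= eta.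
  have : 0 <= rho / m by apply: le_trans zrho; rewrite divr_ge0 ?ltW.
  by move=> h; rewrite /eta !addr_ge0.
have h := mulr_ge0 C0 eta0.
move: eE; move: (C * eta) h => k k0 eE.
rewrite -subr_ge0 (_ : _ - _ = 2 * del + 2 / m * k + k * (z ^+ 2 * m / 2)); last first.
  by rewrite eE; field; rewrite gt_eqF.
have m00 := ltW m0.
have p1 : 0 <= 2 / m * k by rewrite mulr_ge0// divr_ge0.
have p2 : 0 <= k * (z ^+ 2 * m / 2) by rewrite mulr_ge0// divr_ge0// mulr_ge0 ?sqr_ge0.
by rewrite addr_ge0// addr_ge0// mulr_ge0.
Qed.

End Tails.

(** * From vanishing errors to monotone sequences *)

Section Envelope.
Set Implicit Arguments.
Unset Strict Implicit.
Context {R : realType}.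

(** The supremum of the tail is only nonincreasing and may vanish; adding 1 / (n + 1) makes the
    envelope positive and strictly decreasing. *)
Lemma null_decreasing_envelope (e : nat -> R) : e @ \oo --> (0 : R) ->
  exists E : nat -> R, [/\ forall n, e n <= E n, forall n, 0 < E n,
    forall n, E n.+1 < E n & E @ \oo --> (0 : R)].
Proof.
move=> e0.
pose A n := [set `|e k| | k in [set k | (n <= k)%N]].
have [M eM] : exists M : R, forall k, `|e k| <= M.
  have /cvg_seq_bounded[M [_ MP]] : cvgn e by apply/cvg_ex; exists 0.
  by exists (M + 1) => k; apply: (MP (M + 1)); rewrite ?ltrDl.
have supA n : has_sup (A n).
  split; first by exists `|e n|, n => /=.
  by exists M => _ [k _ <-].
pose E n := sup (A n) + n.+1%:R^-1.
have inv0 n : 0 < n.+1%:R^-1 :> R by rewrite invr_gt0 ltr0n.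
have le_sup n k : (n <= k)%N -> `|e k| <= sup (A n).
  by move=> nk; apply: ub_le_sup; [exact: (supA n).2|exists k].
exists E; split.
- move=> n; apply: (le_trans (ler_norm _)).
  by rewrite (le_trans (le_sup n n _))// lerDl ltW.
- by move=> n; rewrite ltr_wpDl// (le_trans _ (le_sup n n _)).
- move=> n; apply: ler_ltD; last by rewrite ltf_pV2 ?posrE ?ltr0n// ltr_nat.
  apply: sup_le_ub; first by exists `|e n.+1|, n.+1 => /=.
  by move=> _ [k /= nk <-]; apply: le_sup; exact: ltnW.
- apply: cvg0P => x x0.
  have x20 : 0 < x / 2 by rewrite divr_gt0.
  have /cvgrPdist_le/(_ _ x20)[N _ NP] := e0.
  exists (maxn N (Num.truncn (x / 2)^-1)) => n; rewrite geq_max => /andP[Nn xn].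
  rewrite ger0_norm; last first.
    by rewrite addr_ge0// ?(ltW (inv0 _))// (le_trans _ (le_sup n n _)).
  have h1 : sup (A n) <= x / 2.
    apply: sup_le_ub; first by exists `|e n|, n => /=.
    move=> _ [k /= nk <-]; have := NP k (leq_trans Nn nk).
    by rewrite /= sub0r normrN.
  have h2 : n.+1%:R^-1 <= x / 2.
    rewrite -[leRHS]invrK lef_pV2 ?posrE ?invr_gt0 ?ltr0n//.
    by rewrite (le_trans (ltW (truncnS_gt _)))// ler_nat.
  by rewrite [leRHS](splitr x) lerD.
Qed.

End Envelope.

Section Assembly.
Set Implicit Arguments.
Unset Strict Implicit.
Context {R : realType} {d r : nat}.
Variables (b : 'cV[R]_d -> 'cV[R]_d) (sigma : 'cV[R]_d -> 'M[R]_(d, r)).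

(** Stated for all large M, so that phi and psi can share one constant. *)
Lemma T_cond_bounds (V g : 'cV[R]_d -> R) (beta : R) : 0 <= beta ->
  T_cond b V beta g -> exists M0, forall M, M0 <= M ->
    [/\ smooth_bounds beta M g, lipschitz_const M (fun x => dot (b x) (grad g x))
      & forall x, `|g x| <= M * (1 + Num.sqrt (V x))].
Proof.
move=> beta0 [/(Ck_holder_smooth_bounds beta0)[C1 gC1] [C2 gC2] [C3 C30 gC3]].
have C10 := sb_ge0 gC1.
exists (C1 + `|C2| + C3) => M CM; have := ler_norm C2; have := normr_ge0 C2 => p2 l2.
split.
- apply: smooth_bounds_le gC1; lra.
- move=> x y; apply: (le_trans (gC2 x y)); rewrite ler_wpM2r ?fnorm_ge0//; lra.
- move=> x; apply: (le_trans (gC3 x)).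
  by rewrite ler_wpM2r ?addr_ge0 ?sqrtr_ge0//; lra.
Qed.

Lemma small_steps_hess (gamma : nat -> R) (V : 'cV[R]_d -> R)
    (vstar CV alphaV betaV K cbar : R) k :
  lyapunov b sigma V vstar CV alphaV betaV ->
  small_steps b gamma V CV alphaV K cbar -> (1 <= k)%N ->
  gamma k * (CV * sup_norm (hess V)) <= alphaV / 2.
Proof.
move=> hLV hS k1; have CV0 := CV_gt0 hLV; have a0 := alphaV_gt0 hLV.
have N0 : 0 <= sup_norm (hess V) := le_trans (fnorm_ge0 _) (fnorm_hess_le hLV 0).
have := gamma_small hS k1; rewrite le_min => /andP[_].
(* If the Hessian of V vanishes, the quotient in the step condition is a division by zero, but the
   claim reduces to 0 <= alphaV / 2. *)
move: N0; rewrite le_eqVlt => /predU1P[<- _|N0].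
  by rewrite !mulr0 divr_ge0 ?(ltW a0).
have cN := mulr_gt0 CV0 N0.
move=> /(ler_wpM2r (ltW cN)) /le_trans; apply.
rewrite le_eqVlt; apply/orP; left; apply/eqP.
by move: (sup_norm _) N0 {cN} => N N0; field; rewrite !gt_eqF.
Qed.

End Assembly.

Section NullSequences.
Set Implicit Arguments.
Unset Strict Implicit.
Context {R : realType}.
Implicit Types u v : nat -> R.

Lemma cvg0D u v : u @ \oo --> (0 : R) -> v @ \oo --> (0 : R) ->
  (fun n => u n + v n) @ \oo --> (0 : R).
Proof. by move=> u0 v0; rewrite -[X in _ --> X](addr0 (0 : R)); exact: cvgD. Qed.

Lemma cvg0Z (c : R) u : u @ \oo --> (0 : R) -> (fun n => c * u n) @ \oo --> (0 : R).
Proof. by move=> u0; rewrite -[X in _ --> X](mulr0 c); exact: cvgMl_tmp. Qed.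

Lemma cvg0_norm u : u @ \oo --> (0 : R) -> (fun n => `|u n|) @ \oo --> (0 : R).
Proof.
move=> u0; apply: cvg0P => x x0; have /cvgrPdist_le/(_ _ x0)[N _ NP] := u0.
by exists N => n Nn; have := NP n Nn; rewrite sub0r normrN normr_id.
Qed.

(* [E n] is an envelope of the relative errors; [c] vanishes as long as the
   errors exceed 1, where the bound to be proved is trivial. *)
Lemma envelope_sequences (e : nat -> R) : e @ \oo --> (0 : R) ->
  exists E c C : nat -> R,
  [/\ forall n, e n <= E n /\ 0 < E n,
      forall n, c n = Num.max 0 (1 - E n) /\ C n = expR (E n),
      exists N : nat, forall n, (N <= n)%N -> c n < c n.+1 /\ C n.+1 < C n,
      c @ \oo --> (1 : R) & C @ \oo --> (1 : R)].
Proof.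
move=> /null_decreasing_envelope[E [eE E0 Edecr Ecvg]].
exists E, (fun n => Num.max 0 (1 - E n)), (fun n => expR (E n)).
have small (x : R) : 0 < x -> exists N, forall n, (N <= n)%N -> E n <= x.
  move=> x0; have /cvgrPdist_le/(_ _ x0)[N _ NP] := Ecvg.
  exists N => n Nn; have := NP n Nn.
  by rewrite /= sub0r normrN ger0_norm// ltW.
have [N NP] := small 1 ltr01.
have maxE n : (N <= n)%N -> Num.max 0 (1 - E n) = 1 - E n.
  by move=> /NP En; apply/max_idPr; rewrite subr_ge0.
split=> //.
- by exists N => n Nn; rewrite !maxE ?(leqW Nn)// ltr_expR Edecr ltrD2l ltrN2 Edecr.
- apply/cvgrPdist_le => x x0; have [N' N'P] := small x x0.
  exists (maxn N N') => // n /=; rewrite geq_max => /andP[Nn N'n].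
  by rewrite maxE// opprB addrCA subrr addr0 ger0_norm ?(ltW (E0 _))// N'P.
- rewrite -[X in _ --> X]expR0.
  exact: (continuous_cvg _ (@continuous_expR R 0) Ecvg).
Qed.

End NullSequences.

Section DeviationError.
Set Implicit Arguments.
Unset Strict Implicit.
Context {R : realType}.
Variables (gamma : nat -> R) (theta beta m M : R).

(** The first part is the error of [exponent_bound]. The last term forces the Chernoff parameter to
    be admissible: an error at most 1 implies |mu| <= 1 and 2 |mu| M <= 1. *)
Definition deviation_error (C rho : R) n : R :=
  let del := weight gamma n / Num.sqrt (Gamma gamma n) in
  2 * del + (1 + 2 / m) * (C * (rho / m
    + (\sum_(0 <= k < n) bias_step gamma beta k) / Num.sqrt (Gamma gamma n)
    + (\sum_(0 <= k < n) Num.sqrt (gamma k.+1) ^+ 3) / Gamma gamma n + del))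
  + (1 + 2 * M) * (rho / m).

Lemma deviation_error_cvg0 (C : R) (rho : nat -> R) :
  steps gamma theta -> 0 < beta -> beta <= 1 -> (2 + beta)^-1 < theta -> theta <= 1 ->
  rho @ \oo --> (0 : R) ->
  (fun n => deviation_error C `|rho n| n) @ \oo --> (0 : R).
Proof.
move=> hgamma beta0 beta1 theta_gt theta1 rho0.
have w0 := weight_cvg0 hgamma beta0 beta1 theta_gt theta1.
have r0 : (fun n => `|rho n| / m) @ \oo --> (0 : R).
  have := cvg0Z m^-1 (cvg0_norm rho0).
  by under eq_fun do rewrite mulrC.
apply: cvg0D; last exact: cvg0Z.
apply: cvg0D; first exact: cvg0Z.
apply: cvg0Z; apply: cvg0Z; apply: cvg0D; last exact: w0.
apply: cvg0D; last exact: (cube_cvg0 hgamma beta0 theta_gt theta1).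
by apply: cvg0D => //; exact: (bias_cvg0 hgamma beta0 theta_gt theta1).
Qed.

End DeviationError.

Section DeviationBound.
Set Implicit Arguments.
Unset Strict Implicit.
Context {R : realType} {d r : nat} {disp : measure_display}
  {Omega : measurableType disp} (P : probability Omega R).
Variables (b : 'cV[R]_d -> 'cV[R]_d) (sigma : 'cV[R]_d -> 'M[R]_(d, r)).
Variables (X0 : Omega -> 'cV[R]_d) (U : nat -> Omega -> 'cV[R]_r).
Hypotheses (b_lip : lipschitz_mx b) (sigma_lip : lipschitz_mx sigma).
Hypotheses (hX0 : initial_cond P X0) (hGC : GC P X0 U).
Variables (V : 'cV[R]_d -> R) (vstar CV alphaV betaV : R).
Hypothesis hLV : lyapunov b sigma V vstar CV alphaV betaV.
Variables (s Lb : R).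
Hypotheses (s0 : 0 < s) (sigma_s : forall x, fnorm (sigma x) <= s).
Hypotheses (Lb0 : 0 <= Lb)
  (bL : forall x y, fnorm (b x - b y) <= Lb * fnorm (x - y)).
Variables (gamma : nat -> R).
Hypotheses (gamma0 : forall k, (1 <= k)%N -> 0 < gamma k)
  (gamma1 : forall k, (1 <= k)%N -> gamma k <= gamma 1%N)
  (gammaN : forall k, (1 <= k)%N -> gamma k * (CV * sup_norm (hess V)) <= alphaV / 2).
Variable (beta : R).
Hypotheses (beta0 : 0 <= beta) (beta1 : beta <= 1).
Variables (phi psi : 'cV[R]_d -> R) (M m : R).
Hypotheses (phiC : Ck 3 phi) (psiC : Ck 3 psi).
Hypotheses (phiM : smooth_bounds beta M phi) (psiM : smooth_bounds beta M psi).
Hypotheses (phi_drift : lipschitz_const M (fun x => dot (b x) (grad phi x)))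
  (psi_drift : lipschitz_const M (fun x => dot (b x) (grad psi x))).
Hypotheses (phi_W : forall x, `|phi x| <= M * (1 + Num.sqrt (V x)))
  (psi_W : forall x, `|psi x| <= M * (1 + Num.sqrt (V x))).
Hypothesis (m0 : 0 < m).
Hypothesis poisson : forall x,
  generator b sigma psi x = carre_du_champ sigma phi x - m.


Lemma deviation_bound : exists2 C, 0 <= C & forall n (a rho : R), (1 <= n)%N -> 0 < a ->
  a / Num.sqrt (Gamma gamma n) <= rho ->
  let e := deviation_error gamma beta m M C rho n in e <= 1 ->
  (P [set w | (a <= `|Num.sqrt (Gamma gamma n) *
      \int[empirical b sigma gamma X0 U n w]_x generator b sigma phi x|)%R] <=
   (2 * expR (- ((1 - e) * (a ^+ 2 / (2 * m))) + e))%:E)%E.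
Proof.
have [C C0 lap] := laplace_weighted_sum b_lip sigma_lip hX0 hGC hLV s0 sigma_s Lb0 bL
  gamma0 gamma1 gammaN beta0 beta1 phiC psiC phiM psiM phi_drift psi_drift phi_W psi_W
  (ltW m0) poisson.
exists C => // n a rho n1 a0 arho.
set G := Gamma gamma n in arho *; set sG := Num.sqrt G in arho *.
have G0 : 0 < G.
  rewrite /G GammaE; case: n n1 {arho sG G} => // n _.
  by rewrite big_nat_recr//= ltr_wpDl ?gamma0// sumr_ge0// => k _; rewrite ltW ?gamma0.
have sG0 : 0 < sG by rewrite sqrtr_gt0.
pose S w := weighted_sum b sigma X0 U gamma phi n w.
have mS : measurable_fun setT S.
  exact: (weighted_sum_measurable b_lip sigma_lip hX0 hGC gamma phiC n).
have mG := generator_measurable b_lip sigma_lip phiC.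
set del := weight gamma n / sG.
set B := \sum_(0 <= k < n) bias_step gamma beta k.
set Q := \sum_(0 <= k < n) Num.sqrt (gamma k.+1) ^+ 3.
rewrite /deviation_error -/G -/sG -/del -/B -/Q.
set e1 := 2 * del + _; set e2 := (1 + 2 * M) * _ => e_le1.
have M0 := sb_ge0 phiM.
have del0 : 0 <= del by rewrite divr_ge0 ?(ltW sG0)// (le_trans _ (weight_ge2 _ _)).
have B0 : 0 <= B by rewrite sumr_ge0// => k _; exact: bias_step_ge0.
have Q0 : 0 <= Q by rewrite sumr_ge0// => k _; rewrite exprn_ge0.
pose x := a / (m * sG).
have x0 : 0 < x by rewrite divr_gt0 ?mulr_gt0.
have xrho : x <= rho / m.
  by rewrite /x invfM mulrA mulrAC ler_wpM2r ?invr_ge0 ?(ltW m0).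
have r0 : 0 <= rho / m := le_trans (ltW x0) xrho.
have e20 : 0 <= e2 by rewrite mulr_ge0// addr_ge0// mulr_ge0.
have e10 : 0 <= e1 - 2 * del.
  rewrite /e1 addrC addKr mulr_ge0 ?addr_ge0 ?divr_ge0 ?(ltW m0)//.
  have bs : 0 <= B / sG := divr_ge0 B0 (ltW sG0).
  have qs : 0 <= Q / G := divr_ge0 Q0 (ltW G0).
  by rewrite mulr_ge0// addr_ge0// addr_ge0// addr_ge0.
(* All parts of the error are nonnegative, so the bound by 1 on their sum passes to each of them and
   yields the conditions of the Laplace estimate. *)
have del1 : del <= 1 by lra.
have e2E : e2 = rho / m + 2 * (rho / m) * M by rewrite /e2; ring.
have xM : 2 * x * M <= 2 * (rho / m) * M by rewrite ler_wpM2r// ler_wpM2l.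
have rM : 0 <= 2 * (rho / m) * M by rewrite mulr_ge0// mulr_ge0.
have x1 : x <= 1 by lra.
have xM1 : 2 * x * M <= 1 by lra.
have -> : [set w | a <= `|sG * \int[empirical b sigma gamma X0 U n w]_y
    generator b sigma phi y|] = [set w | a * sG <= `|S w|].
  apply/funext => w; apply/propext => /=.
  rewrite (Rintegral_empirical b sigma X0 U gamma0)//.
  rewrite -/(S w) -/G mulrA normrM.
  have -> : `|sG * G^-1| = sG^-1.
    rewrite ger0_norm ?mulr_ge0 ?invr_ge0 ?(ltW sG0) ?(ltW G0)//.
    by rewrite -[G](sqr_sqrtr (ltW G0)) -/sG; field; rewrite gt_eqF.
  by rewrite mulrC ler_pdivlMr.
have q0 : 0 <= 1 - del by rewrite subr_ge0.
pose L := x ^+ 2 * m / 2 * G + C * (x ^+ 3 * G + x * B + x ^+ 2 * Q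
  + del * (1 + x ^+ 2 * G)).
have lapL y : `|y| = x ->
    (\int[P]_w (expR ((1 - del) * (y * S w)))%:E <= (expR L)%:E)%E.
  move=> yx; have := lap y n n1; rewrite /laplace_error -/G -/sG -/del -/B -/Q yx.
  have -> : y ^+ 2 = x ^+ 2 by rewrite -yx real_normK// num_real.
  exact.
apply: (le_trans (two_sided_chernoff (a * sG) mS q0 (ltW x0) lapL)).
rewrite lee_fin ler_wpM2l// ler_expR.
have := exponent_bound m0 C0 G0 a0 B0 Q0 del0 arho (erefl x) (erefl e1).
move=> /le_trans; apply.
have y0 : 0 <= a ^+ 2 / (2 * m) by rewrite divr_ge0 ?sqr_ge0 ?mulr_ge0 ?(ltW m0).
rewrite -subr_ge0 (_ : _ - _ = e2 * (a ^+ 2 / (2 * m)) + e2); last by ring.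
by rewrite addr_ge0// mulr_ge0.
Qed.

End DeviationBound.

Theorem theorem3 (R : realType) (d r : nat)
  (disp : measure_display) (Omega : measurableType disp)
  (P : probability Omega R)
  (b : 'cV[R]_d -> 'cV[R]_d) (sigma : 'cV[R]_d -> 'M[R]_(d, r))
  (gamma : nat -> R) (theta : R)
  (X0 : Omega -> 'cV[R]_d) (U : nat -> Omega -> 'cV[R]_r)
  (V : 'cV[R]_d -> R) (vstar CV alphaV betaV K cbar : R)
  (nu : probability (borelV R d) R)
  (beta : R) (phi : 'cV[R]_d -> R)
  (b_lip : lipschitz_mx b) (sigma_lip : lipschitz_mx sigma)
  (hgamma : steps gamma theta)
  (hX0 : initial_cond P X0)
  (hGC : GC P X0 U)
  (hC2 : has_ubound (range (fun x => fnorm (sigma x) ^+ 2)))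
  (hLV : lyapunov b sigma V vstar CV alphaV betaV)
  (hU : unique_invariant b sigma nu)
  (hS : small_steps b gamma V CV alphaV K cbar)
  (beta_gt0 : 0 < beta) (beta_le1 : beta <= 1)
  (hphi : T_cond b V beta phi)
  (hpoisson : exists vtheta : 'cV[R]_d -> R,
     [/\ Ck_holder 3 beta vtheta, T_cond b V beta vtheta
       & forall x, generator b sigma vtheta x =
           carre_du_champ sigma phi x
           - \int[nu]_y carre_du_champ sigma phi y])
  (theta_gt : (2 + beta)^-1 < theta) (theta_le1 : theta <= 1) :
  forall rho : nat -> R, rho @ \oo --> (0 : R) ->
  exists c C : nat -> R,
    [/\ forall n, 0 <= c n /\ 0 <= C n,
        exists N : nat, forall n, (N <= n)%N -> c n < c n.+1 /\ C n.+1 < C n,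
        c @ \oo --> (1 : R), C @ \oo --> (1 : R)
      & forall (n : nat) (a : R), (1 <= n)%N -> 0 < a ->
          a / Num.sqrt (Gamma gamma n) <= rho n ->
          (P [set w | (a <= `| Num.sqrt (Gamma gamma n) *
                \int[empirical b sigma gamma X0 U n w]_x
                   generator b sigma phi x |)%R]
           <= (2 * C n *
               expR (- (c n * (a ^+ 2 /
                 (2 * \int[nu]_x carre_du_champ sigma phi x)))))%R%:E)%E].
Proof.
move=> rho rho0; set m := \int[nu]_x carre_du_champ sigma phi x.
have [psi [_ hpsi poisson]] := hpoisson; rewrite -/m in poisson.
have trivial_bound (A : set Omega) (C y : R) : measurable A -> 0 <= C -> 0 <= y ->
    (P A <= (2 * expR C * expR y)%:E)%E.
  move=> mA C0 y0; apply: (le_trans (probability_le1 P mA)).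
  rewrite lee_fin -mulrA -expRD.
  have : 1 <= expR (C + y) by rewrite -[leLHS]expR0 ler_expR addr_ge0.
  lra.
have gamma0 := gamma_gt0 hgamma.
have mEvent n (a : R) : measurable [set w | a <= `|Num.sqrt (Gamma gamma n) *
    \int[empirical b sigma gamma X0 U n w]_x generator b sigma phi x|].
  have [phiC _ _] := T_smooth hphi.
  have mG := generator_measurable b_lip sigma_lip phiC.
  rewrite (_ : [set w | _] = [set: Omega] `&` (fun w => `|Num.sqrt (Gamma gamma n) *
    ((Gamma gamma n)^-1 * weighted_sum b sigma X0 U gamma phi n w)|) @^-1` `[a, +oo[).
    have mS := weighted_sum_measurable b_lip sigma_lip hX0 hGC gamma phiC n.
    have mf : measurable_fun setT (fun w => `|Num.sqrt (Gamma gamma n) *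
        ((Gamma gamma n)^-1 * weighted_sum b sigma X0 U gamma phi n w)|).
      apply: (measurableT_comp (@normr_measurable R setT)).
      by apply: measurable_funM => //; exact: measurable_funM.
    by apply: mf => //; exact: measurable_itv.
  rewrite setTI; apply/funext => w; apply/propext => /=; rewrite in_itv/= andbT.
  by rewrite (Rintegral_empirical b sigma X0 U gamma0).
(* For m <= 0 the exponential on the right is at least 1, since division by zero gives zero. The
   bound is then trivial, and the envelope of the zero error supplies c and C. *)
have [m_le0|m_gt0] := leP m 0.
  have [E [c [C [EP cC mono c1 C1]]]] := @envelope_sequences R (fun=> 0) (cvg_cst _).
  exists c, C; split => //.
    by move=> n; rewrite (cC n).1 (cC n).2 expR_ge0 le_max lexx.
  move=> n a n1 a0 _; rewrite (cC n).2; apply: trivial_bound => //.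
    exact: ltW (EP n).2.
  rewrite oppr_ge0 mulr_ge0_le0//; first by rewrite (cC n).1 le_max lexx.
  by rewrite mulr_ge0_le0 ?sqr_ge0// invr_le0 mulr_ge0_le0.
have [Lb [Lb0 bL]] : exists Lb, 0 <= Lb /\
    forall x y, fnorm (b x - b y) <= Lb * fnorm (x - y).
  have [L bL] := b_lip; exists `|L|; split=> // x y.
  by apply: (le_trans (bL x y)); rewrite ler_wpM2r ?fnorm_ge0// ler_norm.
have [s [s0 sigma_s]] : exists s, 0 < s /\ forall x, fnorm (sigma x) <= s.
  have [S SP] := hC2; exists (1 + `|S|); split=> [|x].
    by rewrite ltr_pwDl.
  have xS : fnorm (sigma x) ^+ 2 <= S by apply: SP; exists x.
  have := ler_norm S; have := sqr_ge0 (fnorm (sigma x) - 1).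
  rewrite sqrrB mulr1 expr1n; have := fnorm_ge0 (sigma x); lra.
have [M1 phiP] := T_cond_bounds (ltW beta_gt0) hphi.
have [M2 psiP] := T_cond_bounds (ltW beta_gt0) hpsi.
pose M := `|M1| + `|M2|.
have [phiM phi_drift phi_W] : [/\ smooth_bounds beta M phi,
    lipschitz_const M (fun x => dot (b x) (grad phi x))
    & forall x, `|phi x| <= M * (1 + Num.sqrt (V x))].
  by apply: phiP; rewrite (le_trans (ler_norm M1))// lerDl.
have [psiM psi_drift psi_W] : [/\ smooth_bounds beta M psi,
    lipschitz_const M (fun x => dot (b x) (grad psi x))
    & forall x, `|psi x| <= M * (1 + Num.sqrt (V x))].
  by apply: psiP; rewrite (le_trans (ler_norm M2))// lerDr.
have [phiC _ _] := T_smooth hphi; have [psiC _ _] := T_smooth hpsi.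
have [D D0 tail] := deviation_bound b_lip sigma_lip hX0 hGC hLV s0 sigma_s Lb0 bL
  gamma0 (gamma_le1 hgamma) (fun k => small_steps_hess hLV hS (k := k))
  (ltW beta_gt0) beta_le1 phiC psiC phiM psiM phi_drift psi_drift phi_W psi_W
  m_gt0 poisson.
have err0 := deviation_error_cvg0 m M D hgamma beta_gt0 beta_le1 theta_gt theta_le1 rho0.
have [E [c [C [EP cC mono c1 C1]]]] := envelope_sequences err0.
exists c, C; split => //.
  by move=> n; rewrite (cC n).1 (cC n).2 expR_ge0 le_max lexx.
move=> n a n1 a0 arho.
have y0 : 0 <= a ^+ 2 / (2 * m) by rewrite divr_ge0 ?sqr_ge0 ?mulr_ge0 ?(ltW m_gt0).
rewrite (cC n).1 (cC n).2; have [eE E0] := EP n.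
have [E1|E1] := leP 1 (E n).
  rewrite max_l ?subr_le0// mul0r oppr0.
  by apply: trivial_bound => //; exact: ltW.
rewrite max_r ?subr_ge0 ?(ltW E1)//.
apply: (le_trans (tail n a `|rho n| n1 a0 (le_trans arho (ler_norm _)) _)).
  exact: le_trans eE (ltW E1).
rewrite lee_fin -mulrA -expRD ler_wpM2l// ler_expR addrC lerD//.
by rewrite lerN2 ler_wpM2r// lerD2l lerN2.
Qed.
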